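(* Let $N\ge2$ be an integer, $\mu_0,\mu_1\in\mathcal P_2(\mathbb R^d)$, and let $(\gamma_n)_{n\ge0}$ be a sequence in $\Gamma(\mu_0,\mu_1)$ generated by reflow with minibatch OT with batch size $N$, i.e. $\gamma_0\in\Gamma(\mu_0,\mu_1)$ is arbitrary and for every $n\ge0$, $\gamma_n^{(N)}=\mathcal F_N(\gamma_n)$ and $\gamma_{n+1}\in\mathcal R(\gamma_n^{(N)})$. Let $\gamma$ be a limit point of $(\gamma_n)_n$ with respect to weak convergence, with interpolations $\mu_t$. If $\mu_0$ is absolutely continuous, then $\gamma$ is $N$-cyclically monotone, rectifiable, and straight in the sense that $\min_{w_t\in L^2(\mu_t)}\mathcal L(w_t|\gamma)=0$.
   Context: $\mathcal P_2(\mathbb R^m)$ denotes Borel probability measures with finite second moment, and $\Gamma(\mu_0,\mu_1)$ is the set of $\gamma\in\mathcal P_2(\mathbb R^d\times\mathbb R^d)$ with first marginal $\mu_0$ and second marginal $\mu_1$. Absolute continuity is with respect to Lebesgue measure. Minibatch OT operator: let $\Sigma_N$ be the group of permutations of $\{1,\dots,N\}$. Fix a Borel map $S=(S_1,\dots,S_N):(\mathbb R^d\times\mathbb R^d)^N\to(\mathbb R^d\times\mathbb R^d)^N$ which sends $(x^{(i)},y^{(i)})_{i=1}^N$ to $(x^{(i)},y^{(\sigma(i))})_{i=1}^N$, where $\sigma$ (depending measurably on the input, otherwise an arbitrary but fixed choice) satisfies $\sigma\in\arg\min_{\tau\in\Sigma_N}\sum_{i=1}^N\|x^{(i)}-y^{(\tau(i))}\|^2$.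 Set $\mathcal F_N(\gamma)=\frac1N\sum_{i=1}^N (S_i)_\#\gamma^{\otimes N}$. A plan $\gamma$ is $N$-cyclically monotone if for all $(x^{(1)},y^{(1)}),\dots,(x^{(N)},y^{(N)})\in\mathrm{supp}(\gamma)$ and all $\tau\in\Sigma_N$, $\sum_{i=1}^N\|x^{(i)}-y^{(i)}\|^2\le\sum_{i=1}^N\|x^{(i)}-y^{(\tau(i))}\|^2$. For $\gamma\in\Gamma(\mu_0,\mu_1)$ the interpolation $\mu_t$ ($t\in[0,1]$) is the law of $(1-t)x+ty$ under $\gamma$. The flow matching loss is $\mathcal L(w_t|\gamma)=\int_0^1\int\|w_t((1-t)x+ty)-y+x\|^2\,d\gamma(x,y)\,dt$; ''$w_t\in L^2(\mu_t)$'' means Borel vector fields $w:(t,x)\mapsto w_t(x)\in\mathbb R^d$ with $\int_0^1\int\|w_t\|^2d\mu_t\,dt<\infty$. The velocity field $v_t$ of $\gamma$ is the minimizer of $\mathcal L(\cdot|\gamma)$ over such fields; it is unique up to $\mu_t\otimes dt$-null sets. Weak rectified couplings: $\mathcal R(\gamma)$ is the set of all $\tilde\gamma$ for which there is a Borel probability measure $\Lambda$ on curves $\lambda:[0,1]\to\mathbb R^d$ (on $C([0,1];\mathbb R^d)$, concentrated on absolutely continuous curves) such that: (a) $\dot\lambda(t)=v_t(\lambda(t))$ for a.e. $t$ and $\Lambda$-a.e. $\lambda$; (b) $\int\psi\,d\mu_t=\int\psi(\lambda(t))\,d\Lambda(\lambda)$ for all $\psi\in C_c(\mathbb R^d)$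 and all $t\in[0,1]$; (c) $\int\psi(x,y)\,d\tilde\gamma(x,y)=\int\psi(\lambda(0),\lambda(1))\,d\Lambda(\lambda)$ for all $\psi\in C_c^\infty(\mathbb R^d\times\mathbb R^d)$. $\gamma$ is rectifiable if (for a suitable Borel representative of $v_t$) the flow ODE $\partial_t\Phi_t(x)=v_t(\Phi_t(x))$, $\Phi_0(x)=x$, has a unique solution on $[0,1]$ for $\mu_0$-almost every $x$ (solutions being absolutely continuous curves satisfying the ODE for a.e. $t$). *)

(* Defs.v *)
From HB Require Import structures.
From mathcomp Require Import all_boot all_order all_algebra perm.
From mathcomp Require Import all_classical all_reals all_analysis.

Set Implicit Arguments.
Unset Strict Implicit.
Unset Printing Implicit Defensive.

Import Order.TTheory GRing.Theory Num.Theory.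
Import numFieldNormedType.Exports.

Local Open Scope classical_set_scope.
Local Open Scope ring_scope.

(** [R^d] is ['rV[R]_d] with its Borel sigma-algebra.  On [R^d * R^d] the
    library's product sigma-algebra is used; it is the Borel one since [R^d] is
    second countable. *)
HB.instance Definition _ (R : realType) (d : nat) :=
  @isMeasurable.Build (sigma_display (@open 'rV[R]_d)) 'rV[R]_d
    <<s @open 'rV[R]_d >>
    (@sigma_algebra0 _ setT (@open 'rV[R]_d))
    (@sigma_algebraC 'rV[R]_d (@open 'rV[R]_d))
    (@sigma_algebra_bigcup _ setT (@open 'rV[R]_d)).

(** The library norm of ['rV[R]_d] is the sup norm, hence these. *)
Definition sqnorm (R : realType) (d : nat) (x : 'rV[R]_d) : R :=
  \sum_(i < d) x ord0 i ^+ 2.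

Definition enorm (R : realType) (d : nat) (x : 'rV[R]_d) : R :=
  Num.sqrt (sqnorm x).

Section power_measure.
Local Open Scope ereal_scope.
Context d (T : measurableType d) (R : realType) (mu : set T -> \bar R).

(** As for the library's [\x] and [pushforward], [mu] ranges over plain set
    functions; the values are the intended ones when [mu] is a sigma-finite
    measure. *)
Fixpoint power_measure (n : nat) : set (n.-tuple T) -> \bar R :=
  match n return set (n.-tuple T) -> \bar R with
  | 0 => \d_([tuple] : 0.-tuple T)
  | m.+1 => pushforward (mu \x @power_measure m)
              (fun p : T * m.-tuple T => [tuple of p.1 :: p.2])
  end.

End power_measure.
Arguments power_measure {d T R} mu n.

Definition lebesgue_rV (R : realType) (d : nat) : set 'rV[R]_d -> \bar R :=
  pushforward (power_measure (@lebesgue_measure R) d)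
    (fun t : d.-tuple (measurableTypeR R) => \row_i (tnth t i : R)).

Section couplings.
Local Open Scope ereal_scope.
Context (R : realType) (d : nat).
Local Notation E := 'rV[R]_d.

Definition second_moment_finite (mu : probability E R) : Prop :=
  \int[mu]_x (sqnorm x)%:E < +oo.

Definition coupling (mu0 mu1 : probability E R)
    (gam : probability (E * E)%type R) : Prop :=
  [/\ \int[gam]_z (sqnorm z.1 + sqnorm z.2)%:E < +oo,
      forall A, measurable A -> gam (fst @^-1` A) = mu0 A
    & forall A, measurable A -> gam (snd @^-1` A) = mu1 A].

Definition interpolation (gam : set (E * E) -> \bar R) (t : R) :
    set E -> \bar R :=
  pushforward gam (fun z : E * E => (1 - t) *: z.1 + t *: z.2)%R.

Definition support (gam : set (E * E) -> \bar R) : set (E * E) :=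
  [set z | forall U, open U -> U z -> 0 < gam U].

Definition cyclically_monotone (N : nat) (gam : set (E * E) -> \bar R) : Prop :=
  forall z : 'I_N -> E * E, (forall i, support gam (z i)) ->
  forall tau : 'S_N,
    (\sum_(i < N) sqnorm ((z i).1 - (z i).2) <=
     \sum_(i < N) sqnorm ((z i).1 - (z (tau i)).2))%R.

Definition weak_cvg (g : nat -> probability (E * E)%type R)
    (gam : probability (E * E)%type R) : Prop :=
  forall psi : E * E -> R, continuous psi ->
    (exists M : R, forall z, (`|psi z| <= M)%R) ->
    \int[g n]_z (psi z)%:E @[n --> \oo] --> \int[gam]_z (psi z)%:E.

Definition weak_limit_point (g : nat -> probability (E * E)%type R)
    (gam : probability (E * E)%type R) : Prop :=
  exists k : nat -> nat,
    {homo k : m n / (m < n)%N} /\ weak_cvg (g \o k) gam.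

End couplings.

Section minibatch.
Local Open Scope ereal_scope.
Context (R : realType) (d N : nat).
Local Notation E := 'rV[R]_d.

Record minibatch_selection := MinibatchSelection {
  selection :> N.-tuple (E * E) -> 'S_N ;
  selection_measurable :
    forall tau : 'S_N, measurable [set z | selection z = tau] ;
  selection_argmin : forall (z : N.-tuple (E * E)) (tau : 'S_N),
    (\sum_(i < N) sqnorm ((tnth z i).1 - (tnth z (selection z i)).2) <=
     \sum_(i < N) sqnorm ((tnth z i).1 - (tnth z (tau i)).2))%R
}.

Definition minibatch_map (S : minibatch_selection) (i : 'I_N)
    (z : N.-tuple (E * E)) : E * E :=
  ((tnth z i).1, (tnth z (S z i)).2).

Definition minibatch_ot (S : minibatch_selection) (gam : set (E * E) -> \bar R) :
    set (E * E) -> \bar R :=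
  fun A => (N%:R^-1)%:E *
    \sum_(i < N) pushforward (power_measure gam N) (minibatch_map S i) A.

End minibatch.

Section flow_matching.
Local Open Scope ereal_scope.
Context (R : realType) (d : nat).
Local Notation E := 'rV[R]_d.
Implicit Types (gam : set (E * E) -> \bar R) (w v : R -> E -> E).

Definition L2_field gam w : Prop :=
  measurable_fun ((`[0%R, 1%R]%classic : set (measurableTypeR R)) `*` [set: E])
    (fun p : measurableTypeR R * E => w p.1 p.2) /\
  \int[lebesgue_measure]_(t in `[0%R, 1%R])
    \int[interpolation gam t]_x (sqnorm (w t x))%:E < +oo.

Definition fm_loss w gam : \bar R :=
  \int[lebesgue_measure]_(t in `[0%R, 1%R])
    \int[gam]_z (sqnorm (w t ((1 - t) *: z.1 + t *: z.2) - z.2 + z.1)%R)%:E.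

Definition velocity_field gam v : Prop :=
  L2_field gam v /\ forall w, L2_field gam w -> fm_loss v gam <= fm_loss w gam.

Definition straight gam : Prop :=
  exists2 v, velocity_field gam v & fm_loss v gam = 0.

End flow_matching.

(** [C([0, 1]; R^d)] with the topology of uniform convergence and its Borel
    sigma-algebra. *)
Section curve_space.
Context (R : realType) (d : nat).
Local Notation E := 'rV[R]_d.

Definition unit_itv : Type := set_type (`[0, 1]%classic : set R).
HB.instance Definition _ := Topological.on unit_itv.

Definition curve : Type := continuousType unit_itv E.

Definition curve_open : set (set curve) :=
  @open (initial_topology (fun l : curve => (l : {uniform unit_itv -> E}))).

HB.instance Definition _ := Choice.on curve.
HB.instance Definition _ := isPointed.Build curve (cst (0 : E)).
HB.instance Definition _ :=
  @isMeasurable.Build (sigma_display curve_open) curve <<s curve_open >>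
    (@sigma_algebra0 _ setT curve_open)
    (@sigma_algebraC curve curve_open)
    (@sigma_algebra_bigcup _ setT curve_open).

End curve_space.

Section curves.
Context (R : realType) (d : nat).
Local Notation E := 'rV[R]_d.
Implicit Types (l : curve R d) (v : R -> E -> E).

(** Junk value [0] outside [[0, 1]]. *)
Definition path_of l : R -> E := 'valL_(0 : E) l.

Definition abs_continuous (f : R -> E) : Prop :=
  forall e : R, 0 < e -> exists2 del : R, 0 < del &
  forall (n : nat) (a b : 'I_n -> R),
    (forall i, 0 <= a i /\ a i <= b i /\ b i <= 1) ->
    (forall i j, i != j -> b i <= a j \/ b j <= a i) ->
    \sum_(i < n) (b i - a i) < del ->
    \sum_(i < n) enorm (f (b i) - f (a i)) < e.

Definition follows v l : Prop :=
  {ae @lebesgue_measure R, forall t, t \in `]0, 1[ ->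
     is_derive (t : R) (1 : R) (path_of l) (v t (path_of l t))}.

Definition flow_solution v (x : E) l : Prop :=
  [/\ path_of l 0 = x, abs_continuous (path_of l) & follows v l].

Definition rectifiable (gam : set (E * E) -> \bar R) : Prop :=
  exists2 v, velocity_field gam v &
    {ae pushforward gam fst, forall x, exists! l, flow_solution v x l}.

End curves.

Definition compactly_supported (R : realType) (V : topologicalType)
    (f : V -> R) : Prop :=
  compact (closure [set x | f x != 0]).

(** All iterated directional derivatives exist and are continuous. *)
Definition smooth (R : realType) (V : normedModType R) (f : V -> R) : Prop :=
  forall vs : seq V,
    let g := foldr (fun v h => 'D_v h) f vs in
    continuous g /\ forall v x, derivable g x v.

Section reflow.
Local Open Scope ereal_scope.
Context (R : realType) (d : nat).
Local Notation E := 'rV[R]_d.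

Definition weak_rectified (gam : set (E * E) -> \bar R)
    (tgam : probability (E * E)%type R) : Prop :=
  exists2 v, velocity_field gam v &
  exists Lambda : probability (curve R d) R,
  [/\ {ae Lambda, forall l, abs_continuous (path_of l)},
      {ae Lambda, forall l, follows v l},
      forall (psi : E -> R) (t : R), continuous psi -> compactly_supported psi ->
        t \in `[0%R, 1%R] ->
        \int[interpolation gam t]_x (psi x)%:E =
        \int[Lambda]_l (psi (path_of l t))%:E
    & forall psi : E * E -> R, smooth psi -> compactly_supported psi ->
        \int[tgam]_z (psi z)%:E =
        \int[Lambda]_l (psi (path_of l 0, path_of l 1))%:E].

End reflow.

(* Main.v *)
(** Idea.  Let [J] be the quadratic cost of a coupling.  Replacing the pairing of
    a batch by an optimal one lowers [J] by the mean gap of optimality, and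
    rectification does not increase [J] (projection in L^2, then Jensen along
    curves), so the gaps are summable along the iteration and the limit point has
    no gap on its support: it is N-cyclically monotone.

    For N >= 2 the support G is then monotone, so at each time 0 < t < 1 distinct
    segments [(1 - t) x + t y] of G are at distinct points.  The direction [y - x] is therefore a field
    on the union of their graphs, and it has zero loss.  Off this relatively closed
    set the field is a function of t alone that is integrable on no interval, so
    every integral curve stays on segments; the inequalities [t u' <= 2 u] and
    [- (1 - t) u' <= 2 u] for the squared distance [u] to a segment force it to be
    one segment.  Hence the flow from x is unique as soon as x has one image under G,
    which holds outside a Lebesgue null set: along a line parallel to an axis the
    corresponding coordinate of the images is monotone. *)
From HB Require Import structures.
Require Import Defs.
From mathcomp Require Import all_boot all_order all_algebra perm.
From mathcomp Require Import all_classical all_reals all_analysis.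
From mathcomp Require Import measurable_realfun.
From mathcomp Require Import ring lra.

Set Implicit Arguments.
Unset Strict Implicit.
Unset Printing Implicit Defensive.

Import Order.TTheory GRing.Theory Num.Theory.
Import numFieldNormedType.Exports.

Local Open Scope classical_set_scope.
Local Open Scope ring_scope.

(** * Borel sets of Euclidean spaces *)

(** The selection [S] is only measurable, so [minibatch_ot] cannot be passed to a weak limit; gaps
    are measured against one fixed permutation instead, which makes them continuous in the batch.
    The velocity field of the limit is determined up to null sets only, whereas uniqueness of the
    flow concerns every absolutely continuous curve, also one that leaves the segments. With the
    value 0 off a single segment, the curve resting at its starting point would be a second
    solution; this is why the free values are chosen so that no curve can follow them. The times 0
    and 1 stay degenerate, since several segments may share an endpoint. Curves are therefore
    compared with the segment met at time 1/2, and absolute continuity of [mu0] serves only to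
    decide which segment leaves x. The tests in [weak_rectified] have compact support and are smooth
    for the endpoint law, while the cost is unbounded and the field merely Borel. Hence the law of
    the curve at each time is identified as a measure, and the endpoint law enters only through an
    inequality of Fatou type. *)

Section second_countable.
Context (R : realType) (d : nat).
Local Notation E := 'rV[R]_d.

Lemma rV_ball (c : E) (r : R) : 0 < r ->
  ball c r = [set x | forall i, `|c ord0 i - x ord0 i| < r].
Proof.
move=> r0; apply/seteqP; split=> x /=.
  by move=> [_ xr] i; exact: xr.
move=> xr; split => // i j; rewrite ord1; exact: xr.
Qed.

Definition rat_ball (q : 'rV[rat]_d * rat) : set E :=
  ball (map_mx ratr q.1 : E) (ratr q.2 : R).

Lemma rat_ball_nbhs (x : E) (A : set E) : nbhs x A ->
  exists q, [/\ 0 < q.2, rat_ball q x & rat_ball q `<=` A].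
Proof.
move=> /nbhs_ballP[e /= e0 eA].
have [r /andP[r0 re]] : exists r : rat, 0 < (ratr r : R) < e / 2.
  have [r] := rat_in_itvoo (divr_gt0 e0 (ltr0n R 2)).
  by rewrite in_itv /=; exists r.
have cP (i : 'I_d) : exists q : rat, `|ratr q - x ord0 i| < (ratr r : R).
  have /rat_in_itvoo[q] : x ord0 i - ratr r < x ord0 i + ratr r by lra.
  rewrite in_itv/= => /andP[q1 q2]; exists q; rewrite ltr_norml; lra.
pose q : 'rV[rat]_d := \row_i sval (cid (cP i)).
have Bx : rat_ball (q, r) x.
  rewrite /rat_ball rV_ball//= => i; rewrite !mxE; exact: (svalP (cid (cP i))).
exists (q, r); split=> //; first by rewrite /= -(ltr0q R).
apply: subset_trans eA => y By.
have yq : ball (map_mx ratr q : E) (e/2) y.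
  by apply: le_ball By; exact: ltW.
apply: ball_split yq; apply: ball_sym.
by apply: le_ball Bx; exact: ltW.
Qed.

Lemma rV_ball_basis : exists B : set (set E), [/\ countable B, basis B &
  forall V, B V -> exists c r, 0 < r /\ V = ball c r].
Proof.
exists (rat_ball @` [set q | 0 < q.2]); split.
- by apply: (card_le_trans (card_image_le _ _)); exact: countableP.
- split=> [_ [q /= _ <-]|x A /rat_ball_nbhs[q [q0 qx qA]]]; first exact: ball_open.
  by exists (rat_ball q); first by split=> //; exists q.
- move=> _ [q q0 <-]; exists (map_mx ratr q.1), (ratr q.2).
  by rewrite ltr0q.
Qed.

Lemma second_countable_rV : @second_countable E.
Proof. by have [B [? ? _]] := rV_ball_basis; exists B. Qed.

End second_countable.

Lemma open_bigcup_basis (T : topologicalType) (B : set (set T)) (U : set T) :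
  basis B -> open U -> U = \bigcup_(V in [set V | B V /\ V `<=` U]) V.
Proof.
move=> [Bo Bb] oU; apply/seteqP; split=> [x Ux|x [V [_ VU] /VU]//].
have [V [BV Vx] VU] : filter_from [set U | B U /\ U x] id U.
  exact: (Bb x U (open_nbhs_nbhs (conj oU Ux))).
by exists V.
Qed.

Lemma countable_bigcup_measurable d (T : measurableType d) (I : Type) (B : set I)
    (F : I -> set T) :
  countable B -> (forall V, B V -> measurable (F V)) ->
  measurable (\bigcup_(V in B) F V).
Proof.
move=> /countable_injP[f finj] mB.
rewrite (_ : \bigcup_(V in B) F V =
  \bigcup_n \bigcup_(V in B `&` [set V | f V = n]) F V); last first.
  apply/seteqP; split=> [x [V BV FVx]|x [n _ [V [BV _] FVx]]]; last by exists V.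
  by exists (f V) => //; exists V.
apply: bigcupT_measurable => n.
have [[V [BV fV]]|nV] := pselect (exists V, B V /\ f V = n).
  rewrite (_ : \bigcup_(_ in _) _ = F V); first exact: mB.
  apply/seteqP; split=> [x [W [BW fW] FWx]|x FVx]; last by exists V.
  suff <- : W = V by [].
  by apply: finj; rewrite ?inE ?fV ?fW.
rewrite (_ : \bigcup_(_ in _) _ = set0) //.
by apply/seteqP; split=> // x [V [BV fV] _]; exfalso; apply: nV; exists V.
Qed.

Lemma countable_setX T1 T2 (A : set T1) (B : set T2) :
  countable A -> countable B -> countable (A `*` B).
Proof.
move=> /countable_injP[f finj] /countable_injP[g ginj].
suff : exists h : T1 * T2 -> nat, {in A `*` B &, injective h}.
  by move/countable_injP.
exists (fun p => pickle (f p.1, g p.2)) => -[a b] [a' b'].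
rewrite !inE/= => -[Aa Bb] [Aa' Bb'] /(pcan_inj pickleK)[fa gb].
by congr pair; [apply: finj; rewrite ?inE|apply: ginj; rewrite ?inE].
Qed.

Section open_prod.
Context d1 d2 (T1 : measurableType d1) (T2 : measurableType d2)
  (X1 X2 : topologicalType).

(** An open set of the product is a countable union of basic rectangles. The maps [f1] and [f2]
    allow the topology and the sigma-algebra to live on different types, as for [R] and
    [measurableTypeR R]. *)
Lemma open_setX_measurable (f1 : T1 -> X1) (f2 : T2 -> X2) (U : set (X1 * X2)) :
  @second_countable X1 -> @second_countable X2 ->
  (forall V, open V -> measurable (f1 @^-1` V)) ->
  (forall V, open V -> measurable (f2 @^-1` V)) ->
  open U -> measurable [set p | U (f1 p.1, f2 p.2)].
Proof.
move=> [B1 cB1 bB1] [B2 cB2 bB2] m1 m2 oU.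
pose C := [set V : set X1 * set X2 | [/\ B1 V.1, B2 V.2 & V.1 `*` V.2 `<=` U]].
rewrite (_ : [set p | _] = \bigcup_(V in C) ((f1 @^-1` V.1) `*` (f2 @^-1` V.2))).
  apply: countable_bigcup_measurable.
    apply: (@sub_countable _ _ _ (B1 `*` B2)); last exact: countable_setX.
    by apply: subset_card_le => -[V W] [].
  move=> -[V W] [/= BV BW _]; apply: measurableX.
    by apply: m1; exact: bB1.1.
  by apply: m2; exact: bB2.1.
apply/seteqP; split=> -[x y]/=.
  move=> Uxy; have [/= [P Q] [/= nP nQ] PQ] := open_nbhs_nbhs (conj oU Uxy).
  have [V [BV Vx] VP] : filter_from [set U | B1 U /\ U (f1 x)] id P
    by exact: bB1.2.
  have [W [BW Wx] WQ] : filter_from [set U | B2 U /\ U (f2 y)] id Q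
    by exact: bB2.2.
  exists (V, W) => //; split => //= -[a b] [/= Va Wb].
  by apply: PQ; split; [exact: VP|exact: WQ].
by move=> [[V W] [/= BV BW VW] [/= Vx Wy]]; exact: (VW (_, _)).
Qed.

End open_prod.

Section measurable_rV.
Context (R : realType) (d : nat).
Local Notation E := 'rV[R]_d.

Lemma open_measurable_rV (U : set E) : open U -> measurable U.
Proof. exact: sub_sigma_algebra. Qed.

Lemma open_measurable_rV2 (U : set (E * E)) : open U -> measurable U.
Proof.
move=> oU; rewrite (_ : U = [set p | U (p.1, p.2)]).
  apply: (@open_setX_measurable _ _ E E E E id id U) => //;
    by [exact: second_countable_rV|exact: open_measurable_rV].
by apply/seteqP; split=> -[].
Qed.

Lemma measurable_fun_open d' (T : measurableType d') (f : T -> E) :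
  (forall U, open U -> measurable (f @^-1` U)) -> measurable_fun setT f.
Proof.
move=> fo _ Y; rewrite setTI; move: Y; apply: smallest_sub; last exact: fo.
split => [|A mA|F mF].
- by rewrite /= preimage_set0.
- by rewrite /= setTD preimage_setC; exact: measurableC.
- by rewrite /= preimage_bigcup; exact: bigcupT_measurable.
Qed.

Lemma measurable_fun_real_open d' (T : measurableType d') (f : T -> R) :
  (forall U, open U -> measurable (f @^-1` U)) -> measurable_fun setT f.
Proof.
move=> fo; apply: (measurability _ (measurable_realfun.RGenOInfty.measurableE R)).
by move=> _ [_ [a ->] <-]; rewrite setTI; apply: fo; exact: interval_open.
Qed.

Lemma continuous_measurable_rV (f : E -> R) :
  continuous f -> measurable_fun setT f.
Proof.
move=> /continuousP cf; apply: measurable_fun_real_open => U oU.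
by apply: open_measurable_rV; exact: cf.
Qed.

Lemma continuous_measurable_rV2 (f : E * E -> R) :
  continuous f -> measurable_fun setT f.
Proof.
move=> /continuousP cf; apply: measurable_fun_real_open => U oU.
by apply: open_measurable_rV2; exact: cf.
Qed.

Lemma measurable_coord (i : 'I_d) : measurable_fun setT (fun x : E => x ord0 i).
Proof. by apply: continuous_measurable_rV => x; exact: coord_continuous. Qed.

(** Balls of the sup norm are finite intersections of conditions on single coordinates, and every
    open set is a countable union of balls. *)
Lemma measurable_fun_rVP d' (T : measurableType d') (D : set T) (f : T -> E) :
  measurable D ->
  (forall i, measurable_fun D (fun t => f t ord0 i)) -> measurable_fun D f.
Proof.
move=> mD mf _ Y; move: Y; apply: smallest_sub.
  split=> [|A mA|F mF].
  - by rewrite /= preimage_set0 setI0.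
  - rewrite /= setTD (_ : _ `&` _ = D `\` (D `&` f @^-1` A)); last first.
      by apply/seteqP; split=> x /=; tauto.
    exact: measurableD.
  - by rewrite /= preimage_bigcup setI_bigcupr; exact: bigcupT_measurable.
move=> U oU; have [B [cB bB ballB]] := @rV_ball_basis R d.
rewrite (open_bigcup_basis bB oU) preimage_bigcup setI_bigcupr.
apply: countable_bigcup_measurable.
  by apply: sub_countable cB; apply: subset_card_le => V [].
move=> _ [/ballB[c [r [r0 ->]]] _].
rewrite rV_ball// (_ : _ `&` _ =
    D `&` \bigcap_(i in [set: 'I_d]) (D `&` [set t | `|c ord0 i - f t ord0 i| < r])).
  apply: measurableI => //; apply: fin_bigcap_measurable => // i _.
  rewrite (_ : [set t | _] = (fun t => `|c ord0 i - f t ord0 i|) @^-1` `]-oo, r[).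
    by apply: measurableT_comp => //; exact: measurable_funB.
  by apply/seteqP; split=> t /=; rewrite in_itv.
by apply/seteqP; split=> [t [Dt /= ft]|t [Dt /= ft]]; split=> // i;
  [split=> //; exact: ft|have [] := ft i].
Qed.

End measurable_rV.

(** * Powers of a measure *)

Section of_set_function.
Local Open Scope ereal_scope.
Context d (T : measurableType d) (R : realType) (f : set T -> \bar R).

(** The proofs are carried as arguments so that measure structures can be attached to a copy of [f].
    This turns plain set functions such as [power_measure mu n] into bundled measures. *)
Definition of_set_function (_ : f set0 = 0) (_ : forall A, 0 <= f A)
  (_ : semi_sigma_additive f) (_ : sigma_finite setT f) := f.

Hypotheses (f0 : f set0 = 0) (f_ge0 : forall A, 0 <= f A)
  (f_add : semi_sigma_additive f) (f_fin : sigma_finite setT f).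

HB.instance Definition _ := isMeasure.Build _ _ _
  (of_set_function f0 f_ge0 f_add f_fin) f0 f_ge0 f_add.
HB.instance Definition _ := Measure_isSigmaFinite.Build _ _ _
  (of_set_function f0 f_ge0 f_add f_fin) f_fin.

Lemma ex_sigma_finite_measure :
  exists m : {sigma_finite_measure set T -> \bar R}, (m : set T -> \bar R) = f.
Proof. by exists (of_set_function f0 f_ge0 f_add f_fin). Qed.

End of_set_function.

Lemma product_measure_sigma_finite d1 d2 (T1 : measurableType d1)
    (T2 : measurableType d2) (R : realType)
    (m1 : {sigma_finite_measure set T1 -> \bar R})
    (m2 : {sigma_finite_measure set T2 -> \bar R}) :
  sigma_finite setT (m1 \x m2)%E.
Proof.
have /sigma_finiteP[F [FT ndF Foo]] := sigma_finiteT m1.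
have /sigma_finiteP[G [GT ndG Goo]] := sigma_finiteT m2.
exists (fun n => F n `*` G n); last first.
  move=> k; have [? ?] := Foo k; have [? ?] := Goo k.
  split; first exact: measurableX.
  by rewrite product_measure1E// lte_mul_pinfty// ge0_fin_numE.
apply/seteqP; split=> // -[x y] _.
have [n _ Fn] : (\bigcup_i F i) x by rewrite -FT.
have [k _ Gk] : (\bigcup_i G i) y by rewrite -GT.
exists (maxn n k) => //; split.
  by move: x Fn; exact/subsetPset/ndF/leq_maxl.
by move: y Gk; exact/subsetPset/ndG/leq_maxr.
Qed.

Section power_measure.
Local Open Scope ereal_scope.
Context d (T : measurableType d) (R : realType).

Let cons_tuple n (p : T * n.-tuple T) : n.+1.-tuple T :=
  [tuple of p.1 :: p.2].

Let measurable_cons_tuple n : measurable_fun setT (@cons_tuple n).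
Proof. exact: (measurable_cons measurable_fst measurable_snd). Qed.

Lemma ex_power_measure (mu : {sigma_finite_measure set T -> \bar R}) n :
  exists m : {sigma_finite_measure set (n.-tuple T) -> \bar R},
    (m : set _ -> \bar R) = power_measure mu n.
Proof.
elim: n => [|n [m mE]] /=.
  exact: (ex_intro _ [the {sigma_finite_measure set _ -> \bar R} of \d_([tuple] : 0.-tuple T)]).
rewrite -mE.
pose c := @cons_tuple n; pose mc := @measurable_cons_tuple n.
pose p := pushforward (mu \x m) c.
apply: ex_sigma_finite_measure.
- by rewrite /pushforward preimage_set0 measure0.
- by move=> A; exact: measure_ge0.
- exact: (@measure_semi_sigma_additive _ _ _
    [the {measure set _ -> \bar R} of @pushforward _ _ _ _ _ (mu \x m) c]).
have [F FT Ff] := product_measure_sigma_finite mu m.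
(* The inverse of [cons_tuple]; it pulls back the exhaustion of the product by sets of finite
   measure. *)
pose g (t : n.+1.-tuple T) : T * n.-tuple T := (thead t, [tuple of behead t]).
have mg : measurable_fun setT g.
  by apply/measurable_fun_pairP; split; [exact: measurable_tnth|exact: measurable_behead].
exists (fun i => g @^-1` F i).
  by rewrite -preimage_bigcup -FT preimage_setT.
move=> i; split; first by rewrite -[X in measurable X]setTI; apply: mg => //; exact: (Ff i).1.
rewrite /pushforward -comp_preimage (_ : g \o _ = id) ?preimage_id; first exact: (Ff i).2.
apply/funext => -[x t] /=; rewrite /g theadE; congr pair; exact: val_inj.
Qed.

Lemma power_measure_box (mu : {sigma_finite_measure set T -> \bar R}) n
    (A : 'I_n -> set T) : (forall i, measurable (A i)) ->
  power_measure mu n [set t | forall i, A i (tnth t i)] = \prod_i mu (A i).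
Proof.
elim: n A => [|n IH] A mA.
  rewrite big_ord0 /= diracE mem_set// => -[]//.
have [m mE] := ex_power_measure mu n.
rewrite big_ord_recl /= -IH// -mE /pushforward -product_measure1E//; last first.
  rewrite (_ : [set t | _] = \bigcap_(i in [set: 'I_n])
     (@tnth n T ^~ i @^-1` A (lift ord0 i))).
    apply: fin_bigcap_measurable => // i _; rewrite -[X in measurable X]setTI.
    exact: measurable_tnth.
  by apply/seteqP; split=> t At i => [_|]; exact: At.
congr (_ _); apply/seteqP; split=> -[x t] /=.
  move=> At; split=> [|i]; first exact: (At ord0).
  by have := At (lift ord0 i); rewrite tnthS; congr (A _ (tnth _ _)); exact: val_inj.
move=> [Ax At] i; case: (unliftP ord0 i) => [j|] -> //=.
by have := At j; rewrite tnthS.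
Qed.

(** The i-th marginal is read off on boxes that are full in all other coordinates, where each factor
    has mass 1. *)
Lemma integral_power_measure (P : probability T R) n (i : 'I_n)
    (f : T -> \bar R) : measurable_fun setT f -> (forall x, 0 <= f x) ->
  \int[power_measure P n]_t f (tnth t i) = \int[P]_x f x.
Proof.
move=> mf f0; have [m mE] := ex_power_measure P n; rewrite -mE.
have mi := @measurable_tnth _ T n i.
rewrite -[LHS](ge0_integral_pushforward mi m measurableT mf (fun x _ => f0 x)).
apply: eq_measure_integral => A mA _ /=; rewrite /pushforward.
rewrite -[LHS]/((m : set _ -> \bar R) _) mE.
rewrite (_ : _ @^-1` _ = [set t | forall j, (if j == i then A else setT) (tnth t j)]).
  apply: etrans (@power_measure_box P n (fun j => if j == i then A else setT) _) _.
    by move=> j; case: ifP.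
  rewrite (bigD1 i)//= eqxx big1 ?mule1// => j /negPf ->.
  exact: probability_setT.
apply/seteqP; split=> t /=; first by move=> At j; case: eqP => // ->.
by move=> /(_ i); rewrite eqxx.
Qed.

(** Tonelli with coordinate [i] integrated first. If [i] lies in the tail, induction applies to the
    sections at a fixed head; if it is the head, the product measure is rewritten in the other
    order. *)
Lemma power_measure_slice0 (mu : {sigma_finite_measure set T -> \bar R}) n
    (i : 'I_n) (A : set (n.-tuple T)) : measurable A ->
  (forall t, mu [set s | A [tuple (if j == i then s else tnth t j) | j < n]] = 0) ->
  power_measure mu n A = 0.
Proof.
elim: n i A => [[]//|n IH] i A mA A0.
have [m mE] := ex_power_measure mu n.
have mc : measurable (@cons_tuple n @^-1` A).
  by rewrite -[X in measurable X]setTI; exact: measurable_cons_tuple.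
rewrite /= -mE /pushforward; case: (unliftP ord0 i) => [j ij|i0].
  rewrite /product_measure1 integral0_eq// => x _ /=.
  rewrite -[LHS]/((m : set _ -> \bar R) _) mE.
  apply: (IH j) => [|t]; first exact: measurable_xsection.
  rewrite -[RHS](A0 [tuple of x :: t]); congr (mu _).
  have E s : cons_tuple (x, [tuple (if k == j then s else tnth t k) | k < n]) =
      [tuple (if k == i then s else tnth [tuple of x :: t] k) | k < n.+1].
    apply: eq_from_tnth => k; rewrite tnth_mktuple ij.
    case: (unliftP ord0 k) => [k' ->|->] //.
    by rewrite (inj_eq lift_inj) /cons_tuple !tnthS tnth_mktuple.
  by apply/seteqP; split=> s; rewrite /xsection/= inE /=;
    have := E s; rewrite /cons_tuple /= => ->.
rewrite (@product_measure_unique _ _ _ _ _ mu m (mu \x^ m))//; last first.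
  by move=> B C mB mC; exact: product_measure2E.
rewrite /= /product_measure2 integral0_eq// => t _ /=.
(* The slice hypothesis asks for a full tuple, so a dummy head [s0] is needed; if [T] is empty there
   is none, but then the section is empty as well. *)
have [s0|/set0P[s0 _]] := eqVneq [set: T] set0.
  rewrite (_ : ysection _ _ = set0) ?measure0//.
  by rewrite -subset0 -s0.
rewrite -[RHS](A0 [tuple of s0 :: t]); congr (mu _).
apply/seteqP; split=> s; rewrite /ysection/= inE /=; congr (A _).
  apply: eq_from_tnth => k; rewrite tnth_mktuple i0.
  by case: (unliftP ord0 k) => [k' ->|->] //; rewrite /cons_tuple !tnthS.
apply: eq_from_tnth => k; rewrite tnth_mktuple i0.
by case: (unliftP ord0 k) => [k' ->|->] //; rewrite /cons_tuple !tnthS.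
Qed.

End power_measure.

(** * Null sets of Lebesgue measure on R^d *)

Section lebesgue_rV.
Context (R : realType) (d : nat).
Local Notation E := 'rV[R]_d.

Lemma measurable_row_of_tuple :
  measurable_fun setT (fun t : d.-tuple (measurableTypeR R) => \row_i (tnth t i : R) : E).
Proof.
apply: measurable_fun_rVP => // i.
rewrite (_ : (fun t => _) = (fun t => tnth t i)); last by apply/funext => t; rewrite mxE.
exact: measurable_tnth.
Qed.

Lemma lebesgue_rV_countable_lines (A : set E) (i : 'I_d) : measurable A ->
  (forall x : E, countable [set s | A (\row_j if j == i then s else x ord0 j)]) ->
  lebesgue_rV A = 0%E.
Proof.
move=> mA cA; rewrite /lebesgue_rV /pushforward.
apply: (@power_measure_slice0 _ _ _ lebesgue_measure d i).
  by rewrite -[X in measurable X]setTI; exact: measurable_row_of_tuple.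
move=> t; apply: countable_lebesgue_measure0.
have := cA (\row_j tnth t j); congr (countable _).
apply/seteqP; split=> s /=; congr (A _); apply/rowP => j;
  by rewrite !mxE tnth_mktuple.
Qed.

End lebesgue_rV.

Lemma ae_mono2 d (T : measurableType d) (R : realType)
    (mu : {measure set T -> \bar R}) (P Q S : T -> Prop) :
  (forall x, P x -> Q x -> S x) ->
  {ae mu, forall x, P x} -> {ae mu, forall x, Q x} -> {ae mu, forall x, S x}.
Proof.
by move=> PQS aP aQ; apply: (@filterS2 _ _ (ae_filter_ringOfSetsType mu) _ _ _ _ aP aQ).
Qed.

(** * Absolutely continuous functions *)

Section ac_real.
Context (R : realType).
Implicit Types (f g : R -> R) (a b c x y t e r : R).
Local Notation mu := (@lebesgue_measure R).

Definition ac_real g : Prop :=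
  forall e, 0 < e -> exists2 del, 0 < del &
  forall (n : nat) (a b : 'I_n -> R),
    (forall i, 0 <= a i /\ a i <= b i /\ b i <= 1) ->
    (forall i j, i != j -> b i <= a j \/ b j <= a i) ->
    \sum_(i < n) (b i - a i) < del ->
    \sum_(i < n) `|g (b i) - g (a i)| < e.

(** The interval straddles [t], which need not be one of its endpoints: the bound is the sum of two
    one-sided ones. This form suits the supremum argument in [ac_nonincreasing]. *)
Lemma derive_le0_increment g t D e : is_derive t (1 : R) g D -> D <= 0 -> 0 < e ->
  exists2 r, 0 < r & forall x y, x <= t <= y -> t - r < x -> y < t + r ->
    g y - g x <= e * (y - x).
Proof.
move=> [dg Dg] D0 e0.
have : h^-1 *: ((g \o shift t) (h *: (1 : R)) - g t) @[h --> 0^'] --> D.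
  by rewrite -Dg; exact: dg.
move=> /cvgrPdist_lt /(_ _ e0) /nbhs_ballP[r /= r0 rP].
have q h : h != 0 -> `|h| < r -> h^-1 * (g (t + h) - g t) <= e.
  move=> h0 hr.
  have := rP h; rewrite /ball/= sub0r normrN => /(_ hr h0).
  rewrite /= [h *: _]mulr1 [h + t]addrC ltr_norml => /andP[+ _].
  rewrite /GRing.scale/=; lra.
have qp y : t <= y -> y < t + r -> g y - g t <= e * (y - t).
  rewrite le_eqVlt => /predU1P[<-|ty] yr; first by rewrite !subrr mulr0.
  have h0 : 0 < y - t by rewrite subr_gt0.
  have := q (y - t); rewrite gt_eqF// gtr0_norm// => /(_ isT).
  rewrite subrKC mulrC ler_pdivrMr// => ->//; lra.
have qn x : x <= t -> t - r < x -> g t - g x <= e * (t - x).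
  rewrite le_eqVlt => /predU1P[<-|ty] yr; first by rewrite !subrr mulr0.
  have h0 : x - t < 0 by rewrite subr_lt0.
  have := q (x - t); rewrite lt_eqF// ltr0_norm// => /(_ isT).
  rewrite subrKC mulrC ler_ndivrMr//.
  rewrite opprB => /(_ _)/wrap[]; lra.
exists r => // x y /andP[xt ty] rx yr.
have := qp y ty yr; have := qn x xt rx; lra.
Qed.

(** The intervals are listed from right to left. *)
Fixpoint chain (U : set R) a x (s : seq (R * R)) : Prop :=
  if s is p :: s' then
    [/\ p.2 <= x, p.1 <= p.2, `[p.1, p.2]%classic `<=` U & chain U a p.1 s']
  else a <= x.

Lemma chain_le (U : set R) a x y s : x <= y -> chain U a x s -> chain U a y s.
Proof.
case: s => [|p s] /= xy; first by move=> /le_trans; exact.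
by move=> [px p12 pU cs]; split => //; exact: le_trans xy.
Qed.

Lemma chain_nth (U : set R) a x s : chain U a x s ->
  a <= x /\
  (forall i, (i < size s)%N -> [/\ a <= (nth (0, 0) s i).1,
    (nth (0, 0) s i).1 <= (nth (0, 0) s i).2 & (nth (0, 0) s i).2 <= x]) /\
  (forall i j, (i < j < size s)%N -> (nth (0, 0) s j).2 <= (nth (0, 0) s i).1).
Proof.
elim: s x => [|p s IH] x /=.
  by move=> ax; do 2!split=> //; move=> i j; rewrite ltn0 andbF.
move=> [px p12 pU /IH[ap [Hi Hij]]].
have px' := le_trans p12 px.
split; first exact: le_trans px'.
split=> [[|i] /= si|[|i] [|j] //= ij].
- by split.
- have [? ? ?] := Hi i si; split => //; exact: le_trans px'.
- by have [] := Hi j ij.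
- exact: Hij.
Qed.

(** The half-open versions of the intervals are disjoint even when neighbours share an endpoint, and
    all of them lie in [U]. *)
Lemma chain_length (U : set R) a x s : open U -> chain U a x s ->
  ((\sum_(p <- s) (p.2 - p.1))%:E <= mu (U `&` `]a, x]))%E.
Proof.
move=> oU; have mU : measurable U by exact: open_measurable.
elim: s x => [|p s IH] x /=; first by rewrite big_nil measure_ge0.
move=> [px p12 pU cs]; rewrite big_cons EFinD.
have [ap _] := chain_nth cs.
apply: (@le_trans _ _ (mu (`]p.1, p.2] `|` (U `&` `]a, p.1]))))%E.
  rewrite measureU//=; last 2 first.
  - exact: measurableI.
  - apply/seteqP; split => // y /= []; rewrite !in_itv/= => /andP[py _] [_ /andP[_]].
    by rewrite leNgt py.
  apply: leeD; last exact: IH.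
  rewrite lebesgue_measure_itv/= lte_fin; case: ltP => // p21.
  by rewrite lee_fin subr_le0.
apply: le_measure; rewrite ?inE; [|exact: measurableI|].
  by apply: measurableU => //; exact: measurableI.
move=> y /= [|[Uy]]; rewrite !in_itv/=.
  move=> /andP[py yp]; split; first by apply: pU; rewrite /= in_itv/= (ltW py).
  by rewrite (le_lt_trans ap py) (le_trans yp px).
by move=> /andP[-> yp]; split=> //=; rewrite (le_trans yp)// (le_trans p12).
Qed.

(** The exceptional null set is covered by an open set [U] so small that, by absolute continuity,
    [g] varies by less than [e] over disjoint intervals in [U]. When an interval is grown from [a],
    each point is passed either inside [U], at the price of the variation over one more interval, or
    by means of the derivative, at the price of [e] times the length. *)
Lemma ac_nonincreasing g a b : ac_real g -> 0 <= a -> a <= b -> b <= 1 ->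
  {ae mu, forall t, t \in `]a, b[ -> exists2 D, is_derive t (1 : R) g D & D <= 0} ->
  g b <= g a.
Proof.
move=> acg a0 ab b1 [N [mN N0 Nsub]].
suff H e : 0 < e -> g b - g a <= e * (b - a) + e.
  rewrite -subr_le0; apply/ler_addgt0Pl => e e0.
  rewrite addr0; have /H : 0 < e / (b - a + 1) by rewrite divr_gt0//; lra.
  move/le_trans; apply; rewrite -{2}[e / _]mulr1 -mulrDr.
  by rewrite divfK//; apply/eqP; lra.
move=> e0; have [del del0 acd] := acg _ e0.
(* The derivative is controlled only in the open interval, so the endpoints join the exceptional
   set. *)
pose N' := N `|` [set a; b].
have mN' : measurable N' by apply: measurableU => //; exact: measurableU.
have N'0 : mu N' = 0%E.
  apply/eqP; rewrite eq_le measure_ge0 andbT.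
  have ab0 : mu [set a; b] = 0%E.
    by apply: countable_lebesgue_measure0; exact: finite_set_countable.
  apply: (@le_trans _ _ (mu N + mu [set a; b])%E); last by rewrite N0 ab0 adde0.
  by apply: measureU2 => //; exact: measurableU.
have N'oo : (mu N' < +oo)%E by rewrite N'0 ltry.
have [U [oU NU Udel]] := lebesgue_regularity_outer mN' N'oo del0.
have {}Udel : (mu U < del%:E)%E.
  apply: le_lt_trans Udel; rewrite -{1}(setDUK NU) .
  apply: (@le_trans _ _ (mu N' + mu (U `\` N'))%E); last by rewrite N'0 add0e.
  by apply: measureU2 => //; apply: measurableD => //; exact: open_measurable.
(* The points reached at the allowed price. By [loc], each point has a neighbourhood across which
   membership in [T] is carried from left to right, so the supremum of [T] belongs to [T] and equals
   [b]. *)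
pose T := [set x | a <= x <= b /\ exists2 s, chain U a x s &
  g x - g a <= e * (x - a) + \sum_(p <- s) `|g p.2 - g p.1|].
have Ta : T a.
  split; first by rewrite lexx.
  by exists [::]; rewrite /= ?big_nil ?subrr ?mulr0 ?addr0.
have loc c : a <= c <= b -> exists2 r, 0 < r & forall x y, x <= c <= y -> y <= b ->
    c - r < x -> y < c + r -> T x -> T y.
  move=> cab.
  have [Uc|nUc] := pselect (U c).
    have /nbhs_ballP[r /= r0 rU] : nbhs c U by exact: open_nbhs_nbhs.
    exists r => // x y /andP[xc cy] yb rx yr [/andP[ax xb] [s cs gs]].
    split; first by rewrite (le_trans ax (le_trans xc cy)).
    exists ((x, y) :: s) => /=.
      split => //; first exact: le_trans cy.
      move=> z /=; rewrite in_itv/= => /andP[xz zy]; apply: rU.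
      by rewrite /ball/= ltr_norml; lra.
    rewrite big_cons/=; have := ler_norm (g y - g x).
    have : 0 <= e * (y - x) by rewrite mulr_ge0//; lra.
    lra.
  have [D dD D0] : exists2 D, is_derive c (1 : R) g D & D <= 0.
    apply: contrapT => nD; apply/nUc/NU; left; apply: Nsub => /= /(_ _)/wrap[]//.
    rewrite in_itv/= !lt_neqAle (andP cab).1 (andP cab).2 !andbT.
    by apply/andP; split; apply/eqP => cE; apply/nUc/NU; right; [left|right].
  have [r r0 rP] := derive_le0_increment dD D0 e0.
  exists r => // x y xcy yb rx yr [/andP[ax xb] [s cs gs]].
  have xy : x <= y by case/andP: xcy => /le_trans; exact.
  split; first by rewrite (le_trans ax xy).
  exists s; first exact: chain_le cs.
  have := rP x y xcy rx yr; lra.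
have supT : has_sup T.
  by split; [exists a|exists b => x [/andP[]]].
pose c := sup T.
have cab : a <= c <= b.
  rewrite ub_le_sup//=; last by case: supT.
  by apply: ge_sup; [exists a|move=> x [/andP[]]].
have [r r0 rP] := loc c cab.
have [x Tx rx] := sup_adherent r0 supT.
have xc : x <= c by apply: ub_le_sup => //; case: supT.
have bc : c = b.
  apply/eqP; rewrite eq_le (andP cab).2/= leNgt; apply/negP => cb.
  have Ty : T (Num.min b (c + r / 2)).
    apply: (rP x) => //.
    - by rewrite xc/= le_min (ltW cb)/=; lra.
    - by rewrite ge_min lexx.
    - by rewrite gt_min; apply/orP; right; lra.
  have : Num.min b (c + r / 2) <= c by apply: ub_le_sup => //; case: supT.
  by rewrite ge_min; apply/negP; rewrite negb_or -!ltNge cb/=; lra.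
have [_ [s cs gs]] : T b.
  by rewrite -bc; apply: (rP x) => //; rewrite ?xc ?lexx ?(andP cab).2//; lra.
apply: le_trans gs _; rewrite lerD2l.
have [_ [si sij]] := chain_nth cs.
have slen : \sum_(p <- s) (p.2 - p.1) < del.
  rewrite -lte_fin; apply: le_lt_trans (chain_length oU cs) _.
  apply: le_lt_trans Udel; apply: le_measure; rewrite ?inE.
  - by apply: measurableI => //; exact: open_measurable.
  - exact: open_measurable.
  - exact: subIsetl.
have := acd (size s) (fun i => (nth (0, 0) s i).1) (fun i => (nth (0, 0) s i).2).
rewrite !(big_nth (0, 0)) !big_mkord in slen *.
move=> /(_ _ _ slen)/ltW; apply.
  by move=> i; have [] := si i (ltn_ord i) => *; lra.
move=> i j ij; have : (i != j :> nat) by [].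
rewrite neq_ltn => /orP[lt_ij|lt_ji]; [right|left].
  by apply: sij; rewrite lt_ij ltn_ord.
by apply: sij; rewrite lt_ji ltn_ord.
Qed.

Lemma ac_real_uniform g e : ac_real g -> 0 < e ->
  exists2 del : R, 0 < del & forall x y : R, 0 <= x -> x <= y -> y <= 1 ->
    y - x < del -> `|g y - g x| < e.
Proof.
move=> ag e0; have [del del0 H] := ag e e0; exists del => // x y x0 xy y1 xyd.
have := H 1%N (fun=> x) (fun=> y); rewrite !big_ord1; apply=> //.
by move=> i i'; rewrite !ord1.
Qed.

End ac_real.

Section ac_integral.
Context (R : realType).
Local Notation mu := (@lebesgue_measure R).

Lemma ac_realB (f g : R -> R) : ac_real f -> ac_real g -> ac_real (f \- g).
Proof.
move=> af ag e e0; have e20 : 0 < e / 2 by lra.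
have [df df0 Hf] := af _ e20; have [dg dg0 Hg] := ag _ e20.
exists (Num.min df dg); first by rewrite lt_min df0.
move=> n a b ab dis; rewrite lt_min => /andP[sf sg].
apply: (@le_lt_trans _ _ (\sum_(i < n) `|f (b i) - f (a i)| +
    \sum_(i < n) `|g (b i) - g (a i)|)).
  rewrite -big_split/=; apply: ler_sum => i _.
  rewrite [X in `|X|](_ : _ = (f (b i) - f (a i)) - (g (b i) - g (a i))); last by ring.
  exact: ler_normB.
have := Hf n a b ab dis sf; have := Hg n a b ab dis sg; lra.
Qed.

Lemma ac_real_primitive (f : R -> R) :
  mu.-integrable setT (EFin \o f) -> (forall t, 0 <= f t) ->
  ac_real (fun x => \int[mu]_(t in `]-oo, x]) f t)%R.
Proof.
move=> intf f0 e e0.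
have [del [del0 delP]] := integral_normr_continuous intf e0.
have nf : (fun x => `|f x|) = f by apply/funext => x; rewrite ger0_norm.
rewrite nf in delP.
exists del => // n a b ab dis sdel.
pose A i := (`]a i, b i]%classic : set R).
have tA : trivIset [set` index_enum 'I_n] A.
  apply/trivIsetP => i j _ _ ij; apply/seteqP; split => // x /=.
  rewrite /A /= !in_itv/= => -[/andP[aix xbi] /andP[ajx xbj]].
  by case: (dis i j ij) => h; [have := lt_le_trans ajx xbi|have := lt_le_trans aix xbj]; lra.
have mAi i : measurable (A i) by exact: measurable_itv.
have mA : measurable (\big[setU/set0]_(i < n) A i) by exact: bigsetU_measurable.
have muA : mu (\big[setU/set0]_(i < n) A i) = (\sum_(i < n) (b i - a i))%:E.
  rewrite measure_bigsetU_ord_cond//; last first.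
    by apply: sub_trivIset tA => i _ /=; rewrite mem_index_enum.
    by move=> i _; exact: mAi.
  rewrite -sumEFin; apply: eq_bigr => i _.
  rewrite -[LHS]/(mu (A i)) /A lebesgue_measure_itv/= lte_fin.
  have [_ [+ _]] := ab i; rewrite le_eqVlt => /predU1P[->|->]//.
  by rewrite ltxx subrr.
have Adel : (mu (\big[setU/set0]_(i < n) A i) < del%:E)%E by rewrite muA lte_fin.
apply: le_lt_trans (delP _ mA Adel).
rewrite -lee_fin /Rintegral fineK; last first.
  by apply: integrable_fin_num => //; apply: integrableS intf.
rewrite ge0_integral_bigsetU//=; last 3 first.
- exact: index_enum_uniq.
- apply/measurable_EFinP; apply: measurableT_comp => //.
  apply: (@measurable_funS _ _ _ _ setT) => //.
  by have /measurable_int/measurable_EFinP := intf.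
- by move=> x _; rewrite lee_fin.
rewrite -sumEFin; apply: lee_sum => i _.
have [_ [aibi _]] := ab i.
have intD (D : set R) : measurable D -> mu.-integrable D (EFin \o f).
  by move=> mD; apply: integrableS intf.
rewrite (Rintegral_itvB (a := -oo%O) (b := BRight (b i)))//=; last exact: intD.
rewrite ger0_norm; last by apply: Rintegral_ge0 => x _; exact: f0.
rewrite /Rintegral fineK; last by apply: integrable_fin_num => //; exact: intD.
by [].
Qed.

(** Subtracting the primitive of [H], whose derivative is [H] almost everywhere, reduces the claim
    to [ac_nonincreasing]. Only an upper bound of the derivative enters; a non-integrable [H] makes
    the right-hand side infinite. *)
Lemma ac_le_integral (g H : R -> R) : ac_real g ->
  measurable_fun (`[0, 1]%classic : set (measurableTypeR R)) H -> (forall t : R, t \in `[0, 1] -> 0 <= H t) ->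
  {ae mu, forall t : R, t \in `]0, 1[ ->
    exists2 D, is_derive t (1 : R) g D & D <= H t} ->
  ((g 1 - g 0)%:E <= \int[mu]_(t in `[0%R, 1%R]) (H t)%:E)%E.
Proof.
move=> acg mH H0 dg.
have [oo|foo] := eqVneq (\int[mu]_(t in `[0%R, 1%R]) (H t)%:E)%E +oo%E.
  by rewrite oo leey.
have intH : mu.-integrable (`[0, 1]%classic : set (measurableTypeR R)) (EFin \o H).
  apply/integrableP; split; first exact/measurable_EFinP.
  rewrite -ltey in foo; apply: le_lt_trans foo; apply: ge0_le_integral => //=.
  - exact/measurable_EFinP/measurableT_comp.
  - exact/measurable_EFinP.
  - by move=> x x01; rewrite ger0_norm// H0.
pose f := H \_ `[0, 1]%classic.
have intf : mu.-integrable setT (EFin \o f).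
  by rewrite /f -restrict_EFin; apply/(integrable_mkcond _ _).1.
have f0 t : 0 <= f t by rewrite /f patchE; case: ifPn => // /set_mem /H0.
pose F x := (\int[mu]_(t in `]-oo, x]) f t)%R.
have acF : ac_real F := ac_real_primitive intf f0.
have intD (D : set R) : measurable D -> mu.-integrable D (EFin \o f).
  by move=> mD; apply: integrableS intf.
have dF : {ae mu, forall x : R, derivable F x 1 /\ derive1 F x = f x}.
  apply: FTC1Ny; first by move=> y; exact: intD.
  exact: open_integrable_locally openT intf.
have : (g \- F) 1 <= (g \- F) 0.
  apply: ac_nonincreasing => //; first exact: ac_realB.
  apply: ae_mono2 dg dF => t dgt [dFt F't] t01.
  have [D dD DH] := dgt t01; exists (D - f t).
    have dF' : is_derive t (1 : R) F (f t).
      by apply: DeriveDef; [exact: dFt|rewrite -F't derive1E].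
    exact: is_deriveB.
  rewrite subr_le0 (le_trans DH)// /f patchE mem_set//=.
  by move: t01; rewrite !in_itv/= => /andP[/ltW-> /ltW->].
rewrite /= => gF.
have gF' : g 1 - g 0 <= F 1 - F 0 by lra.
apply: (@le_trans _ _ (F 1 - F 0)%:E); first by rewrite lee_fin.
rewrite /F (Rintegral_itvB (a := -oo%O) (b := BRight 1)) //=; last 2 first.
- exact: intD.
- by rewrite bnd_simp.
rewrite /Rintegral fineK; last by apply: integrable_fin_num => //; exact: intD.
rewrite integral_mkcond [leRHS]integral_mkcond.
apply: ge0_le_integral => //=.
- by move=> x _; rewrite patchE; case: ifP => // _; rewrite lee_fin.
- apply/(measurable_restrictT _ _).1 => //.
  by have /measurable_int := intD _ (measurable_itv `]0%R, 1%R]).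
- apply/(measurable_restrictT _ _).1 => //; exact/measurable_EFinP.
- move=> x _; rewrite !patchE; case: ifPn => [/set_mem x01|_].
    rewrite /= (_ : x \in `[0, 1]%classic) /f ?patchE.
      by rewrite mem_set//=; move: x01; rewrite /= !in_itv/= => /andP[/ltW-> ->].
    by rewrite mem_set//=; move: x01; rewrite /= !in_itv/= => /andP[/ltW-> ->].
  by case: ifPn => // /set_mem /H0; rewrite lee_fin.
Qed.

End ac_integral.

(** * Compactly supported and smooth test functions *)

Section test_functions.
Context (R : realType).

Lemma compactly_supported_sub (V : topologicalType) (f : V -> R) (K : set V) :
  compact K -> closed K -> (forall x, f x != 0 -> K x) -> compactly_supported f.
Proof.
move=> cK clK fK; apply: (subclosed_compact _ cK); first exact: closed_closure.
by rewrite [X in _ `<=` X](closure_id K).1 //; apply: closure_subset.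
Qed.

Lemma closed_norm_le (V : normedModType R) (M : R) :
  closed [set x : V | `|x| <= M].
Proof.
rewrite (_ : [set _ | _] = Num.norm @^-1` [set y | y <= M]) //.
by apply: closed_comp => [x _|]; [exact: norm_continuous|exact: closed_le].
Qed.

Lemma compact_norm_le (d : nat) (M : R) : compact [set x : 'rV[R]_d | `|x| <= M].
Proof.
apply: bounded_closed_compact; last exact: closed_norm_le.
by exists M; split=> [|N MN x /= xM]; [exact: num_real|exact: le_trans xM (ltW MN)].
Qed.

Lemma compactly_supported_rV (d : nat) (f : 'rV[R]_d -> R) (M : R) :
  (forall x, f x != 0 -> `|x| <= M) -> compactly_supported f.
Proof.
apply: compactly_supported_sub; first exact: compact_norm_le.
exact: closed_norm_le.
Qed.

Lemma compactly_supported_rV2 (d : nat) (f : 'rV[R]_d * 'rV[R]_d -> R) (M : R) :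
  (forall x, f x != 0 -> `|x.1| <= M /\ `|x.2| <= M) -> compactly_supported f.
Proof.
move=> fM; apply: (@compactly_supported_sub _ _
    ([set x | `|x| <= M] `*` [set x | `|x| <= M])) => //.
- by apply: compact_setX; exact: compact_norm_le.
- rewrite (_ : _ `*` _ = fst @^-1` [set x | `|x| <= M] `&` snd @^-1` [set x | `|x| <= M]) //.
  by apply: closedI; apply: closed_comp => [x _|];
    [exact: cvg_fst|exact: closed_norm_le|exact: cvg_snd|exact: closed_norm_le].
Qed.

(** A cone of slope [k] truncated at height 1; as [k] grows it fills the ball of centre [c] and
    radius [r]. *)
Definition hat (V : normedModType R) (k : R) (c : V) (r : R) (x : V) : R :=
  Num.max 0 (Num.min 1 (k * (r - `|c - x|))).

Lemma hat_itv (V : normedModType R) k (c : V) r x : 0 <= hat k c r x <= 1.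
Proof. by rewrite /hat le_max lexx/= ge_max ler01 ge_min lexx. Qed.

Lemma hat_neq0 (V : normedModType R) k (c : V) r x : 0 <= k -> hat k c r x != 0 ->
  `|c - x| < r.
Proof.
move=> k0; rewrite /hat; apply: contraR; rewrite -leNgt => rx; apply/eqP.
rewrite max_l// ge_min; apply/orP; right.
by rewrite mulr_ge0_le0// subr_le0.
Qed.

Lemma hat_eq1 (V : normedModType R) k (c : V) r x : 1 <= k * (r - `|c - x|) ->
  hat k c r x = 1.
Proof. by move=> h; rewrite /hat min_l// max_r. Qed.

Lemma hat_continuous (V : normedModType R) k (c : V) r : continuous (hat k c r).
Proof.
move=> x; apply: (@continuous_max R V (fun=> 0) _ x); first exact: cvg_cst.
apply: (@continuous_min R V (fun=> 1) _ x); first exact: cvg_cst.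
apply: continuousM; first exact: cvg_cst.
apply: continuousB; first exact: cvg_cst.
apply: (@continuous_comp _ _ _ (fun x => c - x) Num.norm); last exact: norm_continuous.
by apply: continuousB; [exact: cvg_cst|exact: cvg_id].
Qed.

Section max_hat.
Context (d : nat) (c : nat -> 'rV[R]_d) (r : nat -> R).

(** For [k = n] these finite maxima converge pointwise to the indicator of the union of all the
    balls, while each of them has bounded support. *)
Fixpoint max_hat (k : R) (n : nat) (x : 'rV[R]_d) : R :=
  if n is n'.+1 then Num.max (max_hat k n' x) (hat k (c n') (r n') x) else 0.

Lemma max_hat_itv k n x : 0 <= max_hat k n x <= 1.
Proof.
elim: n => [|n /= /andP[h0 h1]]; first by rewrite lexx ler01.
by rewrite le_max h0/= ge_max h1; have /andP[] := hat_itv k (c n) (r n) x.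
Qed.

Lemma max_hat_continuous k n : continuous (max_hat k n).
Proof.
elim: n => [|n IH] x; first exact: (@cst_continuous _ R 0).
by apply: (@continuous_max R _ (max_hat k n)); [exact: IH|exact: hat_continuous].
Qed.

Lemma max_hat_neq0 k n x : 0 <= k -> max_hat k n x != 0 ->
  exists m, `|c m - x| < r m.
Proof.
move=> k0; elim: n => [|n IH] /=; first by rewrite eqxx.
have [h|/negPf h] := boolP (hat k (c n) (r n) x == 0); last first.
  by move=> _; exists n; apply: (hat_neq0 k0); rewrite h.
rewrite (eqP h) max_l//; by have /andP[] := max_hat_itv k n x.
Qed.

Lemma max_hat_compact k n : 0 <= k -> compactly_supported (max_hat k n).
Proof.
move=> k0; suff [M MP] : exists M, forall x, max_hat k n x != 0 -> `|x| <= M.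
  exact: compactly_supported_rV MP.
elim: n => [|n [M MP]]; first by exists 0 => x; rewrite eqxx.
exists (Num.max M (`|c n| + r n)) => x /=; rewrite le_max.
have [h|h] := boolP (hat k (c n) (r n) x == 0).
  rewrite (eqP h) max_l; last by have /andP[] := max_hat_itv k n x.
  by move=> /MP ->.
move=> _; apply/orP; right; have := hat_neq0 k0 h.
have := ler_normB (c n) (c n - x); rewrite subKr; lra.
Qed.

Lemma max_hat_eq1 x m : `|c m - x| < r m ->
  \forall n \near \oo, max_hat n%:R n x = 1.
Proof.
move=> xm; have e0 : 0 < r m - `|c m - x| by lra.
near=> n.
have h1 : hat n%:R (c m) (r m) x = 1.
  apply: hat_eq1; rewrite -ler_pdivrMr// div1r.
  near: n; exact: nbhs_infty_ger.
suff H k : (m < k)%N -> max_hat n%:R k x = 1 by apply: H; near: n; exists m.+1.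
elim: k => // k IH /=; rewrite ltnS leq_eqVlt => /predU1P[<-|/IH ->].
  by rewrite h1 max_r//; have /andP[] := max_hat_itv n%:R m x.
by rewrite max_l//; have /andP[] := hat_itv n%:R (c k) (r k) x.
Unshelve. all: by end_near. Qed.

End max_hat.

Lemma open_enum_ball (d : nat) (U : set 'rV[R]_d) : open U ->
  exists (c : nat -> 'rV[R]_d) (r : nat -> R),
    U = [set x | exists m, `|c m - x| < r m].
Proof.
move=> oU.
pose ok q := `[< rat_ball q `<=` U >].
(* The radius -1 gives an empty ball, the default for codes that do not name a rational ball inside
   [U]. *)
pose q n := if unpickle n is Some q then if ok q then q else (0, -1) else (0, -1) : 'rV[rat]_d * rat.
exists (fun n => map_mx ratr (q n).1), (fun n => ratr (q n).2).
apply/seteqP; split=> [x Ux|x [m]].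
  have [p [p0 px pU]] := rat_ball_nbhs (open_nbhs_nbhs (conj oU Ux)).
  exists (pickle p); rewrite /q pickleK /ok asboolT//.
  by move: px; rewrite /rat_ball mx_norm_ball.
have neg : ~ `|map_mx ratr (0, -1 : rat).1 - x| < (ratr (0 : 'rV[rat]_d, -1).2 : R).
  apply/negP; rewrite -leNgt (@le_trans _ _ 0)//.
  by rewrite /= lerq0.
rewrite /q; case: unpickle => [p|/neg//].
case: ifPn => [/asboolP pU h|_ /neg//].
by apply: pU; rewrite /rat_ball mx_norm_ball.
Qed.

(** The indicator of an open set is the dominated limit of functions [max_hat]; open sets are stable
    under intersection and generate the sigma-algebra. *)
Lemma eq_measure_compactly_supported (d : nat)
    (m1 m2 : {finite_measure set 'rV[R]_d -> \bar R}) :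
  (forall psi : 'rV[R]_d -> R, continuous psi -> compactly_supported psi ->
    (forall x, 0 <= psi x <= 1) ->
    (\int[m1]_x (psi x)%:E = \int[m2]_x (psi x)%:E)%E) ->
  forall A, measurable A -> m1 A = m2 A.
Proof.
move=> m12.
have open12 U : open U -> m1 U = m2 U.
  move=> oU; have [c [r UE]] := open_enum_ball oU.
  have cv (m : {finite_measure set 'rV[R]_d -> \bar R}) :
      (\int[m]_x (max_hat c r n%:R n x)%:E @[n --> \oo] --> m U)%E.
    rewrite (_ : m U = \int[m]_x (\1_U x)%:E)%E; last first.
      by rewrite integral_indic ?setIT//; exact: open_measurable_rV.
    apply: (@dominated_cvg _ _ _ m setT measurableT _ _ (cst 1%E)).
    - move=> n; apply/measurable_EFinP; apply: continuous_measurable_rV.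
      exact: max_hat_continuous.
    - move=> x _; apply: cvg_near_cst; rewrite indicE.
      case: (boolP (x \in U)) => xU.
        have := set_mem xU; rewrite {1}UE => -[i /max_hat_eq1].
        by apply: filterS => n ->.
      apply: nearW => n; congr (_%:E); apply/eqP; apply: contraNT xU => h.
      by rewrite inE UE /=; apply: max_hat_neq0 h; exact: ler0n.
    - by [].
    - exact: finite_measure_integrable_cst.
    - move=> n x _ /=; rewrite lee_fin ger0_norm;
      by have /andP[] := max_hat_itv c r n%:R n x.
  have := cv m1; have -> : (fun n => \int[m1]_x (max_hat c r n%:R n x)%:E)%E =
     (fun n => \int[m2]_x (max_hat c r n%:R n x)%:E)%E.
    apply/funext => n; apply: m12; first exact: max_hat_continuous.
      exact: max_hat_compact.
    exact: max_hat_itv.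
  by move=> h; apply: (cvg_unique _ h (cv m2)).
move=> A mA; apply: (measure_unique (@open 'rV[R]_d) (fun=> setT)) => //.
- by move=> *; exact: openI.
- by move=> _; exact: openT.
- by rewrite bigcup_const//; exists 0%N.
- by move=> _; rewrite ltey_eq fin_num_measure.
Qed.

End test_functions.

Section flat.
Context (R : realType).

(** The flat function [expR (- u^-1)] times a power of [u^-1]. The powers make the family closed
    under differentiation. *)
Definition flat_exp (k : nat) (u : R) : R :=
  if 0 < u then u^-1 ^+ k * expR (- u^-1) else 0.

Lemma flat_exp_ge0 k u : 0 <= flat_exp k u.
Proof.
rewrite /flat_exp; case: ltP => // u0.
by rewrite mulr_ge0 ?expR_ge0// exprn_ge0// invr_ge0 ltW.
Qed.

(** With n = k + 2, [expR (- u^-1)] is the n-th power of [expR (- (n * u)^-1)], which is at most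
    [n * u]. The quadratic bound makes the derivative at 0 vanish. *)
Lemma flat_exp_le k u : flat_exp k u <= k.+2%:R ^+ k.+2 * u ^+ 2.
Proof.
rewrite /flat_exp; case: ltP => [u0|_]; last first.
  by rewrite mulr_ge0 ?sqr_ge0// exprn_ge0.
pose n : R := k.+2%:R; have n0 : 0 < n by rewrite ltr0n.
have -> : - u^-1 = k.+2%:R * (- (n * u)^-1).
  by rewrite mulrN invfM mulrA divff ?mul1r// gt_eqF.
rewrite expRM_natl expRN -/n.
have nu0 : 0 < n * u by rewrite mulr_gt0.
have h : (expR (n * u)^-1)^-1 <= n * u.
  rewrite -[leRHS]invrK lef_pV2 ?posrE ?expR_gt0 ?invr_gt0//.
  by apply: le_trans (expR_ge1Dx _); rewrite lerDr.
have -> : n ^+ k.+2 * u ^+ 2 = u^-1 ^+ k * (n * u) ^+ k.+2.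
  rewrite exprMn [RHS]mulrCA; congr (_ * _).
  by rewrite -(addn2 k) [X in _ = _ * X]exprD mulrA -exprMn mulVf ?expr1n ?mul1r// gt_eqF.
apply: ler_wpM2l; first by rewrite exprn_ge0// invr_ge0 ltW.
by rewrite lerXn2r// nnegrE ?invr_ge0 ?expR_ge0// ltW.
Qed.

Lemma is_derive_flat_exp k u :
  is_derive u (1 : R) (flat_exp k) (- k%:R * flat_exp k.+1 u + flat_exp k.+2 u).
Proof.
have [u0|u0|->] := ltgtP u 0.
- apply: (near_eq_is_derive (f := cst 0)).
    near=> x; rewrite /flat_exp ifF//; apply/negbTE; rewrite -leNgt ltW//.
    by near: x; exact: lt_nbhsl.
  by rewrite /flat_exp ltNge ltW//= mulr0 addr0; exact: is_derive_cst.
- have iV : is_derive u (1 : R) (fun y => y^-1) (- u ^- 2).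
    apply: DeriveDef; first by apply: derivableV; rewrite ?gt_eqF.
    by rewrite (@deriveV _ _ id) ?gt_eqF// derive_id [LHS]mulr1.
  apply: (near_eq_is_derive (f := (fun y => y^-1) ^+ k * (expR \o (fun y => - y^-1)))).
    near=> x; rewrite /flat_exp ifT//; last by near: x; exact: lt_nbhsr.
    by rewrite mulrfctE exprfctE.
  have i1 := is_deriveX k iV.
  have i2 : is_derive u (1 : R) (expR \o (fun y => - y^-1)) (expR (- u^-1) * (u ^- 2)).
    by rewrite -[u ^- 2]opprK; apply: is_derive1_comp; exact: is_deriveN.
  have := is_deriveM i1 i2; congr (is_derive _ _ _ _).
  rewrite /flat_exp u0 /GRing.scale /= fctE -exprVn.
  case: k {i1} => [|k] /=; first by rewrite !expr0; ring.
  by rewrite !exprS; ring.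
- rewrite {2 3}/flat_exp ltxx mulr0 addr0.
  have lim0 : h^-1 *: ((flat_exp k \o shift 0) (h *: (1 : R)) - flat_exp k 0) @[h --> 0^'] --> (0 : R).
    apply/cvgrPdist_lt => e e0.
    pose C : R := k.+2%:R ^+ k.+2.
    have C0 : 0 < C by rewrite exprn_gt0.
    have [r r0 rP] : exists2 r : R, 0 < r & forall h : R, `|h| < r -> C * `|h| < e.
      by exists (e / C) => [|h]; [rewrite divr_gt0|rewrite ltr_pdivlMr// mulrC].
    near=> h; have h0 : h != 0 by near: h; exact: nbhs_dnbhs_neq.
    rewrite sub0r normrN [X in X - _]/= addr0 [h *: 1]mulr1 {2}/flat_exp ltxx subr0.
    rewrite normrM normfV ger0_norm ?flat_exp_ge0//.
    rewrite ltr_pdivrMl ?normr_gt0//.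
    apply: le_lt_trans (flat_exp_le _ _) _.
    rewrite -/C -(real_normK (num_real h)) expr2 mulrCA ltr_pM2l ?normr_gt0//.
    apply: rP.
    by near: h; exact: dnbhs0_lt.
  by apply: DeriveDef; [apply/cvg_ex; exists 0|apply: cvg_lim].
Unshelve. all: by end_near. Qed.

Lemma flat_exp_continuous k : continuous (flat_exp k).
Proof.
move=> u; apply: differentiable_continuous; apply/derivable1_diffP.
by have [] := is_derive_flat_exp k u.
Qed.

(** Restriction to a line reduces the chain rule for directional derivatives to the one-variable
    rule. *)
Lemma is_derive_line (V : normedModType R) (f : V -> R) z v (D : R) :
  is_derive z v f D <-> is_derive (0 : R) (1 : R) (fun t => f (t *: v + z)) D.
Proof.
have E : (fun h : R => h^-1 *: ((f \o shift z) (h *: v) - f z)) =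
    (fun h : R => h^-1 *: (((fun t : R => f (t *: v + z)) \o shift 0) (h *: (1 : R)) -
     (fun t : R => f (t *: v + z)) 0)).
  by apply/funext => h /=; rewrite addr0 [h *: 1]mulr1 scale0r add0r.
by split=> -[d1 d2]; apply: DeriveDef; rewrite /derivable /derive ?E in d1 d2 *.
Qed.

Lemma is_derive_comp_real (V : normedModType R) (f : R -> R) (g : V -> R) z v a b :
  is_derive (g z) (1 : R) f a -> is_derive z v g b ->
  is_derive z v (f \o g) (a * b).
Proof.
move=> df /is_derive_line dg; apply/is_derive_line.
by apply: (@is_derive1_comp _ f (fun t => g (t *: v + z))); rewrite scale0r add0r.
Qed.

End flat.

Section smooth_functions.
Context (R : realType) (d : nat).
Local Notation E := 'rV[R]_d.
Local Notation V := (E * E)%type.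

Inductive poly_fun : (V -> R) -> Prop :=
| poly_cst c : poly_fun (fun=> c)
| poly_fst i : poly_fun (fun z => z.1 ord0 i)
| poly_snd i : poly_fun (fun z => z.2 ord0 i)
| poly_add p q : poly_fun p -> poly_fun q -> poly_fun (fun z => p z + q z)
| poly_mul p q : poly_fun p -> poly_fun q -> poly_fun (fun z => p z * q z).

Lemma poly_sum (I : Type) (s : seq I) (p : I -> V -> R) :
  (forall i, poly_fun (p i)) -> poly_fun (fun z => \sum_(i <- s) p i z).
Proof.
move=> pp; elim: s => [|i s IH].
  rewrite (_ : (fun _ => _) = (fun=> 0)); first exact: poly_cst.
  by apply/funext => z; rewrite big_nil.
rewrite (_ : (fun _ => _) = (fun z => p i z + \sum_(i <- s) p i z)).
  exact: poly_add.
by apply/funext => z; rewrite big_cons.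
Qed.

Lemma is_derive_affine (a b t : R) : is_derive t (1 : R) (fun t => t * a + b) a.
Proof.
have := is_deriveD (is_deriveM (is_derive_id t (1 : R)) (is_derive_cst a t (1 : R)))
  (is_derive_cst b t (1 : R)).
by rewrite scaler0 add0r addr0 [_ *: _]mulr1.
Qed.

Lemma poly_continuous p : poly_fun p -> continuous p.
Proof.
elim=> {p} [c|i|i|p q _ cp _ cq|p q _ cp _ cq] z.
- exact: cvg_cst.
- apply: (@continuous_comp _ _ _ fst (fun x : E => x ord0 i)); first exact: cvg_fst.
  exact: coord_continuous.
- apply: (@continuous_comp _ _ _ snd (fun x : E => x ord0 i)); first exact: cvg_snd.
  exact: coord_continuous.
- by apply: continuousD; [exact: cp|exact: cq].
- by apply: continuousM; [exact: cp|exact: cq].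
Qed.

Lemma poly_derive p v : poly_fun p ->
  exists2 p', poly_fun p' & forall z, is_derive z v p (p' z).
Proof.
elim=> {p} [c|i|i|p q pp [p' pp' dp] qq [q' qq' dq]|p q pp [p' pp' dp] qq [q' qq' dq]].
- by exists (fun=> 0); [exact: poly_cst|move=> z; exact: is_derive_cst].
- exists (fun=> v.1 ord0 i) => [|z]; first exact: poly_cst.
  apply/is_derive_line; rewrite (_ : (fun t => _) = fun t => t * v.1 ord0 i + z.1 ord0 i).
    exact: is_derive_affine.
  by apply/funext => t; rewrite /= !mxE.
- exists (fun=> v.2 ord0 i) => [|z]; first exact: poly_cst.
  apply/is_derive_line; rewrite (_ : (fun t => _) = fun t => t * v.2 ord0 i + z.2 ord0 i).
    exact: is_derive_affine.
  by apply/funext => t; rewrite /= !mxE.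
- exists (fun z => p' z + q' z) => [|z]; first exact: poly_add.
  exact: is_deriveD (dp z) (dq z).
- exists (fun z => p z * q' z + q z * p' z) => [|z].
    by apply: poly_add; exact: poly_mul.
  exact: is_deriveM (dp z) (dq z).
Qed.

Section cutoff.
Variables (s : V -> R) (sP : poly_fun s).

(** A class of continuous functions closed under every directional derivative, so that all its
    members are smooth by induction on the list of directions. The cut-off vanishes where [s] is at
    least 1. *)
Inductive flat_comb : (V -> R) -> Prop :=
| flat_term p k : poly_fun p -> flat_comb (fun z => p z * flat_exp k (1 - s z))
| flat_add f g : flat_comb f -> flat_comb g -> flat_comb (fun z => f z + g z).

Lemma flat_comb_continuous f : flat_comb f -> continuous f.
Proof.
elim=> {f} [p k pp|f g _ cf _ cg] z.
  apply: (@continuousM _ _ p (fun z => flat_exp k (1 - s z))).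
    exact: poly_continuous.
  apply: (@continuous_comp _ _ _ (fun z => 1 - s z) (flat_exp k)); last exact: flat_exp_continuous.
  by apply: continuousB; [exact: cvg_cst|exact: poly_continuous].
by apply: continuousD; [exact: cf|exact: cg].
Qed.

Lemma flat_comb_derive f v : flat_comb f ->
  exists2 f', flat_comb f' & forall z, is_derive z v f (f' z).
Proof.
elim=> {f} [p k pp|f g _ [f' ff' df] _ [g' gg' dg]]; last first.
  exists (fun z => f' z + g' z) => [|z]; first exact: flat_add.
  exact: is_deriveD (df z) (dg z).
have [p' pp' dp] := poly_derive v pp; have [s' ss' ds] := poly_derive v sP.
pose f' := fun z => p' z * flat_exp k (1 - s z) +
  ((k%:R * p z * s' z) * flat_exp k.+1 (1 - s z) +
   (-1 * p z * s' z) * flat_exp k.+2 (1 - s z)).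
exists f' => [|z].
  apply: flat_add; first exact: flat_term.
  by apply: flat_add; apply: flat_term; apply: poly_mul => //;
    apply: poly_mul => //; exact: poly_cst.
have d1 : is_derive z v (fun z => 1 - s z) (- s' z).
  by have := is_deriveB (is_derive_cst (1 : R) z v) (ds z); rewrite sub0r.
have d2 := @is_derive_comp_real R _ (flat_exp k) (fun z => 1 - s z) z v _ _
  (is_derive_flat_exp k (1 - s z)) d1.
have := is_deriveM (dp z) d2.
congr (is_derive _ _ _ _); rewrite /f' /GRing.scale/=; ring.
Qed.

Lemma flat_comb_smooth f : flat_comb f -> smooth f.
Proof.
move=> ff vs.
have {}ff : flat_comb (foldr (fun v h => 'D_v h) f vs).
  elim: vs => //= v vs IH; have [f' ff' df] := flat_comb_derive v IH.
  rewrite (_ : 'D_v _ = f') //; apply/funext => z.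
  by have [_ ->] := df z.
split=> [|v z]; first exact: flat_comb_continuous.
by have [f' _ df] := flat_comb_derive v ff; have [] := df z.
Qed.

End cutoff.

Lemma poly_cost : poly_fun (fun z : V => sqnorm (z.1 - z.2)).
Proof.
apply: poly_sum => i.
rewrite (_ : (fun _ => _) = (fun z : V => (z.1 ord0 i + -1 * z.2 ord0 i) *
   (z.1 ord0 i + -1 * z.2 ord0 i))); last first.
  by apply/funext => z; rewrite !mxE expr2 mulN1r.
by apply: poly_mul; apply: poly_add; [exact: poly_fst| |exact: poly_fst|];
  apply: poly_mul; [exact: poly_cst|exact: poly_snd|exact: poly_cst|exact: poly_snd].
Qed.

Lemma sqnorm_ge0 (x : E) : 0 <= sqnorm x.
Proof. by apply: sumr_ge0 => i _; exact: sqr_ge0. Qed.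

Lemma norm_sqr_le_sqnorm (x : E) : `|x| ^+ 2 <= sqnorm x.
Proof.
have [->|x0] := eqVneq `|x| 0; first by rewrite expr0n/= sqnorm_ge0.
have [[i j] xE] := mx_norm_neq0 x0; rewrite [`|x|]xE /= ord1 real_normK ?num_real//.
by rewrite /sqnorm (bigD1 j)//= lerDl sumr_ge0// => k _; exact: sqr_ge0.
Qed.

(** The endpoint law of the rectified curves is tested on smooth functions of compact support only.
    Approximation of the cost from below suffices, since only an upper bound of the new cost is
    wanted. *)
Lemma smooth_approx_cost : exists psi : nat -> V -> R,
  (forall n, [/\ smooth (psi n), compactly_supported (psi n) &
    forall z, 0 <= psi n z <= sqnorm (z.1 - z.2)]) /\
  forall z, psi ^~ z @ \oo --> sqnorm (z.1 - z.2).
Proof.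
pose q (z : V) := sqnorm z.1 + sqnorm z.2.
have q0 z : 0 <= q z by rewrite addr_ge0 ?sqnorm_ge0.
have qP : poly_fun q.
  apply: poly_add; apply: poly_sum => i.
    rewrite (_ : (fun _ => _) = (fun z : V => z.1 ord0 i * z.1 ord0 i)).
      by apply: poly_mul; exact: poly_fst.
    by apply/funext => z; rewrite expr2.
  rewrite (_ : (fun _ => _) = (fun z : V => z.2 ord0 i * z.2 ord0 i)).
    by apply: poly_mul; exact: poly_snd.
  by apply/funext => z; rewrite expr2.
pose s n z := n.+1%:R^-1 * q z.
have s0 n z : 0 <= s n z by rewrite mulr_ge0 ?q0.
have sP n : poly_fun (s n) by apply: poly_mul => //; exact: poly_cst.
(* On arguments up to 1, [flat_exp 0] is at most [expR (- 1)], with equality at 1. The factor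
   [expR 1] thus keeps the functions below the cost and yields the right limit. *)
exists (fun n z => (expR 1 * sqnorm (z.1 - z.2)) * flat_exp 0 (1 - s n z)).
split=> [n|z].
  split.
  - apply: (@flat_comb_smooth (s n)) => //; apply: flat_term.
    by apply: poly_mul; [exact: poly_cst|exact: poly_cost].
  - apply: (@compactly_supported_rV2 _ _ _ n.+1%:R) => z.
    rewrite mulf_eq0 negb_or => /andP[_]; rewrite /flat_exp; case: ifPn => [|_]; last by rewrite eqxx.
    rewrite subr_gt0 /s mulrC ltr_pdivrMr// mul1r => qn _.
    have n1 : 1 <= n.+1%:R :> R by rewrite ler1n.
    have le (x : E) : sqnorm x <= q z -> `|x| <= n.+1%:R.
      move=> xq; rewrite -(@ler_pXn2r _ 2)// ?nnegrE//.
      apply: le_trans (norm_sqr_le_sqnorm x) (le_trans xq _).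
      apply: le_trans (ltW qn) _; rewrite expr2; exact: ler_peMr.
    by split; apply: le; rewrite /q ?lerDl ?lerDr sqnorm_ge0.
  - move=> z; rewrite mulr_ge0 ?flat_exp_ge0 ?mulr_ge0 ?sqnorm_ge0 ?expR_ge0//=.
    rewrite mulrAC -[leRHS]mul1r ler_wpM2r ?sqnorm_ge0//.
    rewrite /flat_exp; case: ltP => [h|_]; last by rewrite mulr0.
    rewrite expr0 mul1r -expRD -[leRHS]expR0 ler_expR subr_le0.
    by rewrite invf_ge1// gerBl.
rewrite -[X in _ --> X]mul1r.
have -> : 1 * sqnorm (z.1 - z.2) = expR 1 * sqnorm (z.1 - z.2) * flat_exp 0 1.
  by rewrite /flat_exp ltr01 invr1 expr0 [1 * expR _]mul1r mulrAC -expRD subrr expR0.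
apply: cvgM; first exact: cvg_cst.
apply: continuous_cvg; first exact: flat_exp_continuous.
rewrite -[X in _ --> X](subr0 1); apply: cvgB; first exact: cvg_cst.
rewrite -[X in _ --> X](mul0r (q z)); apply: cvgM; last exact: cvg_cst.
exact: cvg_harmonic.
Qed.

End smooth_functions.

Lemma norm_coord_le (R : realType) (d : nat) (x : 'rV[R]_d) i :
  `|x ord0 i| <= `|x|.
Proof. by rewrite [leRHS]mx_normrE; apply: (le_bigmax _ _ (ord0, i)). Qed.

(** * Curves and their evaluation maps *)

Section curve_space.
Context (R : realType) (d : nat).
Local Notation E := 'rV[R]_d.
Implicit Types l : curve R d.

Lemma path_of_val l (x : unit_itv R) : path_of l (val x) = l x.
Proof. by have := congr1 (@^~ x) (@valLK _ _ (0 : E) `[0, 1]%classic l). Qed.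

Lemma path_of_out l t : t \notin `[0, 1] -> path_of l t = 0.
Proof.
move=> t01; rewrite /path_of /valL_ /= oinv_set_val insubF//.
by apply/negbTE; move: t01; rewrite mem_setE.
Qed.

Lemma path_of_continuous l : {within `[0, 1], continuous (path_of l)}.
Proof.
apply/subspace_sigL_continuousP.
by rewrite /path_of [sigL _ _]valLK; exact: cts_fun.
Qed.

Lemma path_of_inj l l' : (forall t, t \in `[0, 1] -> path_of l t = path_of l' t) ->
  l = l'.
Proof.
move=> ll'; apply/continuousEP => x; rewrite -!path_of_val; apply: ll'.
exact: (set_mem (valP x)).
Qed.

Lemma ex_curve (f : R -> E) : {within `[0, 1], continuous f} ->
  exists l, forall t, t \in `[0, 1] -> path_of l t = f t.
Proof.
move/subspace_sigL_continuousP => cf.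
have [l lE] : exists l : curve R d, forall x, l x = f (val x).
  pose h : unit_itv R -> E := fun x => f (val x).
  pose l : curve R d := HB.pack h (isContinuous.Build _ _ h cf).
  by exists l.
exists l => t t01.
have tI : t \in (`[0, 1]%classic : set R) by rewrite mem_setE.
exact: etrans (path_of_val l (exist _ t tI)) (lE _).
Qed.

Lemma path_of_near l (t e : R) : t \in `[0, 1] -> 0 < e ->
  exists2 del : R, 0 < del & forall s : R, s \in `[0, 1] -> `|s - t| < del ->
    `|path_of l s - path_of l t| < e.
Proof.
move=> t01 e0; have /subspace_continuousP/(_ t) := @path_of_continuous l.
move=> /(_ t01)/cvgrPdist_lt /(_ _ e0); rewrite near_withinE.
move=> /nbhs_ballP[del /= del0 delP]; exists del => // s s01 st.
by rewrite distrC; apply: delP => //; rewrite /ball/= distrC.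
Qed.

Lemma measurable_path_of t : measurable_fun setT (fun l : curve R d => path_of l t).
Proof.
have [t01|t01] := boolP (t \in `[0, 1]); last first.
  rewrite (_ : (fun _ => _) = cst 0); first exact: measurable_cst.
  by apply/funext => l; rewrite path_of_out.
have tI : t \in (`[0, 1]%classic : set R) by rewrite mem_setE.
pose x : unit_itv R := exist _ t tI.
apply: measurable_fun_open => U oU; apply: sub_sigma_algebra.
exists [set f : {uniform unit_itv R -> E} | U (f x)].
  rewrite openE => f /= Ufx.
  apply/uniform_nbhs.
  have /nbhsP[A entA AU] : nbhs (f x) U by exact: open_nbhs_nbhs.
  exists A; split => // h /= /(_ x Logic.I) fh; apply: AU.
  by rewrite /xsection/= inE.
by apply/seteqP; split => l /=; rewrite -path_of_val.
Qed.

Local Notation T01 := ((`[0%R, 1%R]%classic : set (measurableTypeR R))).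

(** A Caratheodory argument: evaluation is measurable in the curve at each fixed time and continuous
    in time. Evaluation at a grid point takes countably many times and converges to evaluation at
    [t]. *)
Lemma measurable_path :
  measurable_fun (T01 `*` [set: curve R d])
    (fun p : measurableTypeR R * curve R d => path_of p.2 p.1).
Proof.
have mD : measurable (T01 `*` [set: curve R d]) by apply: measurableX.
apply: measurable_fun_rVP => // i.
(* Rounding down to the grid keeps the time in [0, 1]. *)
pose a n (t : R) : R := (Num.truncn (t * n.+1%:R))%:R / n.+1%:R.
apply: (@measurable_fun_cvg _ _ _ _ (fun n p => path_of p.2 (a n p.1) ord0 i)).
  move=> n _ Y mY.
  pose A k := T01 `&` `[k%:R / n.+1%:R, k.+1%:R / n.+1%:R[%classic.
  pose B (k : nat) := (fun l : curve R d => path_of l (k%:R / n.+1%:R) ord0 i) @^-1` Y.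
  rewrite (_ : _ `&` _ = \bigcup_k (A k `*` B k)).
    apply: bigcupT_measurable => k; apply: measurableX.
      by apply: measurableI => //; exact: measurable_itv.
    rewrite -[B k]setTI.
    exact: (measurableT_comp (@measurable_coord R d i) (measurable_path_of (k%:R / n.+1%:R))).
  have n0 : 0 < n.+1%:R :> R by rewrite ltr0n.
  apply/seteqP; split=> [[t l] /= [[t01 _] Yt]|[t l] [k _ [/= [t01]]]].
    exists (Num.truncn (t * n.+1%:R)) => //; split => //; split => //=.
    have t0 : 0 <= t * n.+1%:R by rewrite mulr_ge0//; move: t01; rewrite in_itv/= => /andP[].
    have := truncn_itv t0; rewrite in_itv/= ler_pdivrMr// => /andP[->].
    by rewrite ltr_pdivlMr.
  rewrite in_itv/= => /andP[kt tk] Bt; split => //=.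
  rewrite /a (_ : Num.truncn _ = k) //; apply/truncn_def.
  move: kt tk; rewrite !bnd_simp => kt tk.
  by rewrite -ler_pdivrMr// kt -ltr_pdivlMr.
move=> [t' l] [/= t01' _]; pose t : R := t'.
rewrite -[t']/t; have t01 : t \in `[0, 1] by [].
clearbody t; clear t' t01'.
have alim : a ^~ t @ \oo --> t.
  apply/cvgrPdist_lt => e e0.
  near=> n.
  have n0 : 0 < n.+1%:R :> R by rewrite ltr0n.
  have t0 : 0 <= t * n.+1%:R by rewrite mulr_ge0//; move: t01; rewrite in_itv/= => /andP[].
  have /andP[h1 h2] := truncn_itv t0.
  have en : n.+1%:R^-1 < e by near: n; exact: near_infty_natSinv_lt (PosNum e0).
  rewrite /a ltr_norml; apply/andP; split.
    have : (Num.truncn (t * n.+1%:R))%:R / n.+1%:R <= t by rewrite ler_pdivrMr.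
    by rewrite -subr_ge0; apply: lt_le_trans; rewrite oppr_lt0.
  have : t < (Num.truncn (t * n.+1%:R)).+1%:R / n.+1%:R by rewrite ltr_pdivlMr.
  rewrite -natr1 mulrDl mul1r => h; rewrite ltrBlDl.
  by apply: lt_trans h _; rewrite ltrD2l.
have a01 n : a n t \in `[0, 1].
  have n0 : 0 < n.+1%:R :> R by rewrite ltr0n.
  move: (t01); rewrite !in_itv/= => /andP[t0 t1].
  rewrite divr_ge0//= ler_pdivrMr// mul1r.
  have /andP[h1 h2] := truncn_itv (mulr_ge0 t0 (ltW n0)).
  by apply: le_trans h1 _; rewrite ler_piMl// ltW.
apply/cvgrPdist_lt => e e0.
have [del del0 delP] := path_of_near l t01 e0.
near=> n.
have ha : `|a n t - t| < del.
  by rewrite distrC; near: n; move/cvgrPdist_lt : alim => /(_ _ del0).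
apply: le_lt_trans (delP _ (a01 n) ha); rewrite distrC.
have := norm_coord_le (path_of l (a n t) - path_of l t) i.
by rewrite !mxE.
Unshelve. all: by end_near. Qed.

End curve_space.

Section probability_of.
Local Open Scope ereal_scope.
Context d (T : measurableType d) (R : realType) (f : set T -> \bar R).

Definition probability_of (_ : f set0 = 0) (_ : forall A, 0 <= f A)
  (_ : semi_sigma_additive f) (_ : f setT = 1) := f.

Hypotheses (f0 : f set0 = 0) (f_ge0 : forall A, 0 <= f A)
  (f_add : semi_sigma_additive f) (f1 : f setT = 1).

HB.instance Definition _ := isMeasure.Build _ _ _
  (probability_of f0 f_ge0 f_add f1) f0 f_ge0 f_add.
HB.instance Definition _ := Measure_isProbability.Build _ _ _
  (probability_of f0 f_ge0 f_add f1) f1.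

Lemma ex_probability_of :
  exists Q : probability T R, (Q : set T -> \bar R) = f.
Proof. by exists (probability_of f0 f_ge0 f_add f1). Qed.

End probability_of.

Lemma ex_pushforward_probability d1 d2 (T1 : measurableType d1)
    (T2 : measurableType d2) (R : realType) (P : probability T1 R) (f : T1 -> T2) :
  measurable_fun setT f ->
  exists Q : probability T2 R, (Q : set T2 -> \bar R) = pushforward P f.
Proof.
move=> mf; apply: ex_probability_of.
- by rewrite /pushforward preimage_set0 measure0.
- by move=> A; exact: measure_ge0.
- exact: (@measure_semi_sigma_additive _ _ _
    [the {measure set _ -> \bar R} of @pushforward _ _ _ _ _ P f]).
- by rewrite /pushforward preimage_setT probability_setT.
Qed.

(** * Integrals over time and a probability space *)

Section iterated_integral.
Local Open Scope ereal_scope.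
Context (R : realType).
Local Notation T01 := ((`[0%R, 1%R]%classic : set (measurableTypeR R))).

Lemma integral_cst_unit (k : \bar R) : \int[@lebesgue_measure R]_(t in T01) k = k.
Proof.
rewrite integral_cst// [X in _ * X](_ : _ = 1) ?mule1//.
transitivity (@lebesgue_measure R [set` `[0%R, 1%R]]) => //.
by rewrite lebesgue_measure_itv/= lte_fin ltr01 oppr0 adde0.
Qed.

Lemma iterated_integralE d (T : measurableType d) (P : probability T R)
    (f : measurableTypeR R * T -> \bar R) :
  measurable_fun (T01 `*` [set: T]) f -> (forall p, 0 <= f p) ->
  \int[lebesgue_measure]_(t in T01) \int[P]_z f (t, z) =
  \int[lebesgue_measure \x P]_(p in T01 `*` [set: T]) f p.
Proof.
move=> mf f0; have mD : measurable (T01 `*` [set: T]) by exact: measurableX.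
rewrite [RHS]integral_mkcond fubini_tonelli1; last 2 first.
- exact/(measurable_restrictT _ _).1.
- by move=> p; rewrite patchE; case: ifP.
rewrite [LHS]integral_mkcond; apply: eq_integral => t _.
rewrite patchE /fubini_F; case: ifPn => t01.
  apply: eq_integral => z _; rewrite patchE ifT//.
  by apply/mem_set; split => //=; exact/set_mem.
rewrite integral0_eq// => z _; rewrite patchE ifF//.
by apply/negbTE; apply: contra t01 => /set_mem[/= ? _]; exact/mem_set.
Qed.

Lemma fubini_G_restrict d (T : measurableType d)
    (f : measurableTypeR R * T -> \bar R) z :
  \int[lebesgue_measure]_(t in T01) f (t, z) =
  fubini_G (@lebesgue_measure R) (f \_ (T01 `*` [set: T])) z.
Proof.
rewrite [LHS]integral_mkcond /fubini_G.
apply: eq_integral => t _; rewrite !patchE.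
have [t01|t01] := boolP (t \in T01).
  by rewrite ifT//; apply/mem_set; split => //=; exact/set_mem.
rewrite ifF//; apply/negbTE; apply: contra t01 => /set_mem[/= ? _]; exact/mem_set.
Qed.

Lemma measurable_integral_T01 d (T : measurableType d)
    (f : measurableTypeR R * T -> \bar R) :
  measurable_fun (T01 `*` [set: T]) f -> (forall p, 0 <= f p) ->
  measurable_fun setT (fun z => \int[lebesgue_measure]_(t in T01) f (t, z)).
Proof.
move=> mf f0; have mD : measurable (T01 `*` [set: T]) by exact: measurableX.
rewrite (_ : (fun z => _) = fubini_G (@lebesgue_measure R) (f \_ (T01 `*` [set: T]))).
  apply: measurable_fun_fubini_tonelli_G; first exact/(measurable_restrictT _ _).1.
  by move=> p; rewrite patchE; case: ifP.
by apply/funext => z; rewrite fubini_G_restrict.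
Qed.

Lemma iterated_integral_swap d (T : measurableType d) (P : probability T R)
    (f : measurableTypeR R * T -> \bar R) :
  measurable_fun (T01 `*` [set: T]) f -> (forall p, 0 <= f p) ->
  \int[lebesgue_measure]_(t in T01) \int[P]_z f (t, z) =
  \int[P]_z \int[lebesgue_measure]_(t in T01) f (t, z).
Proof.
move=> mf f0; have mD : measurable (T01 `*` [set: T]) by exact: measurableX.
rewrite iterated_integralE// integral_mkcond fubini_tonelli2; last 2 first.
- exact/(measurable_restrictT _ _).1.
- by move=> p; rewrite patchE; case: ifP.
by apply: eq_integral => z _; rewrite fubini_G_restrict.
Qed.

End iterated_integral.

(** * Kinetic energy of velocity fields *)

Section energy.
Local Open Scope ereal_scope.
Context (R : realType) (d : nat).
Local Notation E := 'rV[R]_d.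
Local Notation T01 := ((`[0%R, 1%R]%classic : set (measurableTypeR R))).

Definition cost (m : set (E * E) -> \bar R) : \bar R :=
  \int[m]_z (sqnorm (z.1 - z.2)%R)%:E.

Lemma measurable_sqnorm : measurable_fun setT (@sqnorm R d).
Proof.
apply: measurable_sum => i; apply: measurable_funX; exact: measurable_coord.
Qed.

Lemma measurable_fun_sqnorm d' (T : measurableType d') (D : set T) (f : T -> E) :
  measurable_fun D f -> measurable_fun D (fun t => (sqnorm (f t))%:E).
Proof. by move=> mf; apply/measurable_EFinP; exact: measurableT_comp measurable_sqnorm mf. Qed.

Lemma measurable_fun_rV_coord d' (T : measurableType d') (D : set T) (f : T -> E) i :
  measurable_fun D f -> measurable_fun D (fun t => f t ord0 i).
Proof. by move=> mf; exact: measurableT_comp (measurable_coord i) mf. Qed.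

Lemma measurable_fun_rVD d' (T : measurableType d') (D : set T) (f g : T -> E) :
  measurable D -> measurable_fun D f -> measurable_fun D g ->
  measurable_fun D (fun t => (f t + g t)%R).
Proof.
move=> mD mf mg; apply: measurable_fun_rVP => // i.
rewrite (_ : (fun _ => _) = (fun t => f t ord0 i) \+ (fun t => g t ord0 i))%R.
  by apply: measurable_funD; exact: measurable_fun_rV_coord.
by apply/funext => t; rewrite mxE.
Qed.

Lemma measurable_fun_rVZ d' (T : measurableType d') (D : set T) (k : T -> R) (f : T -> E) :
  measurable D -> measurable_fun D k -> measurable_fun D f ->
  measurable_fun D (fun t => (k t *: f t)%R).
Proof.
move=> mD mk mf; apply: measurable_fun_rVP => // i.
rewrite (_ : (fun _ => _) = k \* (fun t => f t ord0 i))%R.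
  by apply: measurable_funM => //; exact: measurable_fun_rV_coord.
by apply/funext => t; rewrite mxE.
Qed.

Lemma measurable_fun_rVB d' (T : measurableType d') (D : set T) (f g : T -> E) :
  measurable D -> measurable_fun D f -> measurable_fun D g ->
  measurable_fun D (fun t => (f t - g t)%R).
Proof.
move=> mD mf mg; rewrite (_ : (fun _ => _) = fun t => (f t + -1 *: g t)%R).
  by apply: measurable_fun_rVD => //; apply: measurable_fun_rVZ.
by apply/funext => t; rewrite scaleN1r.
Qed.

Definition segment_at (t : R) (z : E * E) : E := ((1 - t) *: z.1 + t *: z.2)%R.

Lemma measurable_segment :
  measurable_fun setT (fun p : measurableTypeR R * (E * E) => segment_at p.1 p.2).
Proof.
have m1 : measurable_fun setT (fun p : measurableTypeR R * (E * E) => p.2.1).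
  exact: measurableT_comp.
have m2 : measurable_fun setT (fun p : measurableTypeR R * (E * E) => p.2.2).
  exact: measurableT_comp.
apply: measurable_fun_rVD => //; apply: measurable_fun_rVZ => //.
exact: measurable_funB.
Qed.

Lemma measurable_segment_at t : measurable_fun setT (segment_at t).
Proof. exact: (measurableT_comp measurable_segment (pair1_measurable t)). Qed.

Variable gam : probability (E * E)%type R.

Lemma integral_interpolation t (f : E -> \bar R) :
  measurable_fun setT f -> (forall x, 0 <= f x) ->
  \int[interpolation gam t]_x f x = \int[gam]_z f (segment_at t z).
Proof.
move=> mf f0.
exact: (ge0_integral_pushforward (measurable_segment_at t) gam measurableT mf (fun x _ => f0 x)).
Qed.

Section field.
Variable (w : R -> E -> E).
Hypothesis mw : measurable_fun (T01 `*` [set: E])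
    (fun p : measurableTypeR R * E => w p.1 p.2).

Lemma measurable_field_at t : t \in `[0%R, 1%R] -> measurable_fun setT (w t).
Proof.
move=> t01; apply: (measurable_comp (F := T01 `*` [set: E])
  (f := fun p : measurableTypeR R * E => w p.1 p.2) (g := pair t)) => //.
- exact: measurableX.
- by move=> _ [x _ <-].
Qed.

Lemma measurable_field_along d' (T : measurableType d')
    (h : measurableTypeR R * T -> E) :
  measurable_fun (T01 `*` [set: T]) h ->
  measurable_fun (T01 `*` [set: T]) (fun p => w p.1 (h p)).
Proof.
move=> mh; have mD : measurable (T01 `*` [set: T]) by exact: measurableX.
apply: (measurable_comp (F := T01 `*` [set: E])
  (f := fun p : measurableTypeR R * E => w p.1 p.2) (g := fun p => (p.1, h p))) => //.
- exact: measurableX.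
- by move=> _ [[t x] [/= t01 _] <-].
- apply: (@eq_measurable_fun _ _ _ _ _ (fun p => (p.1, (h \_ (T01 `*` setT)) p))).
    by move=> p pD; rewrite patchE pD.
  apply: measurable_funTS; apply: measurable_fun_pair => //.
  exact/(measurable_restrictT _ _).1.
Qed.

Lemma integral_sqnorm_field :
  \int[lebesgue_measure]_(t in T01) \int[interpolation gam t]_x (sqnorm (w t x))%:E =
  \int[lebesgue_measure]_(t in T01) \int[gam]_z (sqnorm (w t (segment_at t z)))%:E.
Proof.
apply: eq_integral => t /set_mem t01; rewrite integral_interpolation// => [|x].
  by apply: measurable_fun_sqnorm; exact: measurable_field_at.
by rewrite lee_fin sqnorm_ge0.
Qed.

End field.

Lemma sqnormZ (c : R) (x : E) : sqnorm (c *: x) = (c ^+ 2 * sqnorm x)%R.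
Proof. by rewrite /sqnorm mulr_sumr; apply: eq_bigr => i _; rewrite mxE exprMn. Qed.

Lemma sqnormN (x : E) : sqnorm (- x) = sqnorm x.
Proof. by rewrite -scaleN1r sqnormZ sqrrN expr1n mul1r. Qed.

(** Exact convexity defect of the squared distance to y - x along the segment from a to 0. *)
Lemma sqnorm_convex (e : R) (a x y : E) :
  (sqnorm ((1 - e) *: a - y + x) + e * (1 - e) * sqnorm a =
   (1 - e) * sqnorm (a - y + x) + e * sqnorm (x - y))%R.
Proof.
rewrite /sqnorm !mulr_sumr -!big_split/=; apply: eq_bigr => i _.
by rewrite !mxE; ring.
Qed.

Lemma le_of_quadratic_gap (V J L : R) : (0 <= V -> 0 <= J -> 0 <= L ->
  (forall e, 0 <= e <= 1 ->
    exists2 l, L <= l & l + e * (1 - e) * V = (1 - e) * L + e * J) -> V <= J)%R.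
Proof.
move=> V0 J0 L0 H; rewrite leNgt; apply/negP => JV.
have Vp : (0 < V)%R by lra.
(* With this [e], [(1 - e) * V] is the midpoint of [V] and [J], hence exceeds [J], while minimality
   forces [(1 - e) * V <= J]. *)
pose e := ((V - J) / (2 * V))%R.
have eV : (e * V = (V - J) / 2)%R by rewrite /e; field; lra.
have e0 : (0 < e)%R by rewrite divr_gt0//; lra.
have e1 : (e <= 1)%R by rewrite ler_pdivrMr//; lra.
have [|l Ll le] := H e; first by rewrite ltW.
have : (e * (J - (1 - e) * V) >= 0)%R by nra.
rewrite pmulr_rge0//; nra.
Qed.

(** Pythagoras in L^2: the minimizer is the projection of y - x on the fields,
    so it has the smaller energy.  It is compared with its own multiples. *)
Lemma velocity_field_energy v : velocity_field gam v ->
  \int[lebesgue_measure]_(t in T01) \int[gam]_z (sqnorm (v t (segment_at t z)))%:E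
    <= cost gam.
Proof.
move=> [[mv vfin] vmin].
have [->|Jfin] := eqVneq (cost gam) +oo; first exact: leey.
pose D : set (measurableTypeR R * (E * E)) := T01 `*` setT.
have mD : measurable D by exact: measurableX.
pose mu := (@lebesgue_measure R \x gam).
pose A (p : measurableTypeR R * (E * E)) := v p.1 (segment_at p.1 p.2).
have mA : measurable_fun D A.
  by apply: (measurable_field_along mv); exact: measurable_funTS measurable_segment.
have m1 : measurable_fun D (fun p => p.2.1).
  by apply: measurable_funTS; exact: measurableT_comp.
have m2 : measurable_fun D (fun p => p.2.2).
  by apply: measurable_funTS; exact: measurableT_comp.
pose L (c : R) := \int[mu]_(p in D) (sqnorm (c *: A p - p.2.2 + p.2.1)%R)%:E.
have mL (c : R) : measurable_fun D (fun p => (sqnorm (c *: A p - p.2.2 + p.2.1)%R)%:E).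
  apply: measurable_fun_sqnorm; apply: measurable_fun_rVD => //.
  by apply: measurable_fun_rVB => //; apply: measurable_fun_rVZ.
have mAA : measurable_fun D (fun p => (sqnorm (A p))%:E) by exact: measurable_fun_sqnorm.
have mJ : measurable_fun D (fun p => (sqnorm (p.2.1 - p.2.2)%R)%:E).
  by apply: measurable_fun_sqnorm; exact: measurable_fun_rVB.
pose V := \int[mu]_(p in D) (sqnorm (A p))%:E.
pose J := \int[mu]_(p in D) (sqnorm (p.2.1 - p.2.2)%R)%:E.
have sq0 (x : E) : 0 <= (sqnorm x)%:E by rewrite lee_fin sqnorm_ge0.
have VE : \int[lebesgue_measure]_(t in T01)
    \int[gam]_z (sqnorm (v t (segment_at t z)))%:E = V.
  exact: (@iterated_integralE R _ _ gam (fun p => (sqnorm (A p))%:E) mAA (fun p => sq0 _)).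
have JE : cost gam = J.
  rewrite /J -(@iterated_integralE R _ _ gam (fun p => (sqnorm (p.2.1 - p.2.2)%R)%:E) mJ)//=.
  by rewrite -/(cost gam) integral_cst_unit.
have LE c : fm_loss (fun t x => c *: v t x)%R gam = L c.
  exact: (@iterated_integralE R _ _ gam
    (fun p => (sqnorm (c *: A p - p.2.2 + p.2.1)%R)%:E) (mL c) (fun p => sq0 _)).
have L1 : fm_loss v gam = L 1%R.
  by rewrite -LE; congr (fm_loss _ gam); apply/funext => t; apply/funext => x; rewrite scale1r.
have L2c c : L2_field gam (fun t x => c *: v t x)%R.
  have mcv : measurable_fun (T01 `*` [set: E]) (fun p : measurableTypeR R * E => c *: v p.1 p.2)%R.
    by apply: measurable_fun_rVZ => //; exact: measurableX.
  split; first exact: mcv.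
  rewrite (integral_sqnorm_field mcv).
  have mcA : measurable_fun D (fun p => (c ^+ 2)%:E * (sqnorm (A p))%:E).
    by apply: emeasurable_funM.
  rewrite (_ : (fun _ => _) = (fun t => \int[gam]_z ((c ^+ 2)%:E * (sqnorm (A (t, z)))%:E))); last first.
    by apply/funext => t; apply: eq_integral => z _; rewrite sqnormZ EFinM.
  rewrite (@iterated_integralE R _ _ gam (fun p => (c ^+ 2)%:E * (sqnorm (A p))%:E) mcA)
    => [|p]; last by rewrite mule_ge0// lee_fin sqr_ge0.
  rewrite ge0_integralZl_EFin ?sqr_ge0// lte_mul_pinfty ?lee_fin ?sqr_ge0//.
  by rewrite -/V -VE -(integral_sqnorm_field mv).
have ident (e : R) : (0 <= e <= 1)%R ->
    L (1 - e)%R + (e * (1 - e))%:E * V = (1 - e)%:E * L 1%R + e%:E * J.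
  move=> /andP[e0 e1]; have e1' : (0 <= 1 - e)%R by rewrite subr_ge0.
  have ee : (0 <= e * (1 - e))%R by exact: mulr_ge0.
  rewrite -!ge0_integralZl_EFin// -!ge0_integralD//; last 6 first.
  - by move=> p _; rewrite mule_ge0.
  - by apply: emeasurable_funM.
  - by move=> p _; rewrite mule_ge0.
  - by apply: emeasurable_funM.
  - by move=> p _; rewrite mule_ge0.
  - by apply: emeasurable_funM.
  apply: eq_integral => p _; rewrite -!EFinM -!EFinD; congr (_%:E).
  by rewrite scale1r sqnorm_convex.
have Jfin' : J \is a fin_num by rewrite -JE ge0_fin_numE ?ltey// integral_ge0.
have Vfin : V \is a fin_num.
  by rewrite ge0_fin_numE ?integral_ge0// -VE -(integral_sqnorm_field mv).
have L0 : L 0%R = J.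
  apply: eq_integral => p _; congr (_%:E).
  by rewrite scale0r sub0r addrC.
(* The zero field is a competitor with loss [J], so the minimal loss is finite. *)
have Lfin : L 1%R \is a fin_num.
  rewrite ge0_fin_numE ?integral_ge0// -L1; apply: le_lt_trans (vmin _ (L2c 0%R)) _.
  by rewrite LE L0 ltey_eq Jfin'.
rewrite VE JE -(fineK Vfin) -(fineK Jfin') lee_fin.
apply: (@le_of_quadratic_gap (fine V) (fine J) (fine (L 1%R))); rewrite ?fine_ge0 ?integral_ge0//.
move=> e e01; have := vmin _ (L2c (1 - e)%R); have := ident e e01.
rewrite L1 LE -(fineK Vfin) -(fineK Jfin') -(fineK Lfin) -!EFinM -EFinD.
case: (L (1 - e)%R) => [l| |] //; rewrite -EFinD lee_fin => -[le] Ll.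
by exists l; rewrite ?le.
Qed.

End energy.

(** * Energy of curves and the cost after rectification *)

Section ac_paths.
Context (R : realType) (d : nat).
Local Notation E := 'rV[R]_d.
Local Notation mu := (@lebesgue_measure R).

(** A single domination criterion that serves Lipschitz functions, sums, multiples and products. *)
Lemma ac_real_le2 (f1 f2 g : R -> R) (K : R) : 0 <= K ->
  ac_real f1 -> ac_real f2 ->
  (forall a b, 0 <= a -> a <= b -> b <= 1 ->
    `|g b - g a| <= K * (`|f1 b - f1 a| + `|f2 b - f2 a|)) -> ac_real g.
Proof.
move=> K0 a1 a2 gK e e0.
have e20 : 0 < e / (2 * (K + 1)) by rewrite divr_gt0//; lra.
have [d1 d10 H1] := a1 _ e20; have [d2 d20 H2] := a2 _ e20.
exists (Num.min d1 d2); first by rewrite lt_min d10.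
move=> n a b ab dis; rewrite lt_min => /andP[s1 s2].
apply: (@le_lt_trans _ _ (K * (\sum_(i < n) `|f1 (b i) - f1 (a i)| +
    \sum_(i < n) `|f2 (b i) - f2 (a i)|))).
  rewrite -big_split/= mulr_sumr; apply: ler_sum => i _.
  by have [? [? ?]] := ab i; exact: gK.
have h1 := H1 n a b ab dis s1; have h2 := H2 n a b ab dis s2.
have : K * (\sum_(i < n) `|f1 (b i) - f1 (a i)| + \sum_(i < n) `|f2 (b i) - f2 (a i)|)
    <= K * (e / (K + 1)).
  apply: ler_wpM2l => //.
  have -> : e / (K + 1) = e / (2 * (K + 1)) + e / (2 * (K + 1)) by field; lra.
  by rewrite lerD// ltW.
move/le_lt_trans; apply; rewrite mulrA ltr_pdivrMr; last by lra.
by rewrite mulrC ltr_pM2l//; lra.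
Qed.

Lemma ac_real_id : ac_real (@id R).
Proof.
move=> e e0; exists e => // n a b ab _; apply: le_lt_trans.
by apply: ler_sum => i _; have [_ [h _]] := ab i; rewrite ger0_norm ?subr_ge0.
Qed.

Lemma ac_real_lipschitz (g : R -> R) (K : R) : 0 <= K ->
  (forall a b, 0 <= a -> a <= b -> b <= 1 -> `|g b - g a| <= K * (b - a)) ->
  ac_real g.
Proof.
move=> K0 gK; apply: (ac_real_le2 K0 ac_real_id ac_real_id) => a b a0 ab b1.
apply: le_trans (gK a b a0 ab b1) _; apply: ler_wpM2l => //.
by rewrite ger0_norm ?subr_ge0//; lra.
Qed.

Lemma ac_realD (f g : R -> R) : ac_real f -> ac_real g -> ac_real (fun t => f t + g t).
Proof.
move=> af ag; apply: (ac_real_le2 ler01 af ag) => a b _ _ _; rewrite mul1r.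
rewrite [X in `|X|](_ : _ = (f b - f a) + (g b - g a)); last by ring.
exact: ler_normD.
Qed.

Lemma ac_realZ (k : R) (f : R -> R) : ac_real f -> ac_real (fun t => k * f t).
Proof.
move=> af; apply: (ac_real_le2 (normr_ge0 k) af af) => a b _ _ _.
by rewrite -mulrBr normrM ler_wpM2l// lerDl.
Qed.

Lemma ac_real_sum (I : Type) (s : seq I) (f : I -> R -> R) :
  (forall i, ac_real (f i)) -> ac_real (fun t => \sum_(i <- s) f i t).
Proof.
move=> af; elim: s => [|i s IH].
  by apply: (@ac_real_lipschitz _ 0) => // a b _ _ _; rewrite !big_nil subrr normr0 mul0r.
rewrite (_ : (fun _ => _) = fun t => f i t + \sum_(i <- s) f i t).
  exact: ac_realD.
by apply/funext => t; rewrite big_cons.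
Qed.

Lemma coord_le_enorm (x : E) i : `|x ord0 i| <= enorm x.
Proof.
rewrite -sqrtr_sqr /enorm ler_wsqrtr// /sqnorm (bigD1 i)//= lerDl.
by apply: sumr_ge0 => j _; exact: sqr_ge0.
Qed.

Lemma ac_real_coord (f : R -> E) i : abs_continuous f -> ac_real (fun t => f t ord0 i).
Proof.
move=> af e e0; have [del del0 H] := af e e0; exists del => // n a b ab dis sd.
apply: le_lt_trans (H n a b ab dis sd); apply: ler_sum => j _.
by have := coord_le_enorm (f (b j) - f (a j)) i; rewrite !mxE.
Qed.

Lemma is_derive_coord (f : R -> E) (t : R) (w : E) i :
  is_derive t (1 : R) f w -> is_derive t (1 : R) (fun s => f s ord0 i) (w ord0 i).
Proof.
move=> [df dfE].
have lim : h^-1 *: ((f \o shift t) (h *: (1 : R)) - f t) @[h --> 0^'] --> w.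
  by rewrite -dfE; exact: df.
have limi : h^-1 *: (((fun s => f s ord0 i) \o shift t) (h *: (1 : R)) - f t ord0 i)
    @[h --> 0^'] --> w ord0 i.
  rewrite (_ : (fun h => _) = (fun x : E => x ord0 i) \o
      (fun h => h^-1 *: ((f \o shift t) (h *: (1 : R)) - f t))).
    apply: continuous_cvg; last exact: lim.
    exact: coord_continuous.
  by apply/funext => h; rewrite /= !mxE.
by apply: DeriveDef; [apply/cvg_ex; exists (w ord0 i)|exact: cvg_lim].
Qed.

(** Jensen's inequality by linearization. With c the total displacement, [g] has derivative 2 c.v -
    |c|^2, which is at most |v|^2, and its increment over [0, 1] is exactly |c|^2. No integrability
    of the velocity along the curve has to be known. *)
Lemma path_energy (v : R -> E -> E) (l : curve R d) :
  abs_continuous (path_of l) -> follows v l ->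
  measurable_fun (`[0%R, 1%R]%classic : set (measurableTypeR R))
    (fun t => sqnorm (v t (path_of l t))) ->
  ((sqnorm (path_of l 0 - path_of l 1))%:E <=
    \int[mu]_(t in `[0%R, 1%R]) (sqnorm (v t (path_of l t)))%:E)%E.
Proof.
move=> acl fl mH.
pose c := path_of l 1 - path_of l 0.
pose g t := \sum_(i < d) (2 * c ord0 i * path_of l t ord0 i) + (- sqnorm c) * t.
have -> : sqnorm (path_of l 0 - path_of l 1) = g 1 - g 0.
  rewrite /g mulr0 mulr1 addr0 -sqnormN opprB -/c addrAC -sumrB.
  rewrite /sqnorm -sumrB; apply: eq_bigr => i _.
  by rewrite /c !mxE; ring.
apply: ac_le_integral => //.
- apply: ac_realD; last exact: ac_realZ ac_real_id.
  by apply: ac_real_sum => i; apply: ac_realZ; exact: ac_real_coord.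
- by move=> t _; exact: sqnorm_ge0.
have := fl; rewrite /follows.
apply: (ae_mono2 _ fl) => t + _ t01 => /(_ t01) dl.
exists (\sum_(i < d) (2 * c ord0 i * v t (path_of l t) ord0 i) - sqnorm c); last first.
  rewrite /sqnorm -sumrB; apply: ler_sum => i _; rewrite -subr_ge0.
  set a := c ord0 i; set b := v t (path_of l t) ord0 i.
  by rewrite (_ : _ - _ = (a - b) ^+ 2) ?sqr_ge0//; ring.
have := is_deriveD (is_derive_sum (fun i => is_deriveZ (2 * c ord0 i) (is_derive_coord i dl)))
  (is_deriveZ (- sqnorm c) (is_derive_id (t : R) (1 : R))).
congr (is_derive _ _ _ _); last by rewrite [_ *: 1]mulr1.
by apply/funext => s; rewrite /g /= -[in RHS]/(_ + _) fctE fct_sumE.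
Qed.

End ac_paths.

Section reflow_cost.
Local Open Scope ereal_scope.
Context (R : realType) (d : nat).
Local Notation E := 'rV[R]_d.
Local Notation T01 := ((`[0%R, 1%R]%classic : set (measurableTypeR R))).

(** Fatou, because the cost of [m] is not known to be finite beforehand. It serves both the endpoint
    law and the weak limit. *)
Lemma fatou_cost_le (m : {measure set (E * E) -> \bar R}) (psi : nat -> E * E -> R) (c : \bar R) :
  (forall n, continuous (psi n)) ->
  (forall n z, 0 <= psi n z)%R ->
  (forall z, (psi ^~ z @ \oo --> sqnorm (z.1 - z.2))%R) ->
  (forall n, \int[m]_z (psi n z)%:E <= c) -> cost m <= c.
Proof.
move=> cpsi psi0 psic psile.
have mpsi n : measurable_fun setT (fun z => (psi n z)%:E).
  by apply/measurable_EFinP; exact: continuous_measurable_rV2.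
have psi0' n z : setT z -> 0 <= (psi n z)%:E by rewrite lee_fin.
apply: (@le_trans _ _ (limn_einf (fun n => \int[m]_z (psi n z)%:E))).
  apply: le_trans (fatou m measurableT mpsi psi0').
  rewrite le_eqVlt; apply/orP; left; apply/eqP; apply: eq_integral => z _.
  have h : (psi n z)%:E @[n --> \oo] --> (sqnorm (z.1 - z.2)%R)%:E.
    by apply: cvg_EFin; [exact: nearW|exact: psic].
  by have [-> _] := cvg_limn_einf_sup h.
rewrite limn_einf_lim; apply: lime_le; first exact: is_cvg_einfs.
apply: nearW => n; apply: le_trans (psile n).
by apply: ereal_inf_lbound; exists n => /=.
Qed.

(** Tests with compact support already determine the law at time [t]. The extension to Borel
    integrands is needed because the integrand will be the squared norm of the velocity field. *)
Lemma law_path (gam : probability (E * E)%type R) (Lam : probability (curve R d) R) t :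
  (forall psi : E -> R, continuous psi -> compactly_supported psi ->
    \int[interpolation gam t]_x (psi x)%:E = \int[Lam]_l (psi (path_of l t))%:E) ->
  forall f : E -> \bar R, measurable_fun setT f -> (forall x, 0 <= f x) ->
  \int[Lam]_l f (path_of l t) = \int[gam]_z f (segment_at t z).
Proof.
move=> psiE f mf f0.
have mp := @measurable_path_of R d t; have ms := measurable_segment_at (R := R) (d := d) t.
have pE (h : E -> \bar R) : measurable_fun setT h -> (forall x, 0 <= h x) ->
    \int[pushforward Lam (fun l : curve R d => path_of l t)]_x h x = \int[Lam]_l h (path_of l t).
  by move=> mh h0; exact: (ge0_integral_pushforward mp Lam measurableT mh (fun x _ => h0 x)).
have [Q1 Q1E] := ex_pushforward_probability Lam mp.
have [Q2 Q2E] := ex_pushforward_probability gam ms.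
have Q12 : forall A, measurable A -> Q1 A = Q2 A.
  apply: (@eq_measure_compactly_supported R d Q1 Q2) => psi cpsi spsi psi01.
  have mpsi : measurable_fun setT (fun x => (psi x)%:E).
    by apply/measurable_EFinP; exact: continuous_measurable_rV.
  have psi0 x : 0 <= (psi x)%:E by rewrite lee_fin; have /andP[] := psi01 x.
  rewrite -[LHS]/(\int[(Q1 : set E -> \bar R)]_x (psi x)%:E) Q1E pE//.
  rewrite -[RHS]/(\int[(Q2 : set E -> \bar R)]_x (psi x)%:E) Q2E.
  by rewrite -psiE.
rewrite -pE// -Q1E -integral_interpolation//.
rewrite -[RHS]/(\int[pushforward gam (segment_at t)]_x f x) -Q2E.
by apply: eq_measure_integral => A mA _; exact: Q12.
Qed.

(** Finiteness is not assumed: all integrands are nonnegative, so Tonelli exchanges time and curve,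
    after which the law at each fixed time can be used. *)
Lemma reflow_cost (gam tgam : probability (E * E)%type R) :
  weak_rectified gam tgam -> cost tgam <= cost gam.
Proof.
move=> [v vf [Lam [acL fL bL cL]]].
have mv := vf.1.1.
pose H (p : measurableTypeR R * curve R d) := (sqnorm (v p.1 (path_of p.2 p.1)))%:E.
have mH : measurable_fun (T01 `*` [set: curve R d]) H.
  by apply: measurable_fun_sqnorm; apply: (measurable_field_along mv); exact: measurable_path.
have H0 p : 0 <= H p by rewrite lee_fin sqnorm_ge0.
have m01 : measurable_fun setT (fun l : curve R d => (path_of l 0, path_of l 1)).
  by apply: measurable_fun_pair; exact: measurable_path_of.
apply: (@le_trans _ _ (\int[Lam]_l (sqnorm (path_of l 0 - path_of l 1)%R)%:E)).
  have [psi [psiP psic]] := smooth_approx_cost R d.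
  have cpsi n : continuous (psi n) by have [+ _ _] := psiP n; move=> /(_ [::])[].
  have mpsi n : measurable_fun setT (psi n) by exact: continuous_measurable_rV2.
  apply: (fatou_cost_le (psi := psi)) => // [n z|n].
    by have [_ _ /(_ z)/andP[]] := psiP n.
  have [spsi kpsi psi01] := psiP n.
  rewrite cL//; apply: ge0_le_integral => //.
  - by move=> l _; rewrite lee_fin; have /andP[] := psi01 (path_of l 0, path_of l 1).
  - by apply/measurable_EFinP; exact: (measurableT_comp (mpsi n) m01).
  - apply: measurable_fun_sqnorm; apply: measurable_fun_rVB => //; exact: measurable_path_of.
  - by move=> l _; rewrite lee_fin; have /andP[_] := psi01 (path_of l 0, path_of l 1).
apply: (@le_trans _ _ (\int[Lam]_l \int[lebesgue_measure]_(t in T01) H (t, l))).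
  apply: ae_ge0_le_integral => //.
  - by move=> l _; rewrite lee_fin sqnorm_ge0.
  - apply: measurable_fun_sqnorm; apply: measurable_fun_rVB => //; exact: measurable_path_of.
  - by move=> l _; apply: integral_ge0 => t _; exact: H0.
  - exact: measurable_integral_T01.
  apply: (ae_mono2 _ acL fL) => l al fl _.
  apply: path_energy => //.
  apply/measurable_EFinP.
  apply: (measurable_comp (F := T01 `*` [set: curve R d]) (f := H) (g := pair^~ l)) => //.
  - exact: measurableX.
  - by move=> _ [t t01 <-].
  - by apply: measurable_funTS; exact: pair2_measurable.
rewrite -iterated_integral_swap//.
apply: le_trans (velocity_field_energy vf).
(* At each time the curves are distributed as the interpolation, so both energies agree. *)
rewrite le_eqVlt; apply/orP; left; apply/eqP; apply: eq_integral => t /set_mem t01.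
apply: (@law_path gam Lam t _ (fun x => (sqnorm (v t x))%:E)).
- by move=> psi cpsi spsi; exact: bL.
- by apply: measurable_fun_sqnorm; exact: measurable_field_at.
- by move=> x; rewrite lee_fin sqnorm_ge0.
Qed.

End reflow_cost.

Lemma ex_power_probability d (T : measurableType d) (R : realType)
    (P : probability T R) n :
  exists Q : probability (n.-tuple T) R, (Q : set _ -> \bar R) = power_measure P n.
Proof.
have [m mE] := ex_power_measure P n; rewrite -mE.
apply: ex_probability_of => //.
- exact: (@measure_semi_sigma_additive _ _ _ m).
- rewrite mE (_ : setT = [set t : n.-tuple T | forall i, (fun=> setT) i (tnth t i)]).
    apply: etrans (@power_measure_box _ _ _ P n (fun=> setT) _) _ => //.
    by rewrite big1// => i _; exact: probability_setT.
  by apply/seteqP; split.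
Qed.

(** * Decrease of the cost and cyclical monotonicity *)

Section minibatch_cost.
Local Open Scope ereal_scope.
Context (R : realType) (d N : nat).
Local Notation E := 'rV[R]_d.
Variable S : minibatch_selection R d N.

Lemma measurable_minibatch_map i : measurable_fun setT (minibatch_map S i).
Proof.
apply: measurable_fun_pair.
  exact: (measurableT_comp measurable_fst (measurable_tnth i)).
move=> _ Y mY; rewrite setTI.
rewrite (_ : _ @^-1` _ = \bigcup_(tau in [set: 'S_N])
    ([set z | S z = tau] `&` (fun z => (tnth z (tau i)).2) @^-1` Y)).
  apply: fin_bigcup_measurable => [|tau _]; first exact: finite_finset.
  apply: measurableI.
    exact: selection_measurable.
  rewrite -[X in measurable X]setTI.
  exact: (measurableT_comp measurable_snd (measurable_tnth (tau i))).
by apply/seteqP; split=> [z Yz|z [tau _ [<-]]] //; exists (S z).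
Qed.

(** The gain from re-pairing by a fixed [tau]. Being free of the selection, it is bounded below near
    a batch where it is positive; the positive part keeps its integrals nonnegative. *)
Definition batch_gap (tau : 'S_N) (z : N.-tuple (E * E)) : R :=
  (Num.max 0 (\sum_(i < N) sqnorm ((tnth z i).1 - (tnth z i).2) -
     \sum_(i < N) sqnorm ((tnth z i).1 - (tnth z (tau i)).2)))%R.

Lemma batch_gap_ge0 tau z : (0 <= batch_gap tau z)%R.
Proof. by rewrite /batch_gap le_max lexx. Qed.

Lemma measurable_batch_cost (tau : 'S_N) :
  measurable_fun setT (fun z : N.-tuple (E * E) =>
    \sum_(i < N) sqnorm ((tnth z i).1 - (tnth z (tau i)).2))%R.
Proof.
apply: measurable_sum => i; apply: (measurableT_comp (@measurable_sqnorm R d)).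
apply: measurable_fun_rVB => //.
  exact: (measurableT_comp measurable_fst (measurable_tnth i)).
exact: (measurableT_comp measurable_snd (measurable_tnth (tau i))).
Qed.

Lemma measurable_batch_gap tau : measurable_fun setT (batch_gap tau).
Proof.
apply: measurable_maxr => //; apply: measurable_funB; last exact: measurable_batch_cost.
have := measurable_batch_cost 1; congr (measurable_fun _ _).
by apply/funext => z; apply: eq_bigr => i _; rewrite perm1.
Qed.

Variables (P : probability (E * E)%type R) (N0 : (0 < N)%N).

Lemma ex_minibatch_measure : exists (Q : probability (E * E)%type R),
  (Q : set _ -> \bar R) = minibatch_ot S P /\
  forall f : E * E -> \bar R, measurable_fun setT f -> (forall z, 0 <= f z) ->
  N%:R%:E * \int[Q]_z f z =
  \int[power_measure P N]_t \sum_(i < N) f (minibatch_map S i t).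
Proof.
have [m mE] := ex_power_probability P N.
have exQ i := ex_pushforward_probability m (measurable_minibatch_map i).
pose Q i := sval (cid (exQ i)).
have QE i : (Q i : set _ -> \bar R) = pushforward m (minibatch_map S i) := svalP (cid (exQ i)).
(* [msum] runs over natural numbers; indices that are not below [N] get the zero measure. *)
pose part (k : nat) : {measure set (E * E) -> \bar R} :=
  if insub k is Some i then Q i else mzero.
have i0 : (0 <= N%:R^-1 :> R)%R by rewrite invr_ge0.
pose invN : {nonneg R} := NngNum i0.
pose M : {measure set (E * E) -> \bar R} := mscale invN (msum part N).
have partE (i : 'I_N) : part i = Q i.
  rewrite /part insubT /= ?ltn_ord// => ?.
  by congr (Q _ : measure _ _); exact: val_inj.
have ME : (M : set _ -> \bar R) = minibatch_ot S P.
  apply/funext => A; rewrite /M/= /mscale/= /msum /minibatch_ot; congr (_ * _).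
  by apply: eq_bigr => i _; rewrite partE -mE -[LHS]/((Q i : set _ -> \bar R) A) QE.
have [W WE] : exists W : probability (E * E)%type R, (W : set _ -> \bar R) = minibatch_ot S P.
  rewrite -ME; apply: ex_probability_of => //.
  - exact: (@measure_semi_sigma_additive _ _ _ M).
  - rewrite /M /= /mscale/= /msum.
    under eq_bigr do rewrite partE.
    rewrite (eq_bigr (fun=> 1%:E)) => [|i _]; last exact: probability_setT.
    rewrite sumEFin -EFinM sumr_const card_ord mulVf//.
    by rewrite pnatr_eq0 -lt0n.
exists W; split => // f mf f0.
have -> : \int[W]_z f z = \int[M]_z f z.
  by apply: eq_measure_integral => A mA _; rewrite -[LHS]/((W : set _ -> \bar R) A) WE -ME.
rewrite /M ge0_integral_mscale// ge0_integral_measure_sum//.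
rewrite muleA -EFinM mulfV ?pnatr_eq0 -?lt0n// mul1e -mE.
rewrite ge0_integral_sum//; last first.
  by move=> i; exact: (measurableT_comp mf (measurable_minibatch_map i)).
apply: eq_bigr => i _; rewrite partE.
rewrite -[LHS]/(\int[(Q i : set _ -> \bar R)]_x f x) QE.
exact: (ge0_integral_pushforward (measurable_minibatch_map i) m measurableT mf (fun x _ => f0 x)).
Qed.

(** Written as a sum, so that nothing is subtracted when the cost is infinite. *)
Lemma minibatch_cost_gap (Q : probability (E * E)%type R) tau :
  (Q : set _ -> \bar R) = minibatch_ot S P ->
  N%:R%:E * cost Q + \int[power_measure P N]_t (batch_gap tau t)%:E <=
  N%:R%:E * cost P.
Proof.
move=> QE; have [m mE] := ex_power_probability P N.
have [W [WE Wint]] := ex_minibatch_measure.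
have mc : measurable_fun setT (fun z : E * E => (sqnorm (z.1 - z.2)%R)%:E).
  by apply: measurable_fun_sqnorm; exact: measurable_fun_rVB.
have c0 (z : E * E) : 0 <= (sqnorm (z.1 - z.2)%R)%:E by rewrite lee_fin sqnorm_ge0.
have mct i : measurable_fun setT (fun t : N.-tuple (E * E) =>
    (sqnorm ((tnth t i).1 - (tnth t i).2)%R)%:E).
  exact: (measurableT_comp mc (measurable_tnth i)).
rewrite /cost QE -WE [X in X + _]Wint// -mE -ge0_integralD//=; last 4 first.
- by move=> t _; apply: sume_ge0 => i _; rewrite lee_fin sqnorm_ge0.
- apply: emeasurable_sum => i.
  exact: (measurableT_comp mc (measurable_minibatch_map i)).
- by move=> t _; rewrite lee_fin batch_gap_ge0.
- by apply/measurable_EFinP; exact: measurable_batch_gap.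
have -> : N%:R%:E * \int[P]_z (sqnorm (z.1 - z.2)%R)%:E =
    \int[m]_t \sum_(i < N) (sqnorm ((tnth t i).1 - (tnth t i).2)%R)%:E.
  rewrite ge0_integral_sum// (eq_bigr (fun=> \int[P]_z (sqnorm (z.1 - z.2)%R)%:E)).
    by rewrite sumr_const card_ord mule_natl.
  move=> i _; rewrite -(integral_power_measure P i mc c0).
  by rewrite -[LHS]/(\int[(m : set _ -> \bar R)]_t _) mE.
apply: ge0_le_integral => //=.
- move=> t _; apply: adde_ge0; last by rewrite lee_fin batch_gap_ge0.
  by apply: sume_ge0 => i _; rewrite lee_fin sqnorm_ge0.
- apply: emeasurable_funD; last by apply/measurable_EFinP; exact: measurable_batch_gap.
  apply: emeasurable_sum => i.
  exact: (measurableT_comp mc (measurable_minibatch_map i)).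
- exact: emeasurable_sum.
move=> t _; rewrite !sumEFin -EFinD lee_fin /batch_gap /minibatch_map /=.
(* The selected pairing is compared with [tau] where the gap is positive and with the identity where
   it vanishes. *)
have h1 := selection_argmin S t tau; have h2 := selection_argmin S t 1%g.
rewrite maxEle; case: ifP => _; first lra.
rewrite addr0; apply: le_trans h2 _.
by apply: ler_sum => i _; rewrite perm1.
Qed.

End minibatch_cost.

Section weak_limit.
Local Open Scope ereal_scope.
Context (R : realType) (d : nat).
Local Notation E := 'rV[R]_d.
Local Notation V := (E * E)%type.

Local Notation zball z r := [set w : V | (`|z - w| < r)%R].

Lemma open_zball (z : V) (r : R) : open (zball z r).
Proof.
have h := @ball_open R (E * E)%type z r; move: h.
by rewrite -ball_normE.
Qed.

(** The open-set half of the portmanteau theorem: a continuous function below the indicator of the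
    ball has positive integral against the limit, and half of this integral is a lower bound from
    some index on. *)
Lemma weak_cvg_ball (g : nat -> probability V R) (gam : probability V R) (z : V) (r : R) :
  weak_cvg g gam -> Defs.support gam z -> (0 < r)%R ->
  exists2 c : R, (0 < c)%R & \forall n \near \oo, c%:E <= g n (zball z r).
Proof.
move=> wg zs r0.
pose psi := hat (r^-1)%R z r.
have cpsi : continuous psi by exact: hat_continuous.
have mpsi : measurable_fun setT (fun x => (psi x)%:E).
  by apply/measurable_EFinP; exact: continuous_measurable_rV2.
have psi01 x : (0 <= psi x <= 1)%R by exact: hat_itv.
have mball e : measurable (zball z e).
  by apply: open_measurable_rV2; exact: open_zball.
have psi_le (x : V) : (psi x <= \1_(zball z r) x)%R.
  rewrite indicE; have [xb|xb] := boolP (x \in zball z r); first by have /andP[] := psi01 x.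
  rewrite leNgt; apply/negP => p0; move/negP: xb; apply; apply/mem_set.
  have := @hat_neq0 R (E * E)%type (r^-1)%R z r x; apply; first by rewrite invr_ge0 ltW.
  by rewrite gt_eqF.
(* The cone of slope 1/r is at least 1/2 on the ball of half the radius, which is charged because
   [z] lies in the support. *)
have psi_ge (x : V) : (2^-1 * \1_(zball z (r / 2)) x <= psi x)%R.
  rewrite indicE; have [/set_mem xb|xb] := boolP (x \in _); last first.
    by rewrite mulr0; have /andP[] := psi01 x.
  move: xb => /= xb; rewrite mulr1 /psi /hat le_max le_min.
  apply/orP; right; apply/andP; split; first lra.
  by rewrite mulrC ler_pdivlMr//; lra.
have int_pos : 0 < \int[gam]_x (psi x)%:E.
  apply: (@lt_le_trans _ _ (\int[gam]_x (2^-1%:E * (\1_(zball z (r / 2)) x)%:E))).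
    rewrite ge0_integralZl_EFin//; last by apply/measurable_EFinP; exact: measurable_indic.
    rewrite integral_indic// setIT mule_gt0 ?lte_fin//.
    by apply: zs; [exact: open_zball|rewrite /= subrr normr0 divr_gt0].
  apply: ge0_le_integral => //.
  - by apply: emeasurable_funM => //; apply/measurable_EFinP; exact: measurable_indic.
  - by move=> x _; rewrite -EFinM lee_fin.
have int_fin : \int[gam]_x (psi x)%:E \is a fin_num.
  rewrite ge0_fin_numE; last by apply: ltW; exact: int_pos.
  apply: (@le_lt_trans _ _ (\int[gam]_x 1)); last first.
    rewrite integral_cst// mul1e; apply: (@le_lt_trans _ _ 1); last by rewrite ltry.
    by rewrite (@probability_le1 _ _ _ gam).
  apply: ge0_le_integral => //.
  - by move=> x _; rewrite lee_fin; have /andP[] := psi01 x.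
  - by move=> x _; rewrite lee_fin; have /andP[] := psi01 x.
pose I := fine (\int[gam]_x (psi x)%:E).
have I0 : (0 < I)%R by rewrite -lte_fin /I fineK.
exists (I / 2)%R; first by rewrite divr_gt0.
have /(wg psi cpsi) h : exists M : R, forall z, (`|psi z| <= M)%R.
  by exists 1%R => x; rewrite ger0_norm; have /andP[] := psi01 x.
have hI : (I / 2)%:E < \int[gam]_x (psi x)%:E.
  by rewrite -(fineK int_fin) lte_fin -/I; lra.
near=> n.
apply: (@le_trans _ _ (\int[g n]_x (psi x)%:E)).
  apply: ltW; near: n; apply: (h [set y | (I / 2)%:E < y]).
  by apply: open_nbhs_nbhs; split => //; exact: open_ereal_gt_ereal.
apply: (@le_trans _ _ (\int[g n]_x (\1_(zball z r) x)%:E)).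
  apply: ge0_le_integral => //.
  - by move=> x _; rewrite lee_fin; have /andP[] := psi01 x.
  - by apply/measurable_EFinP; exact: measurable_indic.
  - by move=> x _; rewrite lee_fin.
by rewrite integral_indic// setIT.
Unshelve. all: by end_near. Qed.

End weak_limit.

Section sequence_gap.
Local Open Scope ereal_scope.
Context (R : realType) (d N : nat) (N0 : (0 < N)%N) (S : minibatch_selection R d N).
Local Notation E := 'rV[R]_d.
Local Notation V := (E * E)%type.
Variables (g : nat -> probability V R).
Hypothesis hreflow : forall n, weak_rectified (minibatch_ot S (g n)) (g n.+1).

Lemma minibatch_reflow_gap tau n :
  N%:R%:E * cost (g n.+1) + \int[power_measure (g n) N]_t (batch_gap tau t)%:E <=
  N%:R%:E * cost (g n).
Proof.
have [Q [QE _]] := @ex_minibatch_measure R d N S (g n) N0.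
apply: le_trans (minibatch_cost_gap N0 tau QE).
rewrite leeD2r// lee_wpmul2l ?lee_fin//.
by apply: reflow_cost; have := hreflow n; rewrite -QE.
Qed.

Lemma cost_ge0 (m : probability V R) : 0 <= cost m.
Proof. by apply: integral_ge0 => z _; rewrite lee_fin sqnorm_ge0. Qed.

Lemma integral_batch_gap_ge0 tau n : 0 <= \int[power_measure (g n) N]_t (batch_gap tau t)%:E.
Proof.
have [m mE] := ex_power_measure (g n) N; rewrite -mE.
by apply: integral_ge0 => z _; rewrite lee_fin batch_gap_ge0.
Qed.

Lemma reflow_cost_nonincreasing n : cost (g n) <= cost (g 0%N).
Proof.
elim: n => // n; apply: le_trans.
have NR : (0 < N%:R :> R)%R by rewrite ltr0n.
rewrite -(@lee_pmul2l _ N%:R%:E)//.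
apply: le_trans (minibatch_reflow_gap 1 n).
by rewrite leeDl// integral_batch_gap_ge0.
Qed.

(** Telescoping bounds the sum of the gaps by [N] times the initial cost; the terms of a convergent
    series tend to 0. *)
Lemma integral_batch_gap_cvg0 tau e : cost (g 0%N) < +oo -> (0 < e)%R ->
  \forall n \near \oo, \int[power_measure (g n) N]_t (batch_gap tau t)%:E < e%:E.
Proof.
move=> c0 e0.
pose G n := \int[power_measure (g n) N]_t (batch_gap tau t)%:E.
have G0 n : 0 <= G n by exact: integral_batch_gap_ge0.
have sG m : N%:R%:E * cost (g m) + \sum_(n < m) G n <= N%:R%:E * cost (g 0%N).
  elim: m => [|m IH]; first by rewrite big_ord0 adde0.
  rewrite big_ord_recr/=; apply: le_trans IH.
  rewrite -[X in _ + X <= _]/(\sum_(i < m) G i + G m) (addeC (\sum_(i < m) G i)) addeA leeD2r//.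
  exact: minibatch_reflow_gap.
have cf : cost (g 0%N) \is a fin_num by rewrite ge0_fin_numE// cost_ge0.
have sG' m : \sum_(n < m) G n <= N%:R%:E * cost (g 0%N).
  by apply: le_trans (sG m); rewrite leeDr// mule_ge0 ?lee_fin ?cost_ge0.
have Gf n : G n \is a fin_num.
  rewrite ge0_fin_numE//; apply: (@le_lt_trans _ _ (N%:R%:E * cost (g 0%N))).
    apply: le_trans (sG' n.+1); rewrite big_ord_recr/= leeDr//.
    exact: sume_ge0.
  by rewrite -(fineK cf) -EFinM ltry.
have : cvgn (series (fun n => fine (G n))).
  apply: nondecreasing_is_cvgn.
    apply/nondecreasing_seqP => n; rewrite /series/= big_nat_recr//= lerDl.
    exact: fine_ge0.
  exists (N%:R * fine (cost (g 0%N)))%R => _ [m _ <-].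
  rewrite -lee_fin EFinM fineK//; apply: le_trans (sG' m).
  rewrite /series/= big_mkord -sumEFin; apply: lee_sum => i _.
  by rewrite fineK.
move=> /cvg_series_cvg_0 /cvgrPdist_lt /(_ _ e0); apply: filterS => n.
rewrite sub0r normrN ger0_norm ?fine_ge0// => h.
by rewrite -[ltLHS]fineK ?lte_fin//; exact: Gf.
Qed.

End sequence_gap.

Lemma quarter_gap (R : realType) (c1 c2 s1 s2 : R) : c1 < c2 ->
  `|c1 - s1| <= (c2 - c1) / 4 -> `|c2 - s2| <= (c2 - c1) / 4 ->
  (c2 - c1) / 4 <= s2 - s1.
Proof. by rewrite !ler_norml => ? /andP[? _] /andP[_ ?]; lra. Qed.

Section support_monotone.
Context (R : realType) (d N : nat).
Local Notation E := 'rV[R]_d.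
Local Notation V := (E * E)%type.
Local Notation zball z r := [set w : V | (`|z - w| < r)%R].

Lemma sqnorm_continuous : continuous (@sqnorm R d).
Proof.
move=> x; rewrite /sqnorm; elim: (index_enum _) => [|i s IH].
  by under eq_fun do rewrite big_nil; exact: cst_continuous.
under eq_fun do rewrite big_cons; apply: (@continuousD R R E) => //.
apply: (@continuous_comp _ _ _ (fun x : E => x ord0 i) (fun y : R => y ^+ 2)).
  exact: coord_continuous.
exact: exprn_continuous.
Qed.

Lemma continuous_cross_sqnorm : continuous (fun p : V * V => sqnorm (p.1.1 - p.2.2)).
Proof.
move=> p; apply: (@continuous_comp _ _ _ (fun p : V * V => p.1.1 - p.2.2) (@sqnorm R d)).
  apply: (@continuousB _ _ _ (fun p : V * V => p.1.1) (fun p : V * V => p.2.2)).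
    by apply: (@continuous_comp _ _ _ fst fst); exact: cvg_fst.
  by apply: (@continuous_comp _ _ _ snd snd); exact: cvg_snd.
exact: sqnorm_continuous.
Qed.

Lemma cross_sqnorm_near (p q : V) (e : R) : 0 < e ->
  \forall r \near 0^'+, forall p' q' : V, `|p - p'| < r -> `|q - q'| < r ->
    `|sqnorm (p.1 - q.2) - sqnorm (p'.1 - q'.2)| < e.
Proof.
move=> e0; have /cvgrPdist_lt /(_ _ e0) /nbhs_ballP[r /= r0 rP] :=
  @continuous_cross_sqnorm (p, q).
near=> s => p' q' pp qq; apply: (rP (p', q')); rewrite -ball_normE /= gt_max.
have sr : s < r by near: s; exact: nbhs_right_lt.
by rewrite (lt_trans pp)// (lt_trans qq).
Unshelve. all: by end_near. Qed.

Lemma cost_gap_near (z : 'I_N -> V) (tau : 'S_N) (e : R) : 0 < e ->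
  \forall r \near 0^'+, forall z' : 'I_N -> V, (forall i, `|z i - z' i| < r) ->
    `|\sum_(i < N) sqnorm ((z i).1 - (z (tau i)).2)
      - \sum_(i < N) sqnorm ((z' i).1 - (z' (tau i)).2)| <= e.
Proof.
move=> e0; have eN : 0 < e / N.+1%:R by rewrite divr_gt0.
have := @filter_forall _ _ _ _ (at_right_proper_filter (0 : R))
  (fun i => cross_sqnorm_near (z i) (z (tau i)) eN).
apply: filterS => r rP z' zz; rewrite -sumrB; apply: (le_trans (ler_norm_sum _ _ _)).
apply: (@le_trans _ _ (\sum_(i < N) (e / N.+1%:R))).
  by apply: ler_sum => i _; apply: ltW; exact: rP.
rewrite sumr_const card_ord -[_ *+ N]mulr_natr -mulrA ler_piMr ?(ltW e0)//.
by rewrite mulrC ler_pdivrMr// mul1r ler_nat.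
Qed.

Hypothesis N0 : (0 < N)%N.
Variables (S : minibatch_selection R d N) (g : nat -> probability V R).
Hypothesis hreflow : forall n, weak_rectified (minibatch_ot S (g n)) (g n.+1).
Hypothesis g0 : (cost (g 0%N) < +oo)%E.
Variables (k : nat -> nat) (gam : probability V R).
Hypothesis kmono : {homo k : m n / (m < n)%N}.
Hypothesis kcvg : weak_cvg (g \o k) gam.

Lemma homo_ltn_geq_id n : (n <= k n)%N.
Proof. by elim: n => // n IH; apply: (leq_ltn_trans IH); exact: kmono. Qed.

(** A violation by 4e at points of the support leaves a gap of at least e on a product of small
    balls, each sum moving by at most e there. Under the powers of [g (k n)] these products keep a
    mass bounded below, so the integrated gap could not tend to 0. *)
Lemma reflow_limit_cyclically_monotone : cyclically_monotone N gam.
Proof.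
move=> z zs tau; rewrite leNgt; apply/negP => gap.
set c1 := \sum_(i < N) _ in gap; set c2 := \sum_(i < N) _ in gap.
pose e := (c2 - c1) / 4; have e0 : 0 < e by rewrite divr_gt0// subr_gt0.
have [r [r0 [near1 near2]]] : exists r : R, 0 < r /\
  ((forall z' : 'I_N -> V, (forall i, `|z i - z' i| < r) ->
    `|c1 - \sum_(i < N) sqnorm ((z' i).1 - (z' (tau i)).2)| <= e) /\
  (forall z' : 'I_N -> V, (forall i, `|z i - z' i| < r) ->
    `|c2 - \sum_(i < N) sqnorm ((z' i).1 - (z' i).2)| <= e)).
  have h1 := cost_gap_near z tau e0; have h2 := cost_gap_near z 1%g e0.
  near (0 : R)^'+ => r; exists r; split=> //; split.
    by near: r; exact: h1.
  have h z' : (forall i, `|z i - z' i| < r) ->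
    `|\sum_(i < N) sqnorm ((z i).1 - (z ((1%g : 'S_N) i)).2)
      - \sum_(i < N) sqnorm ((z' i).1 - (z' ((1%g : 'S_N) i)).2)| <= e.
    by move: z'; near: r; exact: h2.
  move=> z' /h; under eq_bigr do rewrite perm1.
  by under [X in _ - X]eq_bigr do rewrite perm1.
have /boolp.choice[c cP] : forall i : 'I_N, exists ci : R, 0 < ci /\
    \forall n \near \oo, (ci%:E <= g (k n) (zball (z i) r))%E.
  by move=> i; have [c c0 cP] := weak_cvg_ball kcvg (zs i) r0; exists c.
have d0 : 0 < e * \prod_(i < N) c i.
  by rewrite mulr_gt0//; apply: prodr_gt0 => i _; have [] := cP i.
have [n [+ nP]] : exists n, (\int[power_measure (g (k n)) N]_t (batch_gap tau t)%:E <
    (e * \prod_(i < N) c i)%:E)%E /\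
    forall i, ((c i)%:E <= g (k n) (zball (z i) r))%E.
  have [M _ MP] := integral_batch_gap_cvg0 N0 hreflow tau g0 d0.
  have /filter_ex[n [nM nP]] := @filterI _ _ eventually_filter _ _ (nbhs_infty_ge M)
     (@filter_forall _ _ _ _ eventually_filter (fun i => proj2 (cP i))).
  by exists n; split=> //; apply: MP => /=; exact: leq_trans nM (homo_ltn_geq_id n).
rewrite ltNge => /negP; apply.
have mB i : measurable (zball (z i) r : set V).
  by apply: open_measurable_rV2; exact: open_zball.
pose B := [set t : N.-tuple V | forall i, (zball (z i) r) (tnth t i)].
have mBB : measurable B.
  rewrite (_ : B = \bigcap_(i in [set: 'I_N]) ((fun t => tnth t i) @^-1` (zball (z i) r))).
    apply: fin_bigcap_measurable => // i _; rewrite -[X in measurable X]setTI.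
    exact: (measurable_tnth i).
  by apply/seteqP; split=> t h; [move=> i _; exact: h|move=> i; exact: h].
have [m mE] := ex_power_measure (g (k n)) N; rewrite -mE.
apply: (@le_trans _ _ (\int[m]_t (e%:E * (\1_B t)%:E))%E); last first.
  apply: ge0_le_integral => //.
  - by move=> t _; rewrite -EFinM lee_fin mulr_ge0// ltW.
  - by apply: emeasurable_funM => //; apply/measurable_EFinP; exact: measurable_indic.
  - by apply/measurable_EFinP; exact: measurable_batch_gap.
  - move=> t _; rewrite -EFinM lee_fin indicE.
    have [/set_mem tB|_] := boolP (t \in B); last by rewrite mulr0 batch_gap_ge0.
    rewrite mulr1 /batch_gap le_max; apply/orP; right.
    exact: quarter_gap gap (near1 _ tB) (near2 _ tB).
rewrite ge0_integralZl_EFin//; last 2 first.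
- by apply/measurable_EFinP; exact: measurable_indic.
- exact: ltW.
rewrite integral_indic// setIT EFinM lee_wpmul2l ?lee_fin ?(ltW e0)//.
rewrite -[X in (_ <= X)%E]/((m : set _ -> \bar R) B) mE (power_measure_box _ mB).
rewrite -prodEFin; set b := (\prod_(i < N) (c i)%:E)%E; set b' := (X in (_ <= X)%E).
suff /andP[] : ((0 <= b)%E && (b <= b')%E) by [].
rewrite /b /b'; elim/big_ind2: _ => [|x y u v /andP[x0 xy] /andP[u0 uv]|i _].
- by rewrite lexx lee_fin ler01.
- by rewrite mule_ge0//= lee_pmul.
- by rewrite nP lee_fin ltW; have [] := cP i.
Unshelve. all: by end_near. Qed.
End support_monotone.

(** * Monotone supports *)

Section monotone_set.
Context (R : realType) (d : nat).
Local Notation E := 'rV[R]_d.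
Local Notation V := (E * E)%type.
Implicit Types (G : set V) (z : V) (t : R).

(** The scalar product of x - x' and y - y'. *)
Definition cross_dot z z' : R :=
  \sum_(i < d) (z.1 ord0 i - z'.1 ord0 i) * (z.2 ord0 i - z'.2 ord0 i).

Definition monotone_set G : Prop := forall z z', G z -> G z' -> 0 <= cross_dot z z'.

Lemma cross_sqnormE z z' :
  sqnorm (z.1 - z'.2) + sqnorm (z'.1 - z.2) -
  (sqnorm (z.1 - z.2) + sqnorm (z'.1 - z'.2)) = 2 * cross_dot z z'.
Proof.
rewrite /sqnorm /cross_dot mulr_sumr -!big_split/= -sumrB.
by apply: eq_bigr => i _; rewrite !mxE; ring.
Qed.

Lemma sqnorm_segment_at t z z' : sqnorm (segment_at t z - segment_at t z') =
  (1 - t) ^+ 2 * sqnorm (z.1 - z'.1) + t ^+ 2 * sqnorm (z.2 - z'.2)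
  + 2 * t * (1 - t) * cross_dot z z'.
Proof.
rewrite /sqnorm /cross_dot !mulr_sumr -!big_split/=.
by apply: eq_bigr => i _; rewrite !mxE; ring.
Qed.

(** Beyond injectivity for 0 < t < 1, this controls both endpoints of a segment by one intermediate
    point, the source of compactness in [off_segment_near]. *)
Lemma sqnorm_segment_at_ge G t z z' : monotone_set G -> G z -> G z' -> 0 <= t <= 1 ->
  (1 - t) ^+ 2 * sqnorm (z.1 - z'.1) + t ^+ 2 * sqnorm (z.2 - z'.2) <=
  sqnorm (segment_at t z - segment_at t z').
Proof.
move=> mG Gz Gz' /andP[t0 t1]; rewrite sqnorm_segment_at lerDl.
by rewrite mulr_ge0 ?mG// mulr_ge0 ?subr_ge0// mulr_ge0.
Qed.

Lemma sqnorm_eq0 (x : E) : sqnorm x <= 0 -> x = 0.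
Proof.
move=> x0; have : sqnorm x == 0 by rewrite eq_le x0 sqnorm_ge0.
rewrite /sqnorm psumr_eq0; last by move=> i _; exact: sqr_ge0.
move=> /allP h; apply/rowP => i; rewrite mxE.
by have := h i (mem_index_enum i); rewrite sqrf_eq0 => /eqP.
Qed.

Lemma segment_at_inj G t z z' : monotone_set G -> G z -> G z' -> 0 < t < 1 ->
  segment_at t z = segment_at t z' -> z = z'.
Proof.
move=> mG Gz Gz' /andP[t0 t1] zz.
have t01 : 0 <= t <= 1 by rewrite !ltW.
have := sqnorm_segment_at_ge mG Gz Gz' t01.
rewrite zz subrr [sqnorm 0]big1; last by move=> i _; rewrite mxE expr0n.
have := sqnorm_ge0 (z.1 - z'.1); have := sqnorm_ge0 (z.2 - z'.2) => h2 h1 h.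
have t2 : 0 < t ^+ 2 by rewrite exprn_gt0.
have t3 : 0 < (1 - t) ^+ 2 by rewrite exprn_gt0// subr_gt0.
have p1 := mulr_ge0 (ltW t3) h1; have p2 := mulr_ge0 (ltW t2) h2.
have /sqnorm_eq0/subr0_eq e1 : sqnorm (z.1 - z'.1) <= 0.
  by rewrite -(pmulr_rle0 _ t3); lra.
have /sqnorm_eq0/subr0_eq e2 : sqnorm (z.2 - z'.2) <= 0.
  by rewrite -(pmulr_rle0 _ t2); lra.
by case: z z' e1 e2 {Gz Gz' zz h2 h1 h p1 p2} => [a b] [a' b'] /= -> ->.
Qed.

(** The batch consists of z once and z' in all other places. After the transposition of the first
    two indices the remaining terms cancel, and the difference of the costs is twice [cross_dot]. *)
Lemma cyclically_monotone_support (N : nat) (m : set V -> \bar R) : (2 <= N)%N ->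
  cyclically_monotone N m -> monotone_set (Defs.support m).
Proof.
case: N => [|[|N]]// _ cm z z' mz mz'.
pose y (i : 'I_N.+2) := if i == ord0 then z else z'.
have := cm y _ (tperm ord0 (lift ord0 ord0)).
have [//|] := pselect (forall i, Defs.support m (y i)); last first.
  by move=> []; move=> i; rewrite /y; case: ifP.
move=> my /(_ my); rewrite !big_ord_recl tpermL tpermR /y /=.
set s1 := \sum_(i < N) _; set s2 := \sum_(i < N) _.
have -> : s1 = s2.
  apply: eq_bigr => i _; rewrite tpermD//.
have := cross_sqnormE z z'; lra.
Qed.

Lemma closed_support (m : set V -> \bar R) : closed (Defs.support m).
Proof.
move=> z cz U oU Uz; have [z' [sz' Uz']] := cz U (open_nbhs_nbhs (conj oU Uz)).
exact: sz'.
Qed.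

Lemma measurable_support (m : set V -> \bar R) : measurable (Defs.support m).
Proof.
rewrite -[X in measurable X]setCK; apply: measurableC; apply: open_measurable_rV2.
exact/closed_openC/closed_support.
Qed.

(** The complement is covered by the countably many null products of rational balls. *)
Lemma support_negligible (m : {measure set V -> \bar R}) : m (~` Defs.support m) = 0%E.
Proof.
pose Q := [set q : ('rV[rat]_d * rat) * ('rV[rat]_d * rat) |
  m ((rat_ball q.1 : set E) `*` (rat_ball q.2 : set E)) = 0%E].
have mB q : measurable ((rat_ball q.1 : set E) `*` (rat_ball q.2 : set E) : set V).
  by apply: measurableX; apply: open_measurable_rV; exact: ball_open.
have neg : m.-negligible (~` Defs.support m).
  pose F k := if (unpickle k : option (('rV[rat]_d * rat) * ('rV[rat]_d * rat))) is Some q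
    then (if `[< Q q >] then (rat_ball q.1 : set E) `*` (rat_ball q.2 : set E) else set0) else set0 : set V.
  apply: (@negligibleS _ _ _ _ (\bigcup_k F k)); last first.
    apply: negligible_bigcup => k; rewrite /F; case: unpickle => [q|]; last exact: negligible_set0.
    by case: asboolP => // Qq; [apply/negligibleP|exact: negligible_set0].
  move=> z /existsNP[U /not_implyP[oU /not_implyP[Uz /negP]]].
  rewrite -leNgt => mU.
  have : nbhs z U by exact: open_nbhs_nbhs.
  move=> [[A B] [/= nA nB] AB].
  have [q1 [_ q1z q1A]] := rat_ball_nbhs nA; have [q2 [_ q2z q2B]] := rat_ball_nbhs nB.
  have Qq : Q (q1, q2); last first.
    by exists (pickle (q1, q2)); [exact: I|rewrite /F pickleK (asboolT Qq); split].
  apply/eqP; rewrite eq_le measure_ge0 andbT; apply: le_trans mU.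
  apply: le_measure; rewrite ?inE//.
    exact: open_measurable_rV2.
  by move=> w [/q1A ? /q2B ?]; exact: AB.
apply/negligibleP => //.
by apply: measurableC; exact: measurable_support.
Qed.
End monotone_set.

(** * Sigma-compact sets *)

Section sigma_compact.
Context (R : realType).

(** Continuous images of closed sets, such as projections, need not be Borel. Sigma-compactness
    survives continuous images and implies Borel, and closed subsets of R^d x R^d have it. *)
Definition sigma_compact (T : topologicalType) (A : set T) : Prop :=
  exists K : nat -> set T, (forall n, compact (K n)) /\ A = \bigcup_n K n.

Lemma sigma_compact_closedI (T : topologicalType) (A B : set T) :
  sigma_compact A -> closed B -> sigma_compact (A `&` B).
Proof.
move=> [K [cK ->]] cB; exists (fun n => K n `&` B); split.
  by move=> n; exact: compact_closedI.
by rewrite setI_bigcupl.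
Qed.

Lemma sigma_compact_setX (T U : topologicalType) (A : set T) (B : set U) :
  compact A -> sigma_compact B -> sigma_compact (A `*` B).
Proof.
move=> cA [K [cK ->]]; exists (fun n => A `*` K n); split.
  by move=> n; exact: compact_setX.
apply/seteqP; split=> [[a b] [/= Aa [n _ Kb]]|[a b] [n _ [/= Aa Kb]]].
  by exists n.
by split => //; exists n.
Qed.

Lemma sigma_compact_image (T U : topologicalType) (f : T -> U) (A : set T) :
  continuous f -> sigma_compact A -> sigma_compact (f @` A).
Proof.
move=> cf [K [cK ->]]; exists (fun n => f @` K n); split.
  by move=> n; apply: continuous_compact => //; exact: continuous_subspaceT.
by rewrite image_bigcup.
Qed.

Lemma sigma_compact_bigcup_closed (T : topologicalType) (A : set T) :
  hausdorff_space T -> sigma_compact A ->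
  exists K : nat -> set T, (forall n, closed (K n)) /\ A = \bigcup_n K n.
Proof. by move=> hT [K [cK ->]]; exists K; split => // n; exact: compact_closed. Qed.

Lemma compact_le2 (d : nat) (M : R) :
  compact [set z : 'rV[R]_d * 'rV[R]_d | `|z.1| <= M /\ `|z.2| <= M].
Proof.
by apply: (@compact_setX _ _ [set x : 'rV[R]_d | `|x| <= M] [set x : 'rV[R]_d | `|x| <= M]);
  exact: compact_norm_le.
Qed.

Lemma sigma_compact_rV2 (d : nat) : sigma_compact [set: 'rV[R]_d * 'rV[R]_d].
Proof.
exists (fun n => [set z | `|z.1| <= n%:R /\ `|z.2| <= n%:R]); split.
  by move=> n; exact: compact_le2.
apply/seteqP; split=> // z _.
exists (Num.truncn (Num.max `|z.1| `|z.2|)).+1 => //=.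
have := truncnS_gt (Num.max `|z.1| `|z.2|); rewrite gt_max => /andP[h1 h2].
by split; exact: ltW.
Qed.

Lemma sigma_compact_measurable_rV (d : nat) (A : set 'rV[R]_d) :
  sigma_compact A -> measurable A.
Proof.
move=> /(sigma_compact_bigcup_closed (@norm_hausdorff _ _))[K [cK ->]].
apply: bigcup_measurable => n _; rewrite -[X in measurable X]setCK.
by apply: measurableC; apply: open_measurable_rV; exact: closed_openC.
Qed.

Lemma second_countable_real : @second_countable R.
Proof.
exists ((fun q : rat * rat => `](ratr q.1 : R), ratr q.2[%classic) @` setT).
  by apply: (card_le_trans (card_image_le _ _)); exact: countableP.
split=> [_ [q _ <-]|x A /nbhs_ballP[e /= e0 eA]]; first exact: interval_open.
have /rat_in_itvoo[p] : x - e < x by lra.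
have /rat_in_itvoo[q] : x < x + e by lra.
rewrite !in_itv/= => /andP[xq qe] /andP[ep px].
exists `](ratr p : R), ratr q[%classic.
  by split; [exists (p, q)|rewrite /= in_itv/= px].
move=> y; rewrite /= in_itv/= => /andP[py yq]; apply: eA.
by rewrite /ball/= ltr_norml; apply/andP; split; lra.
Qed.

Lemma sigma_compact_measurable_RrV (d : nat) (A : set (R * 'rV[R]_d)) :
  sigma_compact A -> measurable (A : set (measurableTypeR R * 'rV[R]_d)).
Proof.
move=> /(sigma_compact_bigcup_closed (@norm_hausdorff _ _))[K [cK ->]].
apply: bigcup_measurable => n _; rewrite -[X in measurable X]setCK.
apply: measurableC.
rewrite (_ : ~` K n = [set p | (~` K n) (p.1, p.2)]); last first.
  by apply/seteqP; split=> -[].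
apply: (@open_setX_measurable _ _ (measurableTypeR R) 'rV[R]_d R 'rV[R]_d id id (~` K n)).
- exact: second_countable_real.
- exact: second_countable_rV.
- by move=> V oV; rewrite preimage_id; exact: open_measurable.
- by move=> V oV; rewrite preimage_id; exact: open_measurable_rV.
- exact: closed_openC.
Qed.

End sigma_compact.

(** * A function integrable on no interval *)

Section nowhere_integrable.
Context (R : realType).
Local Notation mu := (@lebesgue_measure R).

(** The natural number paired with the rational is a mere tag: each rational becomes the centre of
    infinitely many balls, hence of arbitrarily small ones. *)
Definition spike_center (j : nat) : R :=
  if (unpickle j : option (rat * nat)) is Some q then ratr q.1 else 0.

Definition spike_radius (j : nat) : R := (2 ^ j.+1)%:R^-1.

Definition spike_ball (j : nat) : set R :=
  `]spike_center j - spike_radius j, spike_center j + spike_radius j[%classic.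

(** Almost everywhere finite by Borel-Cantelli, but of integral at least 2 on every
    [spike_ball j], and every interval contains arbitrarily small such balls. *)
Definition spike_sum (t : R) : \bar R :=
  (\sum_(j <oo) ((spike_radius j)^-1 * \1_(spike_ball j) t)%:E)%E.

Lemma spike_radius_gt0 j : 0 < spike_radius j.
Proof. by rewrite invr_gt0 ltr0n expn_gt0. Qed.

Lemma spike_radius_lt (e : R) : 0 < e -> exists n, forall j, (n <= j)%N -> spike_radius j < e.
Proof.
move=> e0; exists (Num.truncn e^-1) => j nj.
rewrite invf_plt ?posrE ?ltr0n ?expn_gt0//.
apply: lt_le_trans (truncnS_gt _) _; rewrite ler_nat.
by apply: leq_trans (ltnW (ltn_expl _ (ltnSn 1))); rewrite ltnS.
Qed.

(** One rational has infinitely many codes, of which only finitely many are below [n]. *)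
Lemma spike_center_dense (a b : R) (n : nat) : a < b ->
  exists j, (n <= j)%N /\ a < spike_center j < b.
Proof.
move=> /rat_in_itvoo[q]; rewrite in_itv/= => qab.
suff [m nm] : exists m : nat, (n <= @pickle (rat * nat)%type (q, m))%N.
  by exists (@pickle (rat * nat)%type (q, m)); split => //; rewrite /spike_center pickleK.
apply/not_existsP => h; have hlt m : (@pickle (rat * nat)%type (q, m) < n)%N.
  by rewrite ltnNge; apply/negP; exact: h.
have : injective (fun m : 'I_n.+1 => Ordinal (hlt m)).
  move=> m m' /(congr1 val)/= /(pcan_inj pickleK) [] ?; exact: val_inj.
by move=> /leq_card; rewrite !card_ord ltnn.
Qed.

Lemma measurable_spike_ball j : measurable (spike_ball j).
Proof. exact: measurable_itv. Qed.

Lemma spike_limsup_null : mu (lim_sup_set spike_ball) = 0%E.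
Proof.
apply: lim_sup_set_cvg0; first exact: measurable_spike_ball.
have mE n : mu (spike_ball n) = (2 / (2 ^ (n + 1))%:R)%:E.
  rewrite /spike_ball lebesgue_measure_itv /= lte_fin ifT; last first.
    by have := spike_radius_gt0 n; lra.
  by rewrite -EFinD addn1; congr EFin; rewrite /spike_radius; ring.
apply: (@le_lt_trans _ _ (\sum_(n <oo) (2 / (2 ^ (n + 1))%:R)%:E)%E).
  apply: lee_nneseries => [n _ _|n _]; first exact: measure_ge0.
  by rewrite le_eqVlt; apply/orP; left; apply/eqP; exact: mE.
have /cvg_lim := @cvg_geometric_eseries_half R 2 0.
by rewrite /eseries/= => -> //; rewrite ltry.
Qed.

Lemma spike_term_ge0 t j : 0 <= (spike_radius j)^-1 * \1_(spike_ball j) t.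
Proof. by rewrite mulr_ge0 ?indicE ?ler0n ?invr_ge0 ?(ltW (spike_radius_gt0 _)). Qed.

Lemma spike_sum_finite t : ~ lim_sup_set spike_ball t -> (spike_sum t < +oo)%E.
Proof.
move=> /existsNP[n /not_implyP[_ tn]].
apply: (@le_lt_trans _ _ (\sum_(0 <= j < n) ((spike_radius j)^-1 * \1_(spike_ball j) t)%:E)%E);
  last by rewrite sumEFin ltry.
apply: lime_le; first by apply: is_cvg_nneseries => j _ _; rewrite lee_fin spike_term_ge0.
apply: nearW => k.
have [kn|nk] := leqP k n.
  rewrite [X in (_ <= X)%E](@big_cat_nat _ _ _ k)//=.
  by rewrite leeDl// sume_ge0// => j _; rewrite lee_fin spike_term_ge0.
rewrite (@big_cat_nat _ _ _ n)//= ?(ltnW nk)// [X in (_ + X)%E]big1_seq ?adde0//.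
move=> j; rewrite mem_index_iota /= => /andP[nj _].
rewrite indicE memNset ?mulr0// => tj; apply: tn; exists j => //.
Qed.

Lemma spike_sum_ge t j : spike_ball j t -> ((spike_radius j)^-1%:E <= spike_sum t)%E.
Proof.
move=> tj; apply: le_trans (nneseries_lim_ge j.+1 _); last first.
  by move=> i _ _; rewrite lee_fin spike_term_ge0.
rewrite big_nat_recr//= indicE mem_set// mulr1 leeDr// sume_ge0// => i _.
by rewrite lee_fin spike_term_ge0.
Qed.

(** [fine] replaces the value +oo by 0, which happens only on the null set of points in infinitely
    many balls. *)
Definition spike (t : R) : R := fine (spike_sum t).

Lemma measurable_spike : measurable_fun setT spike.
Proof.
apply: (measurableT_comp (fine_measurable measurableT)).
apply: ge0_emeasurable_sum => [j t _ _|j _]; first by rewrite lee_fin spike_term_ge0.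
apply/measurable_EFinP; apply: measurable_funM => //.
by apply: measurable_indic; exact: measurable_spike_ball.
Qed.

(** On a ball of radius r inside the interval the derivative is at least 1/r, so [g] grows by at
    least 2 across it; but uniform continuity keeps the increment below 1 as soon as 2r < [del]. *)
Lemma spike_no_primitive (g : R -> R) (a b : R) : ac_real g -> 0 <= a -> a < b -> b <= 1 ->
  ~ {ae mu, forall t, t \in `]a, b[ -> is_derive t (1 : R) g (spike t)}.
Proof.
move=> ag a0 ab b1 dg; have [del del0 H] := ac_real_uniform ag ltr01.
pose e := Num.min ((b - a) / 4) (del / 4).
have e0 : 0 < e by rewrite lt_min !divr_gt0// subr_gt0.
have [n nr] := spike_radius_lt e0.
have mid : a + (b - a) / 4 < b - (b - a) / 4 by lra.
have [j [/nr jr /andP[jl ju]]] := spike_center_dense n mid.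
move: jr; rewrite lt_min => /andP[r1 r2].
have r0 := spike_radius_gt0 j.
pose c := spike_center j; pose r := spike_radius j; rewrite -/c -/r in jl ju r0 r1 r2.
have cr : a < c - r by lra.
have cr' : c + r < b by lra.
have inc : g (c + r) - g (c - r) < 1.
  by apply: le_lt_trans (ler_norm _) (H _ _ _ _ _ _); lra.
have ae_ge : {ae mu, forall t, t \in `]c - r, c + r[ -> r^-1 <= spike t}.
  apply: ae_mono2 (_ : {ae mu, forall t, ~ lim_sup_set spike_ball t}) (aeW mu (fun=> I)).
    move=> t tl _ tc; have ts := spike_sum_finite tl.
    have tj : spike_ball j t by [].
    have := spike_sum_ge tj; rewrite /spike => h.
    by rewrite -lee_fin fineK// ge0_fin_numE// (le_trans _ h)// lee_fin invr_ge0 ltW.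
  exists (lim_sup_set spike_ball); split; [|exact: spike_limsup_null|].
    apply: bigcapT_measurable => k.
    by apply: bigcup_measurable => i _; exact: measurable_spike_ball.
  by move=> t /= /contrapT.
have := @ac_nonincreasing R (fun t => r^-1 * t + (-1) * g t) (c - r) (c + r).
have -> : (r^-1 * (c + r) + -1 * g (c + r) <= r^-1 * (c - r) + -1 * g (c - r)) =
    (2 <= g (c + r) - g (c - r)).
  have -> : r^-1 * (c + r) = r^-1 * (c - r) + 2 by field; rewrite gt_eqF.
  by apply/idP/idP; lra.
move=> h; have : 2 <= g (c + r) - g (c - r); last by lra.
apply: h; [|lra|lra|lra|].
  apply: ac_realD; first by apply: ac_realZ; exact: ac_real_id.
  exact: ac_realZ.
apply: ae_mono2 dg ae_ge => t dgt rt tc.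
have tab : t \in `]a, b[ by move: tc; rewrite !in_itv/= => /andP[? ?]; apply/andP; split; lra.
have dg' := dgt tab; exists (r^-1 * 1 + (-1) * spike t); last by have := rt tc; lra.
exact: is_deriveD.
Qed.
End nowhere_integrable.

(** * Products of absolutely continuous functions and Gronwall's inequality *)

Section ac_algebra.
Context (R : realType).
Local Notation mu := (@lebesgue_measure R).
Implicit Types (f g u : R -> R).

Lemma ac_real_bounded g : ac_real g ->
  exists M : R, forall t : R, 0 <= t -> t <= 1 -> `|g t| <= M.
Proof.
move=> ag; have [del del0 H] := ac_real_uniform ag ltr01.
pose n := (Num.truncn del^-1).+1.
have n0 : 0 < n%:R :> R by rewrite ltr0n.
have ndel : n%:R^-1 < del by rewrite invf_plt ?posrE//; exact: truncnS_gt.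
exists (\sum_(k < n.+1) `|g (k%:R / n%:R)| + 1) => t t0 t1.
have tn0 : 0 <= t * n%:R by rewrite mulr_ge0// ltW.
have /andP[k1 k2] := truncn_itv tn0.
set k := Num.truncn _ in k1 k2.
have kn : (k < n.+1)%N.
  by rewrite ltnS -(ler_nat R); apply: (le_trans k1); rewrite ler_piMl// ltW.
have kt : k%:R / n%:R <= t by rewrite ler_pdivrMr.
have tk : t - k%:R / n%:R < del.
  apply: le_lt_trans ndel; rewrite (_ : t - _ = (t * n%:R - k%:R) / n%:R).
    by rewrite ler_piMl ?invr_ge0 ?(ltW n0)//; move: k2; rewrite -addn1 natrD; lra.
  by field; rewrite gt_eqF.
have k0 : 0 <= k%:R / n%:R :> R by rewrite divr_ge0.
have := H _ _ k0 kt t1 tk.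
have : `|g (k%:R / n%:R)| <= \sum_(k < n.+1) `|g (k%:R / n%:R)|.
  by rewrite (bigD1 (Ordinal kn))//= lerDl sumr_ge0.
have := ler_normD (g t - g (k%:R / n%:R)) (g (k%:R / n%:R)); rewrite subrK; lra.
Qed.

Lemma ac_realM f g : ac_real f -> ac_real g -> ac_real (fun t => f t * g t).
Proof.
move=> af ag; have [M fM] := ac_real_bounded af; have [L gL] := ac_real_bounded ag.
have K0 : 0 <= `|M| + `|L| by rewrite addr_ge0.
apply: (ac_real_le2 K0 af ag) => a b a0 ab b1.
have -> : f b * g b - f a * g a = (f b - f a) * g b + f a * (g b - g a) by ring.
apply: le_trans (ler_normD _ _) _; rewrite !normrM mulrDr lerD//.
  rewrite mulrC ler_wpM2r//; apply: le_trans (gL _ _ b1) _; first exact: le_trans ab.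
  by apply: le_trans (ler_norm _) _; rewrite lerDr.
rewrite ler_wpM2r//; apply: le_trans (fM _ a0 _) _; first exact: le_trans b1.
by apply: le_trans (ler_norm _) _; rewrite lerDl.
Qed.

Lemma ac_real_cst (c : R) : ac_real (fun=> c).
Proof. by apply: (@ac_real_lipschitz R _ 0) => // a b _ _ _; rewrite subrr normr0 mul0r. Qed.

Lemma ac_realX g n : ac_real g -> ac_real (fun t => g t ^+ n).
Proof.
move=> ag; elim: n => [|n IH]; first exact: ac_real_cst.
by under eq_fun do rewrite exprS; exact: (@ac_realM g (fun t => g t ^+ n)).
Qed.

(** Gronwall's inequality, forward for [s = 1] and backward for [s = -1]; the
    weight [(3 - s t) ^+ 16] replaces the exponential. *)
Lemma ac_gronwall u (s a b : R) : s ^+ 2 = 1 -> ac_real u -> (forall t, 0 <= u t) ->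
  0 <= a -> a <= b -> b <= 1 ->
  {ae mu, forall t, t \in `]a, b[ -> exists2 D, is_derive t (1 : R) u D & s * D <= 4 * u t} ->
  s * u b * (3 - s * b) ^+ 16 <= s * u a * (3 - s * a) ^+ 16.
Proof.
move=> s1 au u0 a0 ab b1 du.
have sab : -1 <= s <= 1.
  have /eqP : s ^+ 2 = 1 by []; rewrite sqrf_eq1 => /orP[] /eqP ->; lra.
apply: (@ac_nonincreasing R (fun t => s * u t * (3 - s * t) ^+ 16)) => //.
  apply: ac_realM; first exact: ac_realZ.
  apply: ac_realX; rewrite (_ : (fun t => _) = fun t => 3 + (- s) * t); last first.
    by apply/funext => t; rewrite mulNr.
  by apply: ac_realD; [exact: ac_real_cst|apply: ac_realZ; exact: ac_real_id].
apply: ae_mono2 du (aeW mu (fun=> I)) => t dt _ tab; have [D dD Dle] := dt tab.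
have t01 : 0 <= t <= 1 by move: tab; rewrite in_itv/= => /andP[? ?]; apply/andP; split; lra.
exists ((3 - s * t) ^+ 15 * (s * D * (3 - s * t) - 16 * u t)).
  have d1 : is_derive t (1 : R) (fun t => s * u t) (s * D) by exact: is_deriveZ.
  have d2 : is_derive t (1 : R) (fun t => 3 - s * t) (0 - s * 1).
    by apply: is_deriveB; exact: is_deriveZ.
  have d3 : is_derive t (1 : R) (fun t => (3 - s * t) ^+ 16)
      ((16 * (3 - s * t) ^+ 15) *: (0 - s * 1)).
    by have := is_deriveX 16 d2; rewrite exprfctE.
  have d4 := @is_deriveM R R (fun t => s * u t) (fun t => (3 - s * t) ^+ 16) t 1 _ _ d1 d3.
  apply: is_derive_eq d4 _; rewrite /GRing.scale/= (exprS _ 15).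
  transitivity ((3 - s * t) ^+ 15 * (s * D * (3 - s * t) - s ^+ 2 * 16 * u t)).
    by set q := (_ ^+ 15); ring.
  by rewrite s1 mul1r.
have /andP[q0 q1] : 0 <= 3 - s * t <= 4.
  by case/andP: sab t01 => ? ? /andP[? ?]; apply/andP; split; nra.
rewrite mulr_ge0_le0 ?exprn_ge0// subr_le0.
(* The exponent 16 is the growth rate 4 times the upper bound 4 of [3 - s * t]. *)
apply: (@le_trans _ _ (4 * u t * (3 - s * t))); first by rewrite ler_wpM2r.
have := u0 t; nra.
Qed.
End ac_algebra.

(** * The velocity field of a monotone support *)

Section monotone_field.
Context (R : realType) (d : nat).
Local Notation E := 'rV[R]_d.
Local Notation V := (E * E)%type.
Local Notation T01 := ((`[0%R, 1%R]%classic : set (measurableTypeR R))).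
Variables (G : set V).

Definition on_segment (t : R) (x : E) : Prop := exists z, G z /\ segment_at t z = x.

(** Off the segments no curve can follow this field, by [spike_no_primitive]. *)
Definition monotone_field (t : R) (x : E) : E :=
  if pselect (0 < t < 1 /\ on_segment t x) is left h
  then let z := sval (cid h.2) in z.2 - z.1 else const_mx (spike t).

Hypothesis mG : monotone_set G.

Lemma monotone_fieldE t z : 0 < t < 1 -> G z ->
  monotone_field t (segment_at t z) = z.2 - z.1.
Proof.
move=> t01 Gz; rewrite /monotone_field; case: pselect => [h|]; last first.
  by move=> []; split => //; exists z.
have [Gz' zz] := svalP (cid h.2).
by rewrite (segment_at_inj mG Gz' Gz t01 zz).
Qed.

Lemma monotone_field_off t x : ~ on_segment t x -> monotone_field t x = const_mx (spike t).
Proof. by move=> n; rewrite /monotone_field; case: pselect => // h; case: (n h.2). Qed.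

Hypothesis cG : closed G.

Lemma continuous_segment :
  continuous (fun p : R * V => (p.1, segment_at p.1 p.2) : R * E).
Proof.
move=> p.
have c1 : {for p, continuous (fun p : R * V => p.1)} by exact: cvg_fst.
have c21 : {for p, continuous (fun p : R * V => p.2.1)}.
  by apply: (@continuous_comp _ _ _ snd fst); [exact: cvg_snd|exact: cvg_fst].
have c22 : {for p, continuous (fun p : R * V => p.2.2)}.
  by apply: (@continuous_comp _ _ _ snd snd); [exact: cvg_snd|exact: cvg_snd].
have cs : {for p, continuous (fun p : R * V => segment_at p.1 p.2)}.
  apply: (@continuousD _ _ _ (fun p : R * V => (1 - p.1) *: p.2.1) (fun p => p.1 *: p.2.2)).
    apply: (@continuousZ _ _ _ (fun p : R * V => 1 - p.1) (fun p => p.2.1)) => //.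
    apply: (@continuous_comp _ _ _ fst (fun t : R => 1 - t)) => //.
    by apply: cvgB; [exact: cvg_cst|exact: cvg_id].
  exact: (@continuousZ _ _ _ (fun p : R * V => p.1) (fun p => p.2.2)).
exact: (cvg_pair c1 cs).
Qed.

Lemma measurable_segments (C : set V) : closed C ->
  measurable ([set p | 0 <= p.1 <= 1 /\ exists z, (G `&` C) z /\ segment_at p.1 z = p.2]
    : set (measurableTypeR R * E)).
Proof.
move=> cC.
rewrite (_ : [set p | _] = (fun p : R * V => (p.1, segment_at p.1 p.2) : R * E) @`
    (`[0, 1] `*` ((setT `&` G) `&` C))).
  apply: sigma_compact_measurable_RrV; apply: sigma_compact_image.
    exact: continuous_segment.
  apply: sigma_compact_setX; first exact: segment_compact.
  apply: sigma_compact_closedI => //; apply: sigma_compact_closedI => //.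
  exact: sigma_compact_rV2.
apply/seteqP; split=> [[t x] /= [t01 [z [[Gz Cz] zx]]]|_ [[t z] [/= t01 [[_ Gz] Cz]] <-]].
  by exists (t, z); rewrite /= ?zx// in_itv.
by split; [move: t01; rewrite in_itv|exists z].
Qed.

Lemma closed_coord_diff (i : 'I_d) (c : R) :
  closed [set z : V | c <= z.2 ord0 i - z.1 ord0 i].
Proof.
rewrite (_ : [set z | _] = (fun z : V => z.2 ord0 i - z.1 ord0 i) @^-1` [set y | c <= y]) //.
apply: closed_comp => [z _|]; last exact: closed_ge.
apply: (@continuousB _ _ _ (fun z : V => z.2 ord0 i) (fun z : V => z.1 ord0 i)).
  apply: (@continuous_comp _ _ _ snd (fun x : E => x ord0 i)); first exact: cvg_snd.
  exact: coord_continuous.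
apply: (@continuous_comp _ _ _ fst (fun x : E => x ord0 i)); first exact: cvg_fst.
exact: coord_continuous.
Qed.

(** Within the segments a superlevel set of a coordinate is the union of the graphs of those
    segments whose direction satisfies the bound, a Borel set by sigma-compactness; since a point
    determines its segment, no other point is included. Elsewhere the field is [spike]. *)
Lemma measurable_monotone_field : measurable_fun (T01 `*` [set: E])
  (fun p : measurableTypeR R * E => monotone_field p.1 p.2).
Proof.
have mD : measurable (T01 `*` [set: E]) by exact: measurableX.
apply: measurable_fun_rVP => // i.
apply: (measurability _ (measurable_realfun.RGenCInfty.measurableE R)) => _ [_ [c ->] <-].
pose D := (T01 `*` [set: E]).
pose I0 := (`]0%R, 1%R[%classic : set (measurableTypeR R)) `*` [set: E].
pose A (C : set V) := [set p : measurableTypeR R * E |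
  0 <= p.1 <= 1 /\ exists z, (G `&` C) z /\ segment_at p.1 z = p.2].
pose C := [set z : V | c <= z.2 ord0 i - z.1 ord0 i].
have mA : measurable (A setT) by apply: measurable_segments; exact: closedT.
have mC : measurable (A C) by apply: measurable_segments; exact: closed_coord_diff.
have mI : measurable I0 by exact: measurableX.
have mB : measurable [set p : measurableTypeR R * E | c <= spike p.1].
  rewrite (_ : [set p | _] = setT `&` (fun p : measurableTypeR R * E => spike p.1) @^-1` `[c, +oo[).
    have mb : measurable_fun setT (fun p : measurableTypeR R * E => spike p.1).
      exact: (measurableT_comp (@measurable_spike R) measurable_fst).
    exact: (mb measurableT _ (measurable_itv _)).
  by apply/seteqP; split=> p /=; rewrite in_itv/= andbT//; case.
rewrite (_ : _ `&` _ = (I0 `&` A C) `|` ((D `\` (I0 `&` A setT)) `&` [set p | c <= spike p.1])).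
  apply: measurableU; first exact: measurableI.
  by apply: measurableI => //; apply: measurableD => //; exact: measurableI.
have key t x : 0 < t < 1 -> on_segment t x ->
   (c <= monotone_field t x ord0 i) <-> A C (t, x).
  move=> t01 [z [Gz zx]]; rewrite -zx monotone_fieldE// !mxE; split=> [h|].
    split; first by rewrite /=; case/andP: t01 => ? ?; rewrite !ltW.
    by exists z.
  by move=> [_ [z' [[Gz' Cz'] zz]]]; rewrite -(segment_at_inj mG Gz' Gz t01 zz).
have key2 t x : ~ (0 < t < 1 /\ on_segment t x) ->
   monotone_field t x ord0 i = spike t.
  by rewrite /monotone_field; case: pselect => // _ _; rewrite mxE.
have AT t x : 0 < t < 1 -> A setT (t, x) <-> on_segment t x.
  move=> t01; split=> [[_ [z [[Gz _] zx]]]|[z [Gz zx]]]; first by exists z.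
  by split; [case/andP: t01 => ? ?; rewrite /= !ltW|exists z].
apply/seteqP; split=> [[t x] /= [[t01 _]]|[t x]].
  rewrite in_itv/= andbT => h.
  have [[t01' os]|n] := pselect (0 < t < 1 /\ on_segment t x).
    by left; split; [split; rewrite /= ?in_itv|exact/key].
  right; rewrite (key2 _ _ n) in h; split => //; split => //= -[[/= t01' _] At].
  by apply: n; rewrite in_itv in t01'; split => //; apply/AT.
case=> [[[/= t01 _] AC]|[[[/= t01 _] n] /= h]].
  have t01' : 0 < t < 1 by move: t01; rewrite in_itv.
  split; first by split => //=; move: t01'; rewrite in_itv/= => /andP[? ?]; rewrite !ltW.
  rewrite /= in_itv/= andbT; apply/key => //.
  by case: AC => _ [z [[Gz _] zx]]; exists z.
split => //; rewrite /= in_itv/= andbT key2// => -[t01' os]; apply: n; split; last exact/AT.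
by split; rewrite //= in_itv.
Qed.

End monotone_field.

Lemma continuous_pair (T U W : topologicalType) (f : T -> U) (g : T -> W) (x : T) :
  {for x, continuous f} -> {for x, continuous g} -> {for x, continuous (fun y => (f y, g y))}.
Proof. by move=> cf cg; exact: (cvg_pair cf cg). Qed.

(** * Integral curves of the field *)

Section field_curves.
Context (R : realType) (d : nat).
Local Notation E := 'rV[R]_d.
Local Notation V := (E * E)%type.
Local Notation mu := (@lebesgue_measure R).
Variables (G : set V).
Hypothesis mG : monotone_set G.
Hypothesis cG : closed G.

Lemma path_of_continuous_at (l : curve R d) (t : R) : 0 < t < 1 ->
  {for t, continuous (path_of l)}.
Proof.
move=> /andP[t0 t1]; apply/cvgrPdist_lt => e e0.
have t01 : t \in `[0, 1] by rewrite in_itv/= !ltW.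
have [del del0 H] := path_of_near l t01 e0.
near=> s; rewrite distrC; apply: H.
  rewrite in_itv/=; apply/andP; split; apply: ltW; near: s;
    [exact: lt_nbhsr|exact: lt_nbhsl].
by rewrite distrC; near: s; apply: (@nbhsx_ballx _ R t del).
Unshelve. all: by end_near. Qed.

Lemma continuous_segment_in (z : V) : continuous (fun t : R => segment_at t z).
Proof.
move=> t; apply: (@continuousD R E R (fun t => (1 - t) *: z.1) (fun t => t *: z.2)).
  apply: (@continuousZ R E R (fun t => 1 - t) (fun=> z.1)); last exact: cst_continuous.
  by apply: cvgB; [exact: cvg_cst|exact: cvg_id].
apply: (@continuousZ R E R id (fun=> z.2)); last exact: cst_continuous.
exact: cvg_id.
Qed.

Lemma le_of_sqr_le (a q : R) : a ^+ 2 <= q -> a <= 1 + q.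
Proof. by move=> h; have := sqr_ge0 (a - 1); nra. Qed.

(** Relative closedness of the union of the graphs of the segments. *)
Lemma off_segment_near (l : curve R d) (t0 : R) (z0 : V) : G z0 -> 0 < t0 < 1 ->
  ~ on_segment G t0 (path_of l t0) ->
  \forall t \near t0, ~ on_segment G t (path_of l t).
Proof.
move=> Gz0 t01 off; have /andP[t00 t10] := t01.
pose e := Num.min t0 (1 - t0) / 2.
have e0 : 0 < e by rewrite divr_gt0// lt_min t00 subr_gt0.
pose q t := sqnorm (path_of l t - segment_at t z0).
have cq : {for t0, continuous q}.
  apply: (@continuous_comp _ _ _ (fun t => path_of l t - segment_at t z0) (@sqnorm R d)).
    apply: (@continuousB _ _ _ (path_of l) (fun t => segment_at t z0)).
      exact: path_of_continuous_at.
    exact: continuous_segment_in.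
  exact: sqnorm_continuous.
pose B := q t0 + 1.
(* A bound for the endpoints of every segment met by the curve near [t0]: there t and 1 - t are at
   least [e], and the squared distance to the segment of [z0] is below [B]. The graphs of segments
   within this bound form a compact set. *)
pose M := `|z0.1| + `|z0.2| + (1 + B / e ^+ 2).
pose K := `[0, 1] `*` ([set z : V | `|z.1| <= M /\ `|z.2| <= M] `&` G) : set (R * V).
have cK : compact ((fun p : R * V => (p.1, segment_at p.1 p.2) : R * E) @` K).
  apply: continuous_compact; first by apply: continuous_subspaceT; exact: continuous_segment.
  apply: compact_setX; first exact: segment_compact.
  by apply: compact_closedI => //; exact: compact_le2.
have oK := closed_openC (compact_closed (@norm_hausdorff _ _) cK).
have nK : \forall t \near t0, ~ ((fun p : R * V => (p.1, segment_at p.1 p.2) : R * E) @` K)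
    (t, path_of l t).
  have cp : {for t0, continuous (fun t => (t, path_of l t) : R * E)}.
    by apply: (@continuous_pair _ _ _ id (path_of l)); [exact: cvg_id|exact: path_of_continuous_at].
  apply: (cp (~` ((fun p : R * V => (p.1, segment_at p.1 p.2) : R * E) @` K))).
  apply: open_nbhs_nbhs; split; first exact: oK.
  move=> -[[t z] /= [_ [_ Gz]] [tt zz]]; apply: off; exists z; split => //.
  by rewrite tt in zz.
near=> t => -[z [Gz zt]].
have tK : ~ ((fun p : R * V => (p.1, segment_at p.1 p.2) : R * E) @` K) (t, path_of l t).
  by near: t.
have qB : q t < B.
  by near: t; apply: (cq [set y | y < B]); apply: open_nbhs_nbhs; split;
    [exact: open_lt|rewrite /= /B ltrDl].
have te : `|t0 - t| < e by near: t; apply: (@nbhsx_ballx _ R t0 e).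
have [et et1] : e <= t /\ e <= 1 - t.
  have := te; rewrite ltr_norml /e => /andP[].
  have : Num.min t0 (1 - t0) <= t0 by rewrite ge_min lexx.
  have : Num.min t0 (1 - t0) <= 1 - t0 by rewrite ge_min lexx orbT.
  by move=> *; split; lra.
apply: tK; exists (t, z); last by rewrite /= zt.
have tt01 : 0 <= t <= 1 by apply/andP; split; lra.
split => /=; first by rewrite in_itv.
split => //=; have := sqnorm_segment_at_ge mG Gz Gz0 tt01; rewrite zt -/(q t) => h.
have bound (x y : E) (s : R) : e <= s -> s ^+ 2 * sqnorm (x - y) <= q t ->
    `|x| <= `|y| + (1 + B / e ^+ 2).
  move=> es hs; rewrite -lerBlDl; apply: le_trans (lerB_dist _ _) _.
  apply: le_of_sqr_le; apply: le_trans (norm_sqr_le_sqnorm _) _.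
  rewrite ler_pdivlMr ?exprn_gt0// mulrC; apply: le_trans (le_trans hs (ltW qB)).
  by rewrite ler_wpM2r ?sqnorm_ge0// lerXn2r ?nnegrE ?(ltW e0)//; lra.
have p1 : 0 <= (1 - t) ^+ 2 * sqnorm (z.1 - z0.1) by rewrite mulr_ge0 ?sqr_ge0 ?sqnorm_ge0.
have p2 : 0 <= t ^+ 2 * sqnorm (z.2 - z0.2) by rewrite mulr_ge0 ?sqr_ge0 ?sqnorm_ge0.
split.
  apply: le_trans (bound z.1 z0.1 (1 - t) et1 _) _; first lra.
  by rewrite lerD2r lerDl.
apply: le_trans (bound z.2 z0.2 t et _) _; first lra.
by rewrite lerD2r lerDr.
Unshelve. all: by end_near. Qed.

Lemma field_curve_on_segment (l : curve R d) (z0 : V) : G z0 ->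
  abs_continuous (path_of l) -> follows (monotone_field G) l ->
  forall t, 0 < t < 1 -> on_segment G t (path_of l t).
Proof.
move=> Gz0 acl fl t t01; apply: contrapT => off.
(* The contradiction needs one coordinate; in dimension 0 all points coincide. *)
have [i _|d0] := pickP 'I_d; last first.
  by apply: off; exists z0; split => //; apply/rowP => i; have := d0 i.
have [/= e e0 eP] := (nbhs_ballP _ _).1 (off_segment_near Gz0 t01 off).
pose a := Num.max 0 (t - e); pose b := Num.min 1 (t + e).
have /andP[t0 t1] := t01.
have ab : a < b.
  by rewrite lt_min !gt_max; apply/andP; split; apply/andP; split; lra.
apply: (@spike_no_primitive R (fun t => path_of l t ord0 i) a b _ _ ab).
- exact: ac_real_coord.
- by rewrite le_max lexx.
- by rewrite ge_min lexx.
apply: ae_mono2 fl (aeW mu (fun=> I)) => s fs _ sab.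
move: sab; rewrite in_itv/= gt_max lt_min => /andP[/andP[s0 se] /andP[s1 es]].
have s01 : s \in `]0, 1[ by rewrite in_itv/= s0.
have := is_derive_coord i (fs s01); rewrite monotone_field_off ?mxE//.
by apply: eP; rewrite /ball/= ltr_norml; apply/andP; split; lra.
Qed.

(** Let w be the difference between the curve and the segment met at time 1/2. If X and Y are the
    endpoint differences of the segment met at time t, then w = (1 - t) X + t Y and w' = Y - X, so w
    - t w' = X and w + (1 - t) w' = Y. The two differential inequalities say that w.X and w.Y are
    nonnegative, which is monotonicity. *)
Lemma field_curve_straight (l : curve R d) (z0 : V) : G z0 ->
  abs_continuous (path_of l) -> follows (monotone_field G) l ->
  exists2 z, G z & forall t : R, t \in `[0, 1] -> path_of l t = segment_at t z.
Proof.
move=> Gz0 acl fl; have os := field_curve_on_segment Gz0 acl fl.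
have half01 : 0 < (2^-1 : R) < 1 by apply/andP; split; lra.
have [z [Gz zh]] := os _ half01; exists z => //.
pose w i t := path_of l t ord0 i - segment_at t z ord0 i.
pose u t := \sum_(i < d) w i t ^+ 2.
have u0 t : 0 <= u t by apply: sumr_ge0 => i _; exact: sqr_ge0.
have uE t : u t = sqnorm (path_of l t - segment_at t z).
  by apply: eq_bigr => i _; rewrite /w !mxE.
have acw i : ac_real (w i).
  rewrite (_ : w i = fun t => path_of l t ord0 i + ((z.1 ord0 i - z.2 ord0 i) * t + (- z.1 ord0 i))).
    apply: ac_realD; first exact: ac_real_coord.
    apply: ac_realD; last exact: ac_real_cst.
    by apply: ac_realZ; exact: ac_real_id.
  by apply/funext => t; rewrite /w !mxE; ring.
have acu : ac_real u by apply: ac_real_sum => i; exact: ac_realX.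
have du : {ae mu, forall t : R, t \in `]0, 1[ -> exists2 D : R, is_derive t (1 : R) u D &
    t * D <= 2 * u t /\ - (1 - t) * D <= 2 * u t}.
  apply: ae_mono2 fl (aeW mu (fun=> I)) => t ft _ t01.
  have t01' : 0 < t < 1 by move: t01; rewrite in_itv.
  have [z' [Gz' zt]] := os _ t01'.
  pose X i := z'.1 ord0 i - z.1 ord0 i; pose Y i := z'.2 ord0 i - z.2 ord0 i.
  have dw i : is_derive t (1 : R) (w i) (Y i - X i).
    have h1 := is_derive_coord i (ft t01).
    rewrite -zt monotone_fieldE// !mxE in h1.
    have h2 : is_derive t (1 : R) (fun t => segment_at t z ord0 i)
        ((0 - 1) * z.1 ord0 i + 1 * z.2 ord0 i).
      rewrite (_ : (fun t => _) = fun t => (z.2 ord0 i - z.1 ord0 i) * t + z.1 ord0 i); last first.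
        by apply/funext => s; rewrite !mxE; ring.
      apply: is_derive_eq; rewrite /GRing.scale/=; ring.
    by apply: is_derive_eq (is_deriveB h1 h2) _; rewrite /X /Y; ring.
  have wE i : w i t = (1 - t) * X i + t * Y i.
    by rewrite /w -zt !mxE /X /Y; ring.
  exists (\sum_(i < d) 2 * w i t * (Y i - X i)).
    rewrite (_ : u = \sum_(i < d) (w i ^+ 2)); last first.
      by apply/funext => s; rewrite fct_sumE; apply: eq_bigr => i _; rewrite exprfctE.
    apply: is_derive_sum => i; exact: is_derive_eq (is_deriveX 2 (dw i)) _.
  have c0 : 0 <= \sum_(i < d) X i * Y i by exact: mG Gz' Gz.
  have X0 : 0 <= \sum_(i < d) X i ^+ 2 by apply: sumr_ge0 => i _; exact: sqr_ge0.
  have Y0 : 0 <= \sum_(i < d) Y i ^+ 2 by apply: sumr_ge0 => i _; exact: sqr_ge0.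
  have [t0 t1] := andP t01'.
  split; rewrite -subr_ge0.
    have -> : 2 * u t - t * (\sum_(i < d) 2 * w i t * (Y i - X i)) =
        2 * (1 - t) * (\sum_(i < d) X i ^+ 2) + 2 * t * (\sum_(i < d) X i * Y i).
      rewrite /u !mulr_sumr -sumrB -big_split/=.
      by apply: eq_bigr => i _; rewrite wE; ring.
    by rewrite addr_ge0// mulr_ge0//; lra.
  have -> : 2 * u t - - (1 - t) * (\sum_(i < d) 2 * w i t * (Y i - X i)) =
      2 * t * (\sum_(i < d) Y i ^+ 2) + 2 * (1 - t) * (\sum_(i < d) X i * Y i).
    rewrite /u !mulr_sumr -sumrB -big_split/=.
    by apply: eq_bigr => i _; rewrite wE; ring.
  by rewrite addr_ge0// mulr_ge0//; lra.
have uh : u 2^-1 = 0.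
  by rewrite uE zh subrr /sqnorm big1// => i _; rewrite mxE expr0n.
(* The rates 2 / t and 2 / (1 - t) blow up at the ends; starting from 1/2, each is used only on the
   half where it is at most 4. *)
have step (t D : R) : 2^-1 <= t -> t * D <= 2 * u t -> D <= 4 * u t.
  by move=> th h; have := u0 t; nra.
move=> t; rewrite in_itv/= => /andP[t0 t1].
suff ut : u t <= 0.
  by apply/subr0_eq/sqnorm_eq0; rewrite -uE.
have [ht|th] := leP 2^-1 t.
  have := @ac_gronwall R u 1 2^-1 t (expr1n _ _) acu u0 _ ht t1.
  rewrite uh !mul1r mul0r => h; have : u t * (3 - t) ^+ 16 <= 0.
    apply: h; first by lra.
    apply: ae_mono2 du (aeW mu (fun=> I)) => s ds _; rewrite in_itv/= => /andP[s0 s1].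
    have s01 : s \in `]0, 1[ by rewrite in_itv/=; apply/andP; split; lra.
    have [D dD [D1 D2]] := ds s01; exists D => //; rewrite mul1r; apply: step => //.
    exact: ltW.
  by rewrite pmulr_lle0// exprn_gt0//; lra.
have := @ac_gronwall R u (-1) t 2^-1 _ acu u0 t0 (ltW th).
rewrite uh !mulN1r !mulNr mul0r oppr0 !opprK => h.
have : 0 <= - (u t * (3 + t) ^+ 16).
  apply: h; [by rewrite sqrrN expr1n|by lra|].
  apply: ae_mono2 du (aeW mu (fun=> I)) => s ds _; rewrite in_itv/= => /andP[s0 s1].
  have s01 : s \in `]0, 1[ by rewrite in_itv/=; apply/andP; split; lra.
  have [D dD [D1 D2]] := ds s01; exists D => //; rewrite mulN1r.
  by have := u0 s; nra.
by rewrite oppr_ge0 pmulr_lle0// exprn_gt0//; lra.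
Qed.

End field_curves.

(** The field is tied to the segments at interior times only, so integrands over time are known off
    the two endpoints. *)
Lemma integral_unit_itv_cst (R : realType) (f : R -> \bar R) (c : \bar R) :
  (forall t, t \in `]0%R, 1%R[ -> f t = c) ->
  (\int[@lebesgue_measure R]_(t in `[0%R, 1%R]) f t = c)%E.
Proof.
move=> fc; rewrite -[RHS](@integral_cst_unit R c) integral_itv_bndoo; last first.
  by apply: (@eq_measurable_fun _ _ _ _ _ (cst c)) => // t /set_mem/fc.
rewrite integral_itv_bndoo; last exact: measurable_cst.
by apply: eq_integral => t /set_mem/fc.
Qed.

Lemma is_derive_segment (R : realType) (d : nat) (z : 'rV[R]_d * 'rV[R]_d) (t : R) :
  is_derive t (1 : R) (fun t => segment_at t z) (z.2 - z.1).
Proof.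
have lim : h^-1 *: (((fun t => segment_at t z) \o shift t) (h *: (1 : R)) - segment_at t z)
    @[h --> 0^'] --> z.2 - z.1.
  apply: cvg_near_cst; near=> h.
  have h0 : h != 0 by near: h; exact: nbhs_dnbhs_neq.
  rewrite [h *: 1]mulr1 /=; apply/rowP => j; rewrite !mxE; field.
  exact: h0.
by apply: DeriveDef; [apply/cvg_ex; exists (z.2 - z.1)|exact: cvg_lim].
Unshelve. all: by end_near. Qed.

(** * Loss and flow of the field *)

Section straight_field.
Local Open Scope ereal_scope.
Context (R : realType) (d : nat).
Local Notation E := 'rV[R]_d.
Local Notation V := (E * E)%type.
Local Notation mu := (@lebesgue_measure R).
Local Notation T01 := ((`[0%R, 1%R]%classic : set (measurableTypeR R))).
Variables (G : set V) (gam : probability V R).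
Hypothesis mG : monotone_set G.
Hypothesis cG : closed G.
Hypothesis measG : measurable G.
Hypothesis gamG : gam (~` G) = 0.
Hypothesis fin : cost gam < +oo.

Lemma ae_in_support : {ae gam, forall z, G z}.
Proof. by exists (~` G); split => //; exact: measurableC. Qed.

Let mv := measurable_monotone_field mG cG.

Lemma integral_monotone_field t : t \in `]0%R, 1%R[ ->
  \int[interpolation gam t]_x (sqnorm (monotone_field G t x))%:E = cost gam.
Proof.
move=> t01.
have t01' : (0 < t < 1)%R by move: t01; rewrite in_itv.
have t01c : t \in `[0%R, 1%R] by rewrite in_itv/= !ltW//; case/andP: t01'.
have mft : measurable_fun setT (monotone_field G t) by exact: (measurable_field_at mv t01c).
rewrite integral_interpolation; last 2 first.
- exact: measurable_fun_sqnorm.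
- by move=> x; rewrite lee_fin sqnorm_ge0.
apply: ae_eq_integral => //.
- by apply: measurable_fun_sqnorm; exact: (measurableT_comp mft (measurable_segment_at t)).
- by apply: measurable_fun_sqnorm; exact: measurable_fun_rVB.
apply: filterS ae_in_support => z Gz _ /=.
by rewrite (monotone_fieldE mG)// -sqnormN opprB.
Qed.

Lemma L2_monotone_field : L2_field gam (monotone_field G).
Proof.
split; first exact: mv.
by rewrite (@integral_unit_itv_cst R _ (cost gam)) => // t; exact: integral_monotone_field.
Qed.

Lemma fm_loss_monotone_field : fm_loss (monotone_field G) gam = 0.
Proof.
apply: integral_unit_itv_cst => t t01.
have t01' : (0 < t < 1)%R by move: t01; rewrite in_itv.
have t01c : t \in `[0%R, 1%R] by rewrite in_itv/= !ltW//; case/andP: t01'.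
have mft : measurable_fun setT (monotone_field G t) by exact: (measurable_field_at mv t01c).
rewrite -[RHS](integral0 gam setT); apply: ae_eq_integral => //.
  apply: measurable_fun_sqnorm; apply: measurable_fun_rVD => //.
  apply: measurable_fun_rVB => //.
  exact: (measurableT_comp mft (measurable_segment_at t)).
apply: filterS ae_in_support => z Gz _ /=; congr EFin.
rewrite -[X in monotone_field G t X]/(segment_at t z) (monotone_fieldE mG)//.
by rewrite /sqnorm big1// => i _; rewrite !mxE; ring.
Qed.

Lemma velocity_monotone_field : velocity_field gam (monotone_field G).
Proof.
split; first exact: L2_monotone_field.
move=> w _; rewrite fm_loss_monotone_field; apply: integral_ge0 => t _.
by apply: integral_ge0 => z _; rewrite lee_fin sqnorm_ge0.
Qed.

Lemma flow_solution_exists z : G z -> exists2 l : curve R d,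
  flow_solution (monotone_field G) z.1 l &
  forall t : R, t \in `[0%R, 1%R] -> path_of l t = segment_at t z.
Proof.
move=> Gz.
have [l lE] : exists l : curve R d,
    forall t, t \in `[0%R, 1%R] -> path_of l t = segment_at t z.
  by apply: ex_curve; apply: continuous_subspaceT; exact: continuous_segment_in.
exists l => //; split.
- by rewrite lE ?in_itv/= ?lexx ?ler01// /segment_at subr0 scale1r scale0r addr0.
- pose K := enorm (z.2 - z.1)%R.
  have K0 : (0 <= K)%R by exact: sqrtr_ge0.
  move=> e e0; exists (e / (K + 1))%R; first by rewrite divr_gt0//; lra.
  move=> n a b ab _ sd.
  have eK i : (enorm (path_of l (b i) - path_of l (a i)) = (b i - a i) * K)%R.
    have [a0 [aibi b1]] := ab i.
    rewrite !lE ?in_itv/=; last 2 first.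
    - by apply/andP; split; lra.
    - by apply/andP; split; lra.
    rewrite (_ : _ - _ = (b i - a i) *: (z.2 - z.1))%R.
      by rewrite /enorm sqnormZ sqrtrM ?sqr_ge0// sqrtr_sqr ger0_norm// subr_ge0.
    by apply/rowP => j; rewrite !mxE; ring.
  under eq_bigr do rewrite eK; rewrite -mulr_suml.
  apply: (@le_lt_trans _ _ ((e / (K + 1)) * K))%R; first by rewrite ler_wpM2r// ltW.
  by rewrite mulrAC ltr_pdivrMr; nra.
- apply: aeW => t t01.
  have t01' : (0 < t < 1)%R by move: t01; rewrite in_itv.
  have t01c : t \in `[0%R, 1%R] by rewrite in_itv/= !ltW//; case/andP: t01'.
  rewrite lE// (monotone_fieldE mG)//.
  apply: near_eq_is_derive (is_derive_segment z t); case/andP: t01' => t0 t1.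
  near=> s; rewrite lE// in_itv/=; apply/andP; split; apply: ltW; near: s;
    [exact: lt_nbhsr|exact: lt_nbhsl].
Unshelve. all: by end_near. Qed.

Lemma flow_solution_unique z : G z -> (forall z', G z' -> z'.1 = z.1 -> z' = z) ->
  exists! l : curve R d, flow_solution (monotone_field G) z.1 l.
Proof.
move=> Gz zu; have [l sl lE] := flow_solution_exists Gz.
exists l; split => // l' [l'0 acl' fl'].
have [z' Gz' l'E] := field_curve_straight mG cG Gz acl' fl'.
apply: path_of_inj => t t01; rewrite lE// l'E//; congr segment_at.
apply/esym/zu => //; rewrite -l'0 l'E ?in_itv/= ?lexx ?ler01//.
by rewrite /segment_at subr0 scale1r scale0r addr0.
Qed.

End straight_field.

(** * Weak limits and single-valuedness *)

Section weak_limits.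
Local Open Scope ereal_scope.
Context (R : realType) (d : nat).
Local Notation E := 'rV[R]_d.
Local Notation V := (E * E)%type.
Variables (g : nat -> probability V R) (gam : probability V R).
Hypothesis gcvg : weak_cvg g gam.

(** Lower semicontinuity of the cost: its truncations are bounded and continuous, hence admissible
    in weak convergence, and they increase to it. *)
Lemma weak_cvg_cost_le (c : \bar R) : (forall n, cost (g n) <= c) -> cost gam <= c.
Proof.
move=> gc; pose psi (M : nat) (z : V) : R := Num.min (sqnorm (z.1 - z.2)) M%:R.
have cpsi M : continuous (psi M).
  move=> z; apply: (@continuous_min R V _ (fun=> M%:R) z); last exact: cst_continuous.
  apply: (@continuous_comp _ _ _ (fun z : V => z.1 - z.2)%R (@sqnorm R d)); last exact: sqnorm_continuous.
  by apply: (@continuousB R E V fst snd); [exact: cvg_fst|exact: cvg_snd].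
have psi0 M z : (0 <= psi M z)%R by rewrite le_min sqnorm_ge0 ler0n.
apply: (@fatou_cost_le _ _ gam psi) => //.
  move=> z; apply: cvg_near_cst; exists (Num.truncn (sqnorm (z.1 - z.2))).+1 => // n /= hn.
  rewrite /psi min_l//; apply: ltW; apply: lt_le_trans (truncnS_gt _) _.
  by rewrite ler_nat.
move=> M; have bM : exists B : R, forall z, (`|psi M z| <= B)%R.
  by exists M%:R => z; rewrite ger0_norm// ge_min lexx orbT.
apply: (cvge_le _ (gcvg (cpsi M) bM)); apply: nearW => n.
apply: le_trans (gc n); apply: ge0_le_integral => //.
- by move=> z _; rewrite lee_fin.
- by apply/measurable_EFinP; exact: continuous_measurable_rV2.
- by apply: measurable_fun_sqnorm; exact: measurable_fun_rVB.
- by move=> z _; rewrite lee_fin ge_min lexx.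
Qed.

Lemma weak_cvg_fst (mu0 : probability E R) :
  (forall n A, measurable A -> g n (fst @^-1` A) = mu0 A) ->
  forall A, measurable A -> gam (fst @^-1` A) = mu0 A.
Proof.
move=> gmu A mA.
have [Q QE] := ex_pushforward_probability gam (@measurable_fst _ _ E E).
rewrite -[LHS]/(pushforward gam fst A) -QE.
apply: (@eq_measure_compactly_supported R d Q mu0) => // psi cpsi _ psi01.
have psi0 x : (0 <= psi x)%R by have /andP[] := psi01 x.
have mpsi : measurable_fun setT (fun x => (psi x)%:E).
  by apply/measurable_EFinP; exact: continuous_measurable_rV.
have push (P : probability V R) :
    \int[pushforward P fst]_x (psi x)%:E = \int[P]_z (psi z.1)%:E.
  exact: (ge0_integral_pushforward (@measurable_fst _ _ E E) P measurableT mpsi (fun x _ => psi0 x)).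
have cpsi1 : continuous (fun z : V => psi z.1).
  by move=> z; apply: (@continuous_comp _ _ _ fst psi); [exact: cvg_fst|exact: cpsi].
have b1 : exists M : R, forall z : V, (`|psi z.1| <= M)%R.
  by exists 1%R => z; rewrite ger0_norm//; have /andP[] := psi01 z.1.
have := gcvg cpsi1 b1.
have -> : (fun n => \int[g n]_z (psi z.1)%:E) = fun=> \int[mu0]_x (psi x)%:E.
  apply/funext => n; rewrite -push; apply: eq_measure_integral => B mB _.
  exact: gmu.
move=> h; have <- : \int[gam]_z (psi z.1)%:E = \int[mu0]_x (psi x)%:E.
  exact: (cvg_unique _ h (cvg_cst _)).
rewrite -push.
by rewrite -[LHS]/(\int[(Q : set _ -> \bar R)]_x (psi x)%:E) QE.
Qed.

End weak_limits.

Section single_valued.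
Context (R : realType) (d : nat).
Local Notation E := 'rV[R]_d.
Local Notation V := (E * E)%type.
Variables (G : set V).
Hypothesis mG : monotone_set G.
Hypothesis cG : closed G.

Lemma measurable_fst_closedI (C : set V) : closed C -> measurable (fst @` (G `&` C)).
Proof.
move=> cC; apply: sigma_compact_measurable_rV; apply: sigma_compact_image.
  by move=> z; exact: cvg_fst.
rewrite -[G]setTI; apply: sigma_compact_closedI => //.
by apply: sigma_compact_closedI => //; exact: sigma_compact_rV2.
Qed.

(** For p < q, the points with two images that the rationals separate in coordinate [i]. Points with
    several images thus form a countable union of Borel sets of this kind. *)
Definition split_at (i : 'I_d) (p q : rat) : set E :=
  fst @` (G `&` [set z : V | z.2 ord0 i <= ratr p]) `&`
  fst @` (G `&` [set z : V | ratr q <= z.2 ord0 i]).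

Lemma closed_snd_coord (i : 'I_d) (A : set R) : closed A -> closed [set z : V | A (z.2 ord0 i)].
Proof.
move=> cA; rewrite (_ : [set z | _] = (fun z : V => z.2 ord0 i) @^-1` A) //.
apply: closed_comp => // z _.
apply: (@continuous_comp _ _ _ snd (fun x : E => x ord0 i)); first exact: cvg_snd.
exact: coord_continuous.
Qed.

Lemma measurable_split_at i p q : measurable (split_at i p q).
Proof.
apply: measurableI; apply: measurable_fst_closedI.
  by apply: (@closed_snd_coord i [set y | y <= ratr p]); exact: closed_le.
by apply: (@closed_snd_coord i [set y | ratr q <= y]); exact: closed_ge.
Qed.

(** By monotonicity a line parallel to the i-th axis meets [split_at i p q] at most
    once. *)
Lemma split_at_null i p q : p < q -> (@lebesgue_rV R d).-null_set (split_at i p q).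
Proof.
move=> pq A mA Asub; apply: (@lebesgue_rV_countable_lines _ _ _ i) => // x.
set L := [set s | _].
have Lle s s' : L s -> L s' -> ~ s < s'.
  move=> /Asub[_ [[y b] [Gb /= bq] /= yE]].
  move=> /Asub[[[y' b'] [Gb' /= bp] /= y'E] _] ss'.
  have := mG Gb' Gb; rewrite /cross_dot /= (bigD1 i)//= big1 ?addr0; last first.
    by move=> j ji; rewrite yE y'E !mxE (negPf ji) subrr mul0r.
  rewrite yE y'E !mxE eqxx pmulr_rge0 ?subr_gt0// subr_ge0 => h.
  have : (ratr q : R) <= ratr p by exact: le_trans bq (le_trans h bp).
  by rewrite ler_rat leNgt pq.
have [[s Ls]|nL] := pselect (exists s, L s).
  apply: (@sub_countable _ _ _ [set s]); last exact: countable1.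
  apply: subset_card_le => s' Ls' /=; apply/eqP; rewrite eq_le.
  by apply/andP; split; rewrite leNgt; apply/negP; exact: Lle.
rewrite (_ : L = set0); first exact: countable0.
by apply/seteqP; split => // s Ls; apply: nL; exists s.
Qed.

Lemma single_valued_ae (mu0 : probability E R) : mu0 `<< @lebesgue_rV R d ->
  mu0.-negligible [set x | exists b b', [/\ G (x, b), G (x, b') & b <> b']].
Proof.
move=> hac.
pose F (k : nat) : set E :=
  if (unpickle k : option ('I_d * (rat * rat))) is Some (i, (p, q))
  then (if p < q then split_at i p q else set0) else set0.
apply: (@negligibleS _ _ _ _ (\bigcup_k F k)).
  move=> x [b [b' [Gb Gb' bb']]].
  have [i bi] : exists i, b ord0 i != b' ord0 i.
    apply/not_existsP => h; apply: bb'; apply/rowP => i; apply/eqP.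
    by have /negP := h i; rewrite negbK.
  have sub (c c' : E) : G (x, c) -> G (x, c') -> c ord0 i < c' ord0 i ->
      (\bigcup_k F k) x.
    move=> Gc Gc' cc'.
    have [p] := rat_in_itvoo cc'; rewrite in_itv/= => /andP[cp pc'].
    have [q] := rat_in_itvoo pc'; rewrite in_itv/= => /andP[pq qc'].
    exists (@pickle ('I_d * (rat * rat))%type (i, (p, q))); first exact: I.
    rewrite /F pickleK; rewrite ltr_rat in pq; rewrite pq; split.
      by exists (x, c) => //; split => //=; exact: ltW.
    by exists (x, c') => //; split => //=; exact: ltW.
  by move: bi; rewrite neq_lt => /orP[]; exact: sub.
apply: negligible_bigcup => k; rewrite /F.
case: unpickle => [[i [p q]]|]; last exact: negligible_set0.
case: ifPn => pq; last exact: negligible_set0.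
apply/negligibleP; first exact: measurable_split_at.
by have := hac _ (@split_at_null i p q pq); apply => //; exact: measurable_split_at.
Qed.

End single_valued.

(** * Limit points of the reflow iteration *)

Section limit_point.
Context (R : realType) (d N : nat) (N2 : (2 <= N)%N).
Local Notation E := 'rV[R]_d.
Local Notation V := (E * E)%type.
Variables (mu0 mu1 : probability E R) (S : minibatch_selection R d N).
Variables (g : nat -> probability V R) (gam : probability V R).
Hypothesis hg : forall n, coupling mu0 mu1 (g n).
Hypothesis hreflow : forall n, weak_rectified (minibatch_ot S (g n)) (g n.+1).
Hypothesis hgam : weak_limit_point g gam.
Hypothesis hac : mu0 `<< @lebesgue_rV R d.

Let N0 : (0 < N)%N. Proof. exact: ltnW. Qed.

Lemma coupling_cost (m : probability V R) : coupling mu0 mu1 m -> (cost m < +oo)%E.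
Proof.
move=> [fin _ _]; apply: (@le_lt_trans _ _
  (\int[m]_z (2%:E * (sqnorm z.1 + sqnorm z.2)%:E))%E).
  apply: ge0_le_integral => //.
  - by move=> z _; rewrite lee_fin sqnorm_ge0.
  - by apply: measurable_fun_sqnorm; exact: measurable_fun_rVB.
  - apply: emeasurable_funM => //; apply/measurable_EFinP; apply: measurable_funD;
      exact: (measurableT_comp (@measurable_sqnorm R d)).
  - move=> z _; rewrite -EFinM lee_fin /sqnorm -big_split/= mulr_sumr.
    by apply: ler_sum => i _; rewrite !mxE; have := sqr_ge0 (z.1 ord0 i + z.2 ord0 i); nra.
rewrite ge0_integralZl_EFin//.
- by rewrite lte_mul_pinfty.
- by move=> z _; rewrite lee_fin addr_ge0// sqnorm_ge0.
- apply/measurable_EFinP; apply: measurable_funD;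
    exact: (measurableT_comp (@measurable_sqnorm R d)).
Qed.

Lemma reflow_limit_point :
  [/\ cyclically_monotone N gam, rectifiable gam & straight gam].
Proof.
have [k [kmono kcvg]] := hgam.
have J0 : (cost (g 0%N) < +oo)%E by exact: coupling_cost (hg 0%N).
have cm : cyclically_monotone N gam.
  exact: (reflow_limit_cyclically_monotone N0 hreflow J0 kmono kcvg).
pose G := Defs.support gam.
have mG : monotone_set G by exact: cyclically_monotone_support N2 cm.
have cG : closed G by exact: closed_support.
have measG : measurable G by exact: measurable_support.
have gamG : gam (~` G) = 0%E by exact: support_negligible.
have fin : (cost gam < +oo)%E.
  apply: le_lt_trans (weak_cvg_cost_le kcvg _) J0 => n /=.
  exact: (reflow_cost_nonincreasing N0 hreflow).
have vf := velocity_monotone_field mG cG measG gamG fin.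
have loss := fm_loss_monotone_field mG cG measG gamG.
split => //; last by exists (monotone_field G).
exists (monotone_field G) => //.
(* [rectifiable] speaks of the first marginal of [gam], absolute continuity of [mu0]; the marginal
   constraint passes to the weak limit. *)
have fst_gam : forall A, measurable A -> gam (fst @^-1` A) = mu0 A.
  by apply: (weak_cvg_fst kcvg) => n A mA; have [_ h _] := hg (k n); exact: h.
have [B [mB B0 Bsub]] := single_valued_ae mG cG hac.
have mF : measurable (fst @` G).
  by rewrite -[G]setIT; apply: measurable_fst_closedI => //; exact: closedT.
(* A starting point is bad if it has several images or none. The second case is null because [gam]
   is carried by [G]. *)
exists (B `|` ~` (fst @` G)); split.
- by apply: measurableU => //; exact: measurableC.
- have mU : measurable (B `|` ~` (fst @` G)) by apply: measurableU => //; exact: measurableC.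
  have mpre (A : set E) : measurable A -> measurable ((fst @^-1` A) : set V).
    by move=> mA; rewrite -[X in measurable X]setTI; exact: measurable_fst.
  rewrite /pushforward; apply: (@negligibleP _ _ _ gam _ _).1; first exact: mpre.
  rewrite preimage_setU; apply: negligibleU.
    by apply/negligibleP; [exact: mpre|exact: etrans (fst_gam _ mB) B0].
  apply: (@negligibleS _ _ _ _ (~` G)); last by apply/negligibleP => //; exact: measurableC.
  by move=> z /= nz Gz; apply: nz; exists z.
- move=> x /= nu; apply: contrapT => /not_orP[nB /contrapT[[y b] Gb /= yx]].
  apply: nu; rewrite -yx.
  apply: (flow_solution_unique mG cG Gb) => -[y' b'] Gb' /= yy.
  congr (_, _) => //; apply: contrapT => bb; apply: nB; apply: Bsub; exists b', b.
  by rewrite -yx -{1}yy.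
Qed.

End limit_point.

Theorem corollary12 (R : realType) (d N : nat) (hN : (2 <= N)%N)
    (mu0 mu1 : probability 'rV[R]_d R)
    (hmu0 : second_moment_finite mu0) (hmu1 : second_moment_finite mu1)
    (S : minibatch_selection R d N)
    (g : nat -> probability ('rV[R]_d * 'rV[R]_d)%type R)
    (hg : forall n, coupling mu0 mu1 (g n))
    (hreflow : forall n, weak_rectified (minibatch_ot S (g n)) (g n.+1))
    (gam : probability ('rV[R]_d * 'rV[R]_d)%type R)
    (hgam : weak_limit_point g gam)
    (hac : mu0 `<< @lebesgue_rV R d) :
  [/\ cyclically_monotone N gam, rectifiable gam & straight gam].
Proof. exact: (reflow_limit_point hN hg hreflow hgam hac). Qed.
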